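(* Let $\Omega\subset\mathbb R^n$ be open, non-empty, bounded and let $q\in L^\infty(\Omega)$. Let $s\in(0,1)$ and let $$L(D)u(x)=\int_{\mathbb R^n}\big(2u(x)-u(x+y)-u(x-y)\big)\frac{a(y/|y|)}{|y|^{n+2s}}\,dy,$$ where $a:\mathbb S^{n-1}\to\mathbb R$ satisfies conditions (A1)–(A3) of the context, with associated cone $\mathcal C$. Suppose that $q$ is such that the Dirichlet problem $$(L(D)+q)u=0\ \text{ in }\Omega,\qquad u=f\ \text{ on }\mathcal C(\Omega)\setminus\overline\Omega$$ is well-posed and gives rise to a well-defined Poisson operator $P_q:H^s(\mathcal C(\Omega)\setminus\overline\Omega)\to H^s(\mathcal C(\Omega))$. Assume in addition that $L(D)$ is $(-\mathcal C\cup\mathcal C)$-antilocal. Let $W$ be an open set such that $W\subset\mathcal C(\Omega)\setminus\overline\Omega$ and $\Omega\subset\mathcal C(W)$. Then the set $$\mathcal R:=\{u=P_qf|_\Omega:\ f\in C_c^\infty(W)\}$$ is dense in $\widetilde H^s(\Omega)$.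
   Context: All functions are real-valued. A cone is a set closed under multiplication by $t>0$; for a set $U$, $\mathcal C(U):=U+(-\mathcal C\cup\mathcal C)$. Conditions on $a$: (A1) $a\in L^1(\mathbb S^{n-1})$ and $\int_{\mathbb S^{n-1}}|\xi\cdot\theta|^{2s}a(\theta)\,d\theta>0$ for all $\xi\in\mathbb R^n\setminus\{0\}$; (A2) $a(\theta)=a(-\theta)\ge0$ for all $\theta$; (A3) there is a convex, open, non-empty cone $\mathcal C\subset\mathbb R^n\setminus\{0\}$ such that $a(\theta)\neq0$ if and only if $\theta\in(-\mathcal C\cup\mathcal C)\cap\mathbb S^{n-1}$. Sobolev spaces: $H^s(\mathbb R^n)$ is the usual $L^2$-based space; for open $U$, $H^s(U)$ consists of restrictions to $U$ of elements of $H^s(\mathbb R^n)$ with the quotient norm; $\widetilde H^s(U)$ is the closure of $C_c^\infty(U)$ in $H^s(\mathbb R^n)$. $\mathcal E_Uu$ is the extension of $u:U\to\mathbb R$ by zero. Bilinear form: $$B_q(u,v)=\frac12\int_{\mathcal C(\Omega)}\int_{\mathcal C(\Omega)}(u(x)-u(y))(v(x)-v(y))\frac{a\big(\frac{x-y}{|x-y|}\big)}{|x-y|^{n+2s}}\,dy\,dx+\int_\Omega quv\,dx .$$ Weak solution for $f\in H^s(\mathcal C(\Omega)\setminus\overline\Omega)$: $u\in H^s(\mathcal C(\Omega))$ with $B_q(u,v)=0$ for all $v\in\widetilde H^s(\Omega)$ and $\mathcal E_{\mathcal C(\Omega)}(u-\tilde f)\in\widetilde H^s(\Omega)$ for any $\tilde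 f\in H^s(\mathcal C(\Omega))$ with $\tilde f|_{\mathcal C(\Omega)\setminus\overline\Omega}=f$. Well-posedness: for every $f$ there is a unique weak solution $u=:P_qf$, with $\|u\|_{H^s(\mathcal C(\Omega))}\le C\|f\|_{H^s(\mathcal C(\Omega)\setminus\overline\Omega)}$. $P_qf|_\Omega$ is identified with its extension by zero outside $\Omega$. Antilocality: $L(D)$ is $(-\mathcal C\cup\mathcal C)$-antilocal if, whenever $f\in C_c^\infty(\mathbb R^n)$ and $f=L(D)f=0$ in an open non-empty set $U$, then $f=0$ in $U+(-\mathcal C\cup\mathcal C)$. *)

(* Defs.v *)
From HB Require Import structures.
From mathcomp Require Import all_boot all_order all_algebra.
From mathcomp Require Import all_classical all_reals all_analysis.
From mathcomp Require Import measurable_realfun.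

Set Implicit Arguments.
Unset Strict Implicit.
Unset Printing Implicit Defensive.

Import Order.TTheory GRing.Theory Num.Theory.
Import numFieldNormedType.Exports.

Local Open Scope classical_set_scope.
Local Open Scope ring_scope.

Definition rV_display : measure_display -> measure_display.
Proof. exact. Qed.

(* The sigma-algebra generated by the coordinate maps, i.e. the Borel one. *)
Section measurable_rV.
Context {R : realType} {n : nat}.

Definition rV_coord (i : 'I_n) (x : 'rV[R]_n) : measurableTypeR R := x ord0 i.

Let rV_set0 : g_sigma_preimage rV_coord set0.
Proof. exact: sigma_algebra0. Qed.

Let rV_setC A : g_sigma_preimage rV_coord A -> g_sigma_preimage rV_coord (~` A).
Proof. exact: sigma_algebraC. Qed.

Let rV_bigcup (F : (set 'rV[R]_n)^nat) :
  (forall i, g_sigma_preimage rV_coord (F i)) ->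
  g_sigma_preimage rV_coord (\bigcup_i (F i)).
Proof. exact: sigma_algebra_bigcup. Qed.

HB.instance Definition _ := @isMeasurable.Build
  (rV_display default_measure_display)
  'rV[R]_n (g_sigma_preimage rV_coord) rV_set0 rV_setC rV_bigcup.

Lemma measurable_rV_coord (i : 'I_n) :
  measurable_fun [set: 'rV[R]_n] (fun x => x ord0 i).
Proof.
move=> _ Y mY; rewrite setTI; apply: sub_sigma_algebra => /=.
rewrite -bigcup_seq/=; exists i => /=; first by rewrite mem_index_enum.
by exists Y => //; rewrite setTI.
Qed.

Lemma measurable_fun_rVP d (T : measurableType d) (f : T -> 'rV[R]_n) :
  (forall i, measurable_fun [set: T] (fun t => f t ord0 i)) ->
  measurable_fun [set: T] f.
Proof.
move=> mf _ Y; rewrite setTI.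
apply: (@smallest_sub _ _ _ [set Y | measurable (f @^-1` Y)]) => /=.
  split => /=.
  - by rewrite preimage_set0; exact: measurable0.
  - by move=> A mA; rewrite setTD -preimage_setC; exact: measurableC.
  - by move=> F mF; rewrite preimage_bigcup; exact: bigcup_measurable.
rewrite -bigcup_seq/= => A [i _] [B mB <-]; rewrite setTI.
rewrite /= -comp_preimage -[X in measurable X]setTI.
exact: mf.
Qed.

End measurable_rV.

(* Lebesgue measure on R^n, by recursion on n:  L_0 is the Dirac mass at the
   point and L_(n+1) is the image of lebesgue_measure x L_n. *)
Section lebesgue_rV_step.
Context {R : realType} (n : nat).

Definition rV_cons (p : measurableTypeR R * 'rV[R]_n) : 'rV[R]_n.+1 :=
  row_mx (const_mx p.1 : 'rV_1) p.2.

Definition rV_uncons (x : 'rV[R]_n.+1) : measurableTypeR R * 'rV[R]_n :=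
  (x ord0 ord0, rsubmx (x : 'rV_(1 + n))).

Lemma rV_cons0 p : rV_cons p ord0 ord0 = p.1.
Proof.
have -> : (ord0 : 'I_n.+1) = lshift n (ord0 : 'I_1) by exact/val_inj.
by apply: etrans (row_mxEl _ _ _ _) _; rewrite mxE.
Qed.

Lemma rV_consS p i : rV_cons p ord0 (rshift 1 i) = p.2 ord0 i.
Proof. exact: row_mxEr. Qed.

Lemma rV_consK : cancel rV_cons rV_uncons.
Proof.
by move=> [x v]; rewrite /rV_uncons rV_cons0; congr pair; exact: row_mxKr.
Qed.

Lemma measurable_rV_cons : measurable_fun setT rV_cons.
Proof.
apply: measurable_fun_rVP => i.
case: (split_ordP (i : 'I_(1 + n))) => j ->.
  rewrite (ord1 j) (_ : lshift n (ord0 : 'I_1) = (ord0 : 'I_n.+1)); last exact/val_inj.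
  by under eq_fun do rewrite rV_cons0; exact: measurable_fst.
under eq_fun do rewrite rV_consS.
by apply: (measurableT_comp (measurable_rV_coord j)); exact: measurable_snd.
Qed.

Lemma measurable_rV_uncons : measurable_fun setT rV_uncons.
Proof.
apply: measurable_fun_pair; first exact: measurable_rV_coord.
apply: measurable_fun_rVP => i.
rewrite (_ : (fun _ => _) =
    (fun x : 'rV[R]_n.+1 => x ord0 (rshift 1 i : 'I_n.+1))).
  exact: measurable_rV_coord.
by apply/funext => p; rewrite mxE.
Qed.

Variable m : {sigma_finite_measure set 'rV[R]_n -> \bar R}.

Definition lebesgue_rV_step : set 'rV[R]_n.+1 -> \bar R :=
  pushforward (lebesgue_measure \x m)%E rV_cons.

Let step0 : lebesgue_rV_step set0 = 0%E.
Proof. by rewrite /lebesgue_rV_step /pushforward preimage_set0 measure0. Qed.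

Let step_ge0 A : (0 <= lebesgue_rV_step A)%E.
Proof. by rewrite /lebesgue_rV_step /pushforward; exact: measure_ge0. Qed.

Let step_sigma_additive : semi_sigma_additive lebesgue_rV_step.
Proof.
apply: measure_semi_sigma_additive; exact: measurable_rV_cons.
Qed.

HB.instance Definition _ := isMeasure.Build _ _ _ lebesgue_rV_step
  step0 step_ge0 step_sigma_additive.

Let step_sigma_finite : sigma_finite setT lebesgue_rV_step.
Proof.
have /sigma_finiteP[F [TF ndF Foo]] := sigma_finiteT (@lebesgue_measure R).
have /sigma_finiteP[G [TG ndG Goo]] := sigma_finiteT m.
exists (fun k => rV_uncons @^-1` (F k `*` G k)) => [|k].
  apply/esym; rewrite -subTset => x _.
  have [i _ Fi] : (\bigcup_k F k) (rV_uncons x).1 by rewrite -TF.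
  have [j _ Gj] : (\bigcup_k G k) (rV_uncons x).2 by rewrite -TG.
  exists (maxn i j) => //; split.
    by move: Fi; exact/subsetPset/ndF/leq_maxl.
  by move: Gj; exact/subsetPset/ndG/leq_maxr.
have [mF Fk] := Foo k; have [mG Gk] := Goo k.
have mFG : measurable (F k `*` G k) by exact: measurableX.
split; first by rewrite -[X in measurable X]setTI; exact: measurable_rV_uncons.
rewrite /lebesgue_rV_step /pushforward -comp_preimage.
rewrite (_ : rV_uncons \o rV_cons = id); last exact/funext/rV_consK.
by rewrite preimage_id product_measure1E// lte_mul_pinfty// ge0_fin_numE.
Qed.

HB.instance Definition _ := Measure_isSigmaFinite.Build _ _ _
  lebesgue_rV_step step_sigma_finite.

End lebesgue_rV_step.

Fixpoint lebesgue_rV {R : realType} (n : nat) :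
    {sigma_finite_measure set 'rV[R]_n -> \bar R} :=
  match n with
  | 0 => [the {sigma_finite_measure set 'rV[R]_0 -> \bar R} of
           dirac (0 : 'rV[R]_0)]
  | m.+1 => [the {sigma_finite_measure set 'rV[R]_m.+1 -> \bar R} of
           lebesgue_rV_step (lebesgue_rV m)]
  end.

(* The norm of the library on 'rV[R]_n is the sup norm: it has the right
   topology, but the Euclidean norm has to be introduced. *)
Definition dotv {R : realType} {n : nat} (x y : 'rV[R]_n) : R :=
  \sum_(i < n) x ord0 i * y ord0 i.

Definition enorm {R : realType} {n : nat} (x : 'rV[R]_n) : R :=
  Num.sqrt (dotv x x).

Definition sphere {R : realType} {n : nat} : set 'rV[R]_n :=
  [set x | enorm x = 1].

Definition udir {R : realType} {n : nat} (x : 'rV[R]_n) : 'rV[R]_n :=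
  (enorm x)^-1 *: x.

Definition punctured_ball {R : realType} {n : nat} : set 'rV[R]_n :=
  [set x | 0 < enorm x <= 1].

Lemma measurable_enorm {R : realType} {n : nat} :
  measurable_fun setT (@enorm R n).
Proof.
rewrite (_ : enorm = (@powR R)^~ 2^-1 \o (fun x => dotv x x)); last first.
  apply/funext => x /=; rewrite powR12_sqrt//.
  by apply: sumr_ge0 => i _; exact: sqr_ge0.
apply: measurableT_comp; first exact: measurable_powR.
apply: measurable_sum => i.
by apply: measurable_funM; exact: measurable_rV_coord.
Qed.

Lemma measurable_udir {R : realType} {n : nat} : measurable_fun setT (@udir R n).
Proof.
apply: measurable_fun_rVP => i; rewrite /udir.
under eq_fun do rewrite mxE.
apply: measurable_funM; last exact: measurable_rV_coord.
rewrite (_ : (fun _ => _) = (@powR R)^~ (-1) \o enorm); last first.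
  by apply/funext => x /=; rewrite powR_inv1// sqrtr_ge0.
by apply: measurableT_comp; [exact: measurable_powR|exact: measurable_enorm].
Qed.

Lemma measurable_punctured_ball {R : realType} {n : nat} :
  measurable (@punctured_ball R n).
Proof.
rewrite (_ : punctured_ball = setT `&` enorm @^-1` `]0, 1]).
  exact: measurable_enorm.
by rewrite setTI; apply/seteqP; split=> x /=; rewrite in_itv.
Qed.

(* Surface measure on the unit sphere, as a measure on R^n:
   sigma(A) = n |{x | 0 < |x| <= 1 and x / |x| \in A}|. *)
Section sphere_measure.
Context {R : realType} (n : nat).

Definition cone_measure : set 'rV[R]_n -> \bar R :=
  pushforward (mrestr (lebesgue_rV n) measurable_punctured_ball) udir.

Let cone0 : cone_measure set0 = 0%E.
Proof. by rewrite /cone_measure /pushforward preimage_set0 measure0. Qed.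

Let cone_ge0 A : (0 <= cone_measure A)%E.
Proof. by rewrite /cone_measure /pushforward; exact: measure_ge0. Qed.

Let cone_sigma_additive : semi_sigma_additive cone_measure.
Proof. by apply: measure_semi_sigma_additive; exact: measurable_udir. Qed.

HB.instance Definition _ := isMeasure.Build _ _ _ cone_measure
  cone0 cone_ge0 cone_sigma_additive.

Definition sphere_measure : {measure set 'rV[R]_n -> \bar R} :=
  mscale (n%:R%:nng : {nonneg R}) cone_measure.

End sphere_measure.

Section cones.
Context {R : realType} {n : nat}.
Implicit Types (C U : set 'rV[R]_n).

Definition is_cone C := forall (t : R) x, 0 < t -> C x -> C (t *: x).

Definition sym_cone C : set 'rV[R]_n := (-%R @` C) `|` C.

(* U + (-C u C) *)
Definition cone_nbhd C U : set 'rV[R]_n :=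
  [set x + y | x in U & y in sym_cone C].

End cones.

(* a is a function on the unit sphere: its values elsewhere are junk. *)
Section conditions.
Context {R : realType} {n : nat}.
Implicit Types (s : R) (a : 'rV[R]_n -> R) (C : set 'rV[R]_n).

Definition condA1 s a :=
  (sphere_measure n).-integrable sphere (EFin \o a) /\
  forall xi : 'rV[R]_n, xi != 0 ->
    0 < \int[sphere_measure n]_(t in sphere) (`|dotv xi t| `^ (2 * s) * a t).

Definition condA2 a :=
  forall t, sphere t -> a t = a (- t) /\ 0 <= a t.

Definition condA3 a C :=
  [/\ convex_set C, open C, C !=set0, is_cone C & ~ C 0] /\
  forall t, sphere t -> (a t <> 0 <-> sym_cone C t).

End conditions.

Section function_spaces.
Context {R : realType} {n : nat}.
Implicit Types (s : R) (U : set 'rV[R]_n) (u w f phi : 'rV[R]_n -> R).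

Fixpoint Ck (k : nat) f : Prop :=
  match k with
  | 0 => continuous f
  | j.+1 => continuous f /\
      forall i : 'I_n, (forall x, derivable f x (delta_mx ord0 i)) /\
        Ck j (fun x => 'D_(delta_mx ord0 i) f x)
  end.

Definition supp f : set 'rV[R]_n := closure [set x | f x != 0].

Definition Ccinf U : set ('rV[R]_n -> R) :=
  [set f | [/\ forall k, Ck k f, compact (supp f) & supp f `<=` U]].

Definition gagliardo s u : \bar R :=
  (\int[lebesgue_rV n \x lebesgue_rV n]_z
    ((u z.1 - u z.2) ^+ 2 / enorm (z.1 - z.2) `^ (n%:R + 2 * s))%:E)%E.

(* H^s(R^n) for 0 < s < 1, with the Sobolev-Slobodeckij norm.  Elements of the
   spaces below are Borel representatives, to be identified when they are equal
   almost everywhere. *)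
Definition Hs s : set ('rV[R]_n -> R) :=
  [set u | u \in Lfun (lebesgue_rV n) 2%:E /\ (gagliardo s u < +oo)%E].

Definition Hs_norm s u : R :=
  Num.sqrt (\int[lebesgue_rV n]_x (u x ^+ 2) + fine (gagliardo s u)).

Definition Hs_ext s U u : set ('rV[R]_n -> R) :=
  [set w | Hs s w /\ w = u %[ae lebesgue_rV n in U]].

(* H^s(U): only the values of u on U matter. *)
Definition HsOn s U : set ('rV[R]_n -> R) :=
  [set u | measurable_fun U u /\ Hs_ext s U u !=set0].

Definition HsOn_norm s U u : R := inf [set Hs_norm s w | w in Hs_ext s U u].

Definition tHs s U : set ('rV[R]_n -> R) :=
  [set u | Hs s u /\ forall e, 0 < e ->
     exists2 phi, Ccinf U phi & Hs_norm s (u \- phi) < e].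

(* Density in X, for the H^s(R^n) norm, of a subset D of X. *)
Definition Hs_dense s (X D : set ('rV[R]_n -> R)) :=
  D `<=` X /\ forall w, X w -> forall e, 0 < e ->
    exists2 u, D u & Hs_norm s (w \- u) < e.

End function_spaces.

Section operator.
Context {R : realType} {n : nat}.
Variables (s : R) (a : 'rV[R]_n -> R) (C : set 'rV[R]_n).
Implicit Types (Omega : set 'rV[R]_n) (q u v f : 'rV[R]_n -> R).

Definition kern (y : 'rV[R]_n) : R := a (udir y) / enorm y `^ (n%:R + 2 * s).

Definition LD u (x : 'rV[R]_n) : R :=
  \int[lebesgue_rV n]_y ((2 * u x - u (x + y) - u (x - y)) * kern y).

Definition antilocal :=
  forall f, Ccinf setT f -> forall U : set 'rV[R]_n, open U -> U !=set0 ->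
    (forall x, U x -> f x = 0 /\ LD f x = 0) ->
    forall x, cone_nbhd C U x -> f x = 0.

Definition Bq q Omega u v : R :=
  2^-1 * \int[(lebesgue_rV n \x lebesgue_rV n)%E]_(z in
             cone_nbhd C Omega `*` cone_nbhd C Omega)
           ((u z.1 - u z.2) * (v z.1 - v z.2) * kern (z.1 - z.2))
  + \int[lebesgue_rV n]_(x in Omega) (q x * u x * v x).

Definition exterior Omega : set 'rV[R]_n :=
  cone_nbhd C Omega `\` closure Omega.

(* g \_ A is the extension by zero of the restriction of g to A. *)
Definition weak_solution q Omega f u :=
  [/\ HsOn s (cone_nbhd C Omega) u,
      forall v, tHs s Omega v -> Bq q Omega u v = 0 &
      forall ft, HsOn s (cone_nbhd C Omega) ft ->
        ft = f %[ae lebesgue_rV n in exterior Omega] ->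
        tHs s Omega ((u \- ft) \_ (cone_nbhd C Omega))].

Definition well_posed q Omega :=
  (forall f, HsOn s (exterior Omega) f ->
    exists u, weak_solution q Omega f u /\
      forall u', weak_solution q Omega f u' ->
        u' = u %[ae lebesgue_rV n in cone_nbhd C Omega]) /\
  exists K : R, forall f u,
    HsOn s (exterior Omega) f -> weak_solution q Omega f u ->
    HsOn_norm s (cone_nbhd C Omega) u <= K * HsOn_norm s (exterior Omega) f.

Definition poisson_operator q Omega (P : ('rV[R]_n -> R) -> 'rV[R]_n -> R) :=
  forall f, HsOn s (exterior Omega) f -> weak_solution q Omega f (P f).

End operator.

Definition runge_set {R : realType} {n : nat} (Omega W : set 'rV[R]_n)
    (P : ('rV[R]_n -> R) -> 'rV[R]_n -> R) : set ('rV[R]_n -> R) :=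
  [set (P f) \_ Omega | f in Ccinf W].

(* Main.v *)
Require Import Defs.
From mathcomp Require Import all_boot all_order all_algebra.
From mathcomp Require Import all_classical all_reals all_analysis.
From mathcomp Require Import measurable_realfun ess_sup_inf ring lra.

(* Write A(u, v) for the form B_q and V for the closure of C_c^oo(Omega) in H^s.
   Since the kernel charges an open cone, its energy dominates the Gagliardo
   seminorm up to a constant: every z is a sum w + (z - w) with w and z - w of
   size comparable to |z| and in good directions of the cone, and averaging
   |u(x+z) - u(x)|^2 <= 2|u(x+w) - u(x)|^2 + 2|u(x+z) - u(x+w)|^2
   over such w is enough.  A fractional Poincare inequality on small cells then
   makes D = A + sum_i p_i (x) p_i, with finitely many averages p_i, an inner
   product on V equivalent to that of H^s.

   For f in C_c^oo(W) the restriction of P f to Omega is the element w of V with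
   A(w, v) = - A(f, v) for all v in V.  As A is a finite rank perturbation of D
   and is injective by well-posedness, the density of these w follows once
   A(phi, w) = 0 for all of them forces phi = 0.  That condition says that
   A(f, phi) = 0 for all f in C_c^oo(W).  Taking for f a translate of a mollifier
   theta shows that theta * phi and L(D)(theta * phi) both vanish on an open
   subset of W, so theta * phi = 0 on Omega by antilocality, and phi = 0. *)

Set Implicit Arguments.
Unset Strict Implicit.
Unset Printing Implicit Defensive.

Import Order.TTheory GRing.Theory Num.Theory.
Import numFieldNormedType.Exports.

Local Open Scope classical_set_scope.
Local Open Scope ring_scope.

(** * Lebesgue measure on R^n *)

Section lebesgue_rV_invariance.
Context {R : realType}.
Local Open Scope ereal_scope.
Implicit Types n : nat.

(** Three obstacles shape the argument. The weight [a] is only integrable on the sphere: it may be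
    unbounded, and on the cone it is positive without a positive lower bound. So neither of the
    kernels |z|^(-n-2s) and [kern s a z] has to dominate the other pointwise, and the comparison of
    energies, needed in both directions, passes through averages of L^2 increments. The potential
    [q] has no sign, so A need not be coercive; the cell averages stand in for a compact embedding
    and reduce the Fredholm alternative to the invertibility of one finite matrix, for which
    uniqueness of weak solutions is enough. Antilocality concerns test functions only, whereas the
    function phi to be annihilated is just an element of V; it is mollified, and since W and Omega
    are disjoint the mollification vanishes on small balls inside W, where L(D) of it is an
    absolutely convergent integral that can be identified with a value of A. *)

Lemma lebesgue_measure_affine (c t : R) (f : measurableTypeR R -> \bar R) :
  c != 0%R -> measurable_fun setT f -> (forall x, 0 <= f x) ->
  \int[lebesgue_measure]_x f (c * x + t)%R =
  (`|c|^-1)%:E * \int[lebesgue_measure]_x f x.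
Proof.
move=> c0 mf f0.
have nc0 : (0 < `|c|)%R by rewrite normr_gt0.
pose phi : measurableTypeR R -> measurableTypeR R := (fun x : R => c * x + t)%R.
have mphi : measurable_fun setT phi.
  by apply: measurable_funD => //; exact: measurable_funM.
(* |c| times the image of Lebesgue measure under [phi] agrees with Lebesgue measure on half-open
   intervals, hence on all Borel sets. For negative c the preimage of a half-open interval is closed
   at the other end. *)
pose m' := mscale (NngNum (normr_ge0 c)) (pushforward lebesgue_measure phi).
have m'E A : measurable A -> lebesgue_measure A = m' mphi A.
  apply: lebesgue_measure_unique => X [[a b] _ /= <-].
  rewrite /m' /mscale /= /pushforward lebesgue_measure_itv /= lte_fin.
  have [cp|cn|c00] := ltgtP c 0%R; last by rewrite c00 eqxx in c0.
    rewrite (_ : phi @^-1` _ = `[((b - t) / c)%R, ((a - t) / c)%R[%classic); last first.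
      apply/seteqP; split=> x; rewrite /phi /= !in_itv /=.
        by rewrite ler_ndivrMr// ltr_ndivlMr// => /andP[? ?]; apply/andP; split; nra.
      by rewrite ler_ndivrMr// ltr_ndivlMr// => /andP[? ?]; apply/andP; split; nra.
    rewrite lebesgue_measure_itv /= lte_fin ltr_ndivrMr// divfK ?lt_eqF//.
    rewrite ltrD2r; case: ifPn => _; last by rewrite mule0.
    rewrite -!EFinB -EFinM; congr EFin; rewrite ltr0_norm//; field.
    by rewrite lt_eqF.
  rewrite (_ : phi @^-1` _ = `]((a - t) / c)%R, ((b - t) / c)%R]%classic); last first.
    apply/seteqP; split=> x; rewrite /phi /= !in_itv /=.
      by rewrite ler_pdivlMr// ltr_pdivrMr// => /andP[? ?]; apply/andP; split; nra.
    by rewrite ler_pdivlMr// ltr_pdivrMr// => /andP[? ?]; apply/andP; split; nra.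
  rewrite lebesgue_measure_itv /= lte_fin ltr_pdivrMr// divfK ?gt_eqF//.
  rewrite ltrD2r; case: ifPn => _; last by rewrite mule0.
  rewrite -!EFinB -EFinM; congr EFin; rewrite gtr0_norm//; field.
  by rewrite gt_eqF.
rewrite (@eq_measure_integral _ _ _ _ (m' mphi) lebesgue_measure f); last first.
  by move=> A mA _; exact: m'E.
rewrite ge0_integral_mscale//= muleA -EFinM mulVf ?gt_eqF// mul1e.
by rewrite ge0_integral_pushforward.
Qed.

Lemma integral_lebesgue_rVS n (f : 'rV[R]_n.+1 -> \bar R) :
  measurable_fun setT f -> (forall x, 0 <= f x) ->
  \int[lebesgue_rV n.+1]_x f x =
  \int[lebesgue_measure]_x \int[lebesgue_rV n]_v f (rV_cons (x, v)).
Proof.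
move=> mf f0.
rewrite /= (_ : \int[_]_x f x =
    \int[pushforward (lebesgue_measure \x lebesgue_rV n) (@rV_cons R n)]_x f x)//.
rewrite (ge0_integral_pushforward (@measurable_rV_cons R n))//.
rewrite fubini_tonelli1//=.
by apply: measurableT_comp => //; exact: (@measurable_rV_cons R n).
Qed.

Lemma rV_unconsK n : cancel (@rV_uncons R n) (@rV_cons R n).
Proof.
move=> x; rewrite /rV_cons /=.
have -> : const_mx (x ord0 ord0) = lsubmx (x : 'rV_(1 + n)).
  by apply/matrixP => i j; rewrite !mxE !ord1; congr (x _ _); exact/val_inj.
exact: (@hsubmxK _ 1 1 n x).
Qed.

Lemma rV_consD n (x y : R) (v w : 'rV[R]_n) :
  rV_cons (x + y, v + w)%R = (rV_cons (x, v) + rV_cons (y, w))%R.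
Proof.
apply: (can_inj (@rV_unconsK n)); rewrite rV_consK /rV_uncons.
congr pair; first by rewrite mxE !rV_cons0.
apply/rowP => j; rewrite [RHS]mxE.
by rewrite (mxE _ (fun i k => rV_cons (x, v) i k + rV_cons (y, w) i k)%R) !rV_consS mxE.
Qed.

Lemma rV_consZ n (c x : R) (v : 'rV[R]_n) :
  rV_cons (c * x, c *: v)%R = (c *: rV_cons (x, v))%R.
Proof.
apply: (can_inj (@rV_unconsK n)); rewrite rV_consK /rV_uncons.
congr pair; first by rewrite mxE !rV_cons0.
apply/rowP => j; rewrite [RHS]mxE.
by rewrite (mxE _ (fun i k => c * rV_cons (x, v) i k)%R) !rV_consS mxE.
Qed.

Lemma measurable_rV_affine n (c : R) (h : 'rV[R]_n) :
  measurable_fun setT (fun x : 'rV[R]_n => c *: x + h)%R.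
Proof.
apply: measurable_fun_rVP => i.
under eq_fun do rewrite !mxE.
apply: measurable_funD => //; apply: measurable_funM => //.
exact: measurable_rV_coord.
Qed.

(** Induction on the dimension: Tonelli splits off the first coordinate, the induction hypothesis
    treats the remaining n coordinates, and the one-dimensional change of variables supplies the
    last factor 1/|c|. *)
Lemma integral_rV_affine n (c : R) (h : 'rV[R]_n) (f : 'rV[R]_n -> \bar R) :
  c != 0%R -> measurable_fun setT f -> (forall x, 0 <= f x) ->
  \int[lebesgue_rV n]_x f (c *: x + h)%R =
  ((`|c| ^+ n)^-1)%:E * \int[lebesgue_rV n]_x f x.
Proof.
move=> c0; elim: n => [|n IH] in h f *.
  move=> mf f0; rewrite expr0 invr1 mul1e; apply: eq_integral => x _.
  by congr f; apply/matrixP => i [].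
move=> mf f0; rewrite !integral_lebesgue_rVS//; last first.
  by apply: measurableT_comp => //; exact: measurable_rV_affine.
have mfx x : measurable_fun setT (fun v => f (rV_cons (x, v))).
  apply: measurableT_comp => //; apply: measurableT_comp (@measurable_rV_cons R n) _.
  exact: measurable_pair1.
transitivity (\int[lebesgue_measure]_x (((`|c| ^+ n)^-1)%:E *
   (fun y => \int[lebesgue_rV n]_v f (rV_cons (y, v)))
     (c * x + (rV_uncons h).1)%R)).
  apply: eq_integral => x _ /=; rewrite -(IH (rV_uncons h).2)//.
  apply: eq_integral => v _; congr f.
  by rewrite rV_consD rV_consZ; congr (_ + _)%R; exact/esym/rV_unconsK.
have mG : measurable_fun setT (fun y => \int[lebesgue_rV n]_v f (rV_cons (y, v))).
  apply: (@measurable_fun_fubini_tonelli_F _ _ _ _ _ (lebesgue_rV n)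
    (fun z => f (rV_cons z))) => //.
  by apply: measurableT_comp => //; exact: (@measurable_rV_cons R n).
have G0 y : 0 <= \int[lebesgue_rV n]_v f (rV_cons (y, v)) by exact: integral_ge0.
rewrite ge0_integralZl_EFin//; last first.
  apply: (measurableT_comp mG).
  by apply: measurable_funD => //; exact: measurable_funM.
rewrite (lebesgue_measure_affine (rV_uncons h).1 c0 mG)//.
by rewrite muleA -EFinM -invfM exprSr.
Qed.

End lebesgue_rV_invariance.

Lemma exists_natSinv_lt {R : realType} (r : R) : 0 < r ->
  exists k : nat, k.+1%:R^-1 < r.
Proof.
move=> r0; have [k _ /(_ _ (leqnn _))] := near_infty_natSinv_lt (PosNum r0).
by exists k.
Qed.

(** * The Euclidean norm and its topology *)

Section euclidean_norm.
Context {R : realType} {n : nat}.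
Implicit Types x y z : 'rV[R]_n.

Lemma dotvC x y : dotv x y = dotv y x.
Proof. by apply: eq_bigr => i _; rewrite mulrC. Qed.

Lemma dotvDl x y z : dotv (x + y) z = dotv x z + dotv y z.
Proof. by rewrite -big_split; apply: eq_bigr => i _; rewrite mxE mulrDl. Qed.

Lemma dotvZl (c : R) x z : dotv (c *: x) z = c * dotv x z.
Proof. by rewrite mulr_sumr; apply: eq_bigr => i _; rewrite mxE mulrA. Qed.

Lemma dotv_ge0 x : 0 <= dotv x x.
Proof. by apply: sumr_ge0 => i _; exact: sqr_ge0. Qed.

Lemma dotv_eq0 x : (dotv x x == 0) = (x == 0).
Proof.
apply/idP/eqP => [|->]; last first.
  by rewrite /dotv big1// => i _; rewrite mxE mul0r.
rewrite psumr_eq0; last by move=> i _; exact: sqr_ge0.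
move=> /allP h; apply/rowP => i; rewrite mxE.
by have := h i (mem_index_enum _); rewrite /= mulf_eq0 orbb => /eqP.
Qed.

Lemma dotv_CauchySchwarz x y : dotv x y ^+ 2 <= dotv x x * dotv y y.
Proof.
have [y0|y0] := eqVneq (dotv y y) 0.
  rewrite y0 mulr0; move/eqP: y0; rewrite dotv_eq0 => /eqP ->.
  by rewrite dotvC /dotv big1 ?expr0n// => i _; rewrite mxE mul0r.
have yp : 0 < dotv y y by rewrite lt_neqAle eq_sym y0 dotv_ge0.
(* The squared norm of (y.y) x - (x.y) y equals (y.y) times the difference of the two sides. *)
have := dotv_ge0 (dotv y y *: x + (- dotv x y) *: y).
rewrite dotvDl !dotvZl ![dotv _ (_ + _)]dotvC !dotvDl !dotvZl.
rewrite [dotv y x]dotvC => h.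
rewrite -subr_ge0 -(pmulr_rge0 _ yp).
by apply: le_trans h _; rewrite le_eqVlt; apply/orP; left; apply/eqP; ring.
Qed.

Lemma enorm_ge0 x : 0 <= enorm x. Proof. exact: sqrtr_ge0. Qed.

Lemma sqr_enorm x : enorm x ^+ 2 = dotv x x.
Proof. by rewrite sqr_sqrtr// dotv_ge0. Qed.

Lemma enorm_eq0 x : (enorm x == 0) = (x == 0).
Proof. by rewrite -dotv_eq0 -sqr_enorm expf_eq0. Qed.

Lemma enorm_gt0 x : (0 < enorm x) = (x != 0).
Proof. by rewrite lt_neqAle enorm_ge0 andbT eq_sym enorm_eq0. Qed.

Lemma enorm0 : enorm (0 : 'rV[R]_n) = 0.
Proof. by apply/eqP; rewrite enorm_eq0. Qed.

Lemma enormZ (c : R) x : enorm (c *: x) = `|c| * enorm x.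
Proof.
by rewrite /enorm dotvZl dotvC dotvZl mulrA -expr2 sqrtrM ?sqr_ge0// sqrtr_sqr.
Qed.

Lemma enormN x : enorm (- x) = enorm x.
Proof. by rewrite -scaleN1r enormZ normrN normr1 mul1r. Qed.

Lemma enormD x y : enorm (x + y) <= enorm x + enorm y.
Proof.
rewrite -(@ler_pXn2r _ 2)// ?nnegrE ?addr_ge0 ?enorm_ge0//.
rewrite sqrrD !sqr_enorm dotvDl ![dotv _ (_ + _)]dotvC !dotvDl [dotv y x]dotvC.
have : dotv x y <= enorm x * enorm y.
  apply: le_trans (ler_norm _) _.
  rewrite -(@ler_pXn2r _ 2)// ?nnegrE ?mulr_ge0 ?enorm_ge0//.
  by rewrite real_normK ?num_real// exprMn !sqr_enorm dotv_CauchySchwarz.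
by lra.
Qed.

Lemma enormB x y : enorm (x - y) = enorm (y - x).
Proof. by rewrite -enormN opprB. Qed.

Lemma enorm_sub_le x y : enorm x - enorm y <= enorm (x - y).
Proof. by rewrite lerBlDr; apply: le_trans (enormD _ _); rewrite subrK. Qed.

Lemma coord_le_enorm x i : `|x ord0 i| <= enorm x.
Proof.
rewrite -(@ler_pXn2r _ 2)// ?nnegrE ?enorm_ge0//.
rewrite real_normK ?num_real// sqr_enorm /dotv (bigD1 i)//= -expr2 lerDl.
by apply: sumr_ge0 => j _; exact: sqr_ge0.
Qed.

Lemma enorm_le_coord x (r : R) : 0 <= r -> (forall i, `|x ord0 i| <= r) ->
  enorm x <= n%:R * r.
Proof.
move=> r0 xr.
rewrite -(@ler_pXn2r _ 2)// ?nnegrE ?mulr_ge0 ?enorm_ge0//.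
rewrite sqr_enorm; apply: (@le_trans _ _ (\sum_(i < n) r ^+ 2)).
  apply: ler_sum => i _; rewrite -expr2 -real_normK ?num_real//.
  by rewrite ler_pXn2r ?nnegrE.
rewrite sumr_const card_ord exprMn -[leLHS]mulr_natl ler_wpM2r ?sqr_ge0//.
by rewrite -natrX ler_nat; case: (n) => // k; rewrite expnS leq_pmulr.
Qed.

Lemma udirZ (t : R) x : 0 < t -> udir (t *: x) = udir x.
Proof.
move=> t0; rewrite /udir enormZ gtr0_norm// scalerA invfM.
by rewrite mulrAC mulVf ?mul1r// gt_eqF.
Qed.

Lemma udirN x : udir (- x) = - udir x.
Proof. by rewrite /udir enormN scalerN. Qed.

Lemma enorm_udir x : x != 0 -> enorm (udir x) = 1.
Proof.
rewrite -enorm_gt0 => x0.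
by rewrite enormZ gtr0_norm ?invr_gt0// mulVf// gt_eqF.
Qed.

Lemma ball_enorm x (r : R) : 0 < r ->
  exists2 d, 0 < d & forall y, enorm (x - y) < d -> ball x r y.
Proof.
move=> r0; exists r => // y xy; split => // i j.
rewrite /ball /= ord1; apply: le_lt_trans xy.
by have := coord_le_enorm (x - y) j; rewrite !mxE.
Qed.

Lemma enorm_ball x (r : R) : 0 < r ->
  exists2 d, 0 < d & forall y, ball x d y -> enorm (x - y) < r.
Proof.
(* Dividing by [n.+1] covers n = 0 and makes the resulting bound n r / (n + 1) < r strict. *)
move=> r0; have d0 : 0 < r / (n.+1)%:R by rewrite divr_gt0.
exists (r / (n.+1)%:R) => // y [_ xy].
have := @enorm_le_coord (x - y) _ (ltW d0).
move=> /(_ _)/le_lt_trans; apply.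
  by move=> i; have := xy ord0 i; rewrite /ball /= !mxE => /ltW.
rewrite mulrCA -[ltRHS]mulr1 ltr_pM2l// ltr_pdivrMr ?mul1r ?ltr_nat//.
Qed.

Lemma open_enormP (U : set 'rV[R]_n) :
  open U <-> forall x, U x -> exists2 r, 0 < r & forall y, enorm (x - y) < r -> U y.
Proof.
split=> [oU x Ux|h].
  have /nbhs_ballP[r /= r0 rU] : nbhs x U by exact: open_nbhs_nbhs.
  have [d d0 dr] := ball_enorm x r0.
  by exists d => // y /dr/rU.
rewrite openE => x /h[r r0 rU]; have [d d0 dr] := enorm_ball x r0.
by apply/nbhs_ballP; exists d => // y /dr/rU.
Qed.

Lemma continuous_enorm : continuous (@enorm R n).
Proof.
move=> x A /nbhs_ballP[e /= e0 eA]; have [d d0 dr] := enorm_ball x e0.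
apply/nbhs_ballP; exists d => // y /dr xy; apply: eA; apply: le_lt_trans xy.
rewrite ler_norml enorm_sub_le andbT.
by rewrite lerNl opprB enormB enorm_sub_le.
Qed.

End euclidean_norm.

Section measurable_rV_open.
Context {R : realType} {n : nat}.

Lemma measurable_mx_ball (x : 'rV[R]_n) (r : R) : measurable (ball x r).
Proof.
have [r0|r0] := ltP 0 r; last first.
  rewrite (_ : ball x r = set0)//; apply/seteqP; split=> // y [].
  by rewrite ltNge r0.
rewrite (_ : ball x r = \bigcap_(i in [set: 'I_n])
    ((fun y : 'rV[R]_n => y ord0 i) @^-1` (ball (x ord0 i) r))).
  apply: fin_bigcap_measurable => // i _; rewrite -[X in measurable X]setTI.
  by apply: (measurable_rV_coord i) => //; exact: measurable_ball.
apply/seteqP; split=> [y [_ xy] i _ /=|y xy]; first exact: xy.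
by split=> // i j; rewrite ord1; exact: xy.
Qed.

(** The sigma-algebra is generated by the coordinates, which measure the balls of the sup norm. An
    open set is the countable union of those balls with rational centre and radius 1/(k+1) that it
    contains; around x, a radius below half of the distance available leaves room for moving the
    centre to a rational point. *)
Lemma open_measurable_rV (U : set 'rV[R]_n) : open U -> measurable U.
Proof.
move=> oU.
pose c (p : 'rV[rat]_n) : 'rV[R]_n := \row_i ratr (p ord0 i).
pose F (p : 'rV[rat]_n * nat) : set 'rV[R]_n :=
  if `[< ball (c p.1) p.2.+1%:R^-1 `<=` U >] then ball (c p.1) p.2.+1%:R^-1
  else set0.
rewrite (_ : U = \bigcup_p F p).
  apply: countable_bigcupT_measurable => [|p]; first exact: countableP.
  by rewrite /F; case: ifP => _ //; exact: measurable_mx_ball.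
apply/seteqP; split=> [x Ux|x [p _]]; last first.
  by rewrite /F; case: ifPn => // /asboolP; exact.
have /nbhs_ballP[r /= r0 rU] : nbhs x U by exact: open_nbhs_nbhs.
have [k kr] := exists_natSinv_lt (divr_gt0 r0 (ltr0Sn R 1)).
have k0 : (0 : R) < k.+1%:R^-1 by rewrite invr_gt0.
have : forall i, {q : rat | `|x ord0 i - ratr q| < k.+1%:R^-1 :> R}.
  move=> i; apply: cid.
  have [|q] := @rat_in_itvoo R (x ord0 i - k.+1%:R^-1) (x ord0 i + k.+1%:R^-1).
    by rewrite ltrBlDr -addrA ltrDl addr_gt0.
  rewrite in_itv /= => /andP[a b]; exists q.
  rewrite ltr_norml; move: (k.+1%:R^-1) (ratr q) a b => e t ? ?.
  by apply/andP; split; lra.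
move=> q; pose p : 'rV[rat]_n := \row_i sval (q i).
have px : ball (c p) k.+1%:R^-1 x.
  split=> // i j; rewrite ord1 /ball /= !mxE distrC.
  exact: (svalP (q j)).
exists (p, k) => //; rewrite /F ifT//; apply/asboolP => y /= py.
apply: rU; apply: (@le_ball _ _ _ (k.+1%:R^-1 + k.+1%:R^-1)).
  by move: (k.+1%:R^-1) kr => e; lra.
exact: ball_triangle (ball_sym px) py.
Qed.

End measurable_rV_open.

(** * Volumes of boxes and of Euclidean balls *)

Section lebesgue_rV_box.
Context {R : realType}.

Lemma measurable_rV_box n (A : set (measurableTypeR R)) : measurable A ->
  measurable [set x : 'rV[R]_n | forall i, A (x ord0 i)].
Proof.
move=> mA; rewrite (_ : [set _ | _] = \bigcap_(i in [set: 'I_n])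
    ((fun y : 'rV[R]_n => y ord0 i) @^-1` A)).
  apply: fin_bigcap_measurable => // i _; rewrite -[X in measurable X]setTI.
  exact: (measurable_rV_coord i).
by apply/seteqP; split=> [y xy i _ /=|y xy i]; exact: xy.
Qed.

Lemma lebesgue_rV_box n (A : set (measurableTypeR R)) : measurable A ->
  lebesgue_rV n [set x | forall i, A (x ord0 i)] = (lebesgue_measure A ^+ n)%E.
Proof.
move=> mA; elim: n => [|n IH].
  by rewrite expe0 /= /dirac indicE mem_set// => -[].
rewrite expeS -IH /= /lebesgue_rV_step /pushforward.
rewrite -product_measure1E//; last exact: measurable_rV_box.
congr (_ _); apply/seteqP; split=> [[x v] /= h|[x v] [/= Ax Av] i].
  split=> [|i] /=; first by have := h ord0; rewrite rV_cons0.
  by have := h (rshift 1 i); rewrite rV_consS.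
case: (split_ordP (i : 'I_(1 + n))) => j ->; last by rewrite rV_consS.
by rewrite (ord1 j) (_ : lshift n (ord0 : 'I_1) = (ord0 : 'I_n.+1)) ?rV_cons0//; exact/val_inj.
Qed.

Definition eball n (y : 'rV[R]_n) (r : R) : set 'rV[R]_n :=
  [set x | enorm (x - y) <= r].

Lemma eball0E n (r : R) (x : 'rV[R]_n) : eball 0 r x = (enorm x <= r) :> Prop.
Proof. by rewrite /eball /= subr0. Qed.

Lemma measurable_eball n (y : 'rV[R]_n) (r : R) : measurable (eball y r).
Proof.
rewrite -[X in measurable X]setTI; apply: measurable_fun_le => //.
apply: (measurableT_comp measurable_enorm).
under eq_fun do rewrite -[X in X - _]scale1r.
exact: measurable_rV_affine.
Qed.

Lemma lebesgue_rV_affine n (c : R) (h : 'rV[R]_n) (A : set 'rV[R]_n) :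
  0 < c -> measurable A ->
  lebesgue_rV n [set x | A (c *: x + h)] = ((c ^- n)%:E * lebesgue_rV n A)%E.
Proof.
move=> c0 mA.
have mA' : measurable [set x | A (c *: x + h)].
  by rewrite -[X in measurable X]setTI; exact: measurable_rV_affine.
rewrite -[X in lebesgue_rV n X]setIT -integral_indic//.
rewrite -[X in (_ * lebesgue_rV n X)%E]setIT -integral_indic//.
have := integral_rV_affine h (lt0r_neq0 c0) (f := fun x => (\1_A x)%:E).
by rewrite gtr0_norm// => <-//; apply/measurable_EFinP; exact: measurable_indic.
Qed.

Lemma lebesgue_rV_eball n (y : 'rV[R]_n) (r : R) : 0 < r ->
  lebesgue_rV n (eball y r) = ((r ^+ n)%:E * lebesgue_rV n (eball 0 1))%E.
Proof.
move=> r0; rewrite (_ : eball y r =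
    [set x | eball 0 1 (r^-1 *: x + (- (r^-1 *: y)))]).
  rewrite lebesgue_rV_affine ?invr_gt0 ?exprVn ?invrK//.
  exact: measurable_eball.
apply/seteqP; split=> x; rewrite /= eball0E /eball /=;
  rewrite -scalerBr enormZ gtr0_norm ?invr_gt0//;
  by rewrite mulrC ler_pdivrMr ?mul1r.
Qed.

Lemma lebesgue_rV_eball_lty n (y : 'rV[R]_n) (r : R) :
  (lebesgue_rV n (eball y r) < +oo)%E.
Proof.
(* The larger radius is positive, so the scaling law reduces the claim to the unit ball, which lies
   in a cube. *)
apply: (@le_lt_trans _ _ (lebesgue_rV n (eball y (Num.max 1 r)))).
  apply: le_measure; rewrite ?inE; try exact: measurable_eball.
  by move=> x; rewrite /eball /= le_max => ->; rewrite orbT.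
rewrite lebesgue_rV_eball ?lt_max ?ltr01//.
apply: lte_mul_pinfty => //; first by rewrite lee_fin exprn_ge0// le_max ler01.
pose B := [set x : 'rV[R]_n | forall i, `[- 1, 1]%classic (x ord0 i)].
apply: (@le_lt_trans _ _ (lebesgue_rV n B)); last first.
  rewrite (lebesgue_rV_box n (measurable_itv _)).
  rewrite lebesgue_measure_itv /= lte_fin gtrN//.
  by rewrite -EFinB -EFin_expe ltry.
apply: le_measure; rewrite ?inE.
- exact: measurable_eball.
- exact: (measurable_rV_box (measurable_itv _)).
move=> x; rewrite eball0E => xr i; rewrite /= in_itv /= -ler_norml.
exact: le_trans (coord_le_enorm x i) xr.
Qed.

Lemma lebesgue_rV_eball_gt0 n (y : 'rV[R]_n) (r : R) : 0 < r ->
  (0 < lebesgue_rV n (eball y r))%E.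
Proof.
move=> r0; rewrite lebesgue_rV_eball// mule_gt0// ?lte_fin ?exprn_gt0//.
(* The cube of half-side d lies in the unit ball because its points have norm at most n d <= 1. *)
pose d : R := n.+1%:R^-1.
have d0 : 0 < d by rewrite invr_gt0.
pose B := [set x : 'rV[R]_n | forall i, `[- d, d]%classic (x ord0 i)].
apply: (@lt_le_trans _ _ (lebesgue_rV n B)).
  rewrite (lebesgue_rV_box n (measurable_itv _)).
  rewrite lebesgue_measure_itv /= lte_fin gtrN//.
  by rewrite -EFinB -EFin_expe lte_fin exprn_gt0// opprK addr_gt0.
apply: le_measure; rewrite ?inE.
- exact: (measurable_rV_box (measurable_itv _)).
- exact: measurable_eball.
move=> x /= xr; rewrite eball0E; apply: (@le_trans _ _ (n%:R * d)).
  apply: enorm_le_coord => [|i]; first exact: ltW.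
  by have := xr i; rewrite /= in_itv /= -ler_norml.
by rewrite ler_pdivrMr ?mul1r ?ler_nat.
Qed.

Local Open Scope ereal_scope.

Lemma integral_homogeneous n (b : 'rV[R]_n -> \bar R) (r : R) :
  (0 < r)%R -> measurable_fun setT b -> (forall x, 0 <= b x) ->
  (forall (t : R) x, (0 < t)%R -> b (t *: x)%R = b x) ->
  \int[lebesgue_rV n]_(x in eball 0%R r) b x =
  (r ^+ n)%:E * \int[lebesgue_rV n]_(x in eball 0%R 1%R) b x.
Proof.
move=> r0 mb b0 bZ.
rewrite (integral_mkcond (eball 0%R 1%R)).
rewrite (_ : _ \_ _ = (fun x : 'rV[R]_n => (b \_ (eball 0%R r)) (r *: x + 0)%R)); last first.
  apply/funext => x; rewrite !patchE addr0 bZ//.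
  congr (if _ then _ else _); apply: asbool_equiv_eq; rewrite !eball0E.
  by rewrite enormZ gtr0_norm// -ler_pdivlMl// mulVf// gt_eqF.
rewrite (integral_rV_affine 0%R)//; last 3 first.
- by rewrite gt_eqF.
- apply/(measurable_restrictT _ _).1; first exact: measurable_eball.
  exact: measurable_funTS.
- by move=> x; rewrite patchE; case: ifP.
by rewrite gtr0_norm// muleA -EFinM mulfV ?expf_neq0 ?gt_eqF// mul1e -integral_mkcond.
Qed.

End lebesgue_rV_box.

Section measurable_rV_operations.
Context {R : realType} {n : nat} d (T : measurableType d).
Implicit Types f g : T -> 'rV[R]_n.

Lemma measurable_rVD f g : measurable_fun setT f -> measurable_fun setT g ->
  measurable_fun setT (fun x => f x + g x).
Proof.
move=> mf mg; apply: measurable_fun_rVP => i; under eq_fun do rewrite mxE.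
by apply: measurable_funD; exact: (measurableT_comp (measurable_rV_coord i)).
Qed.

Lemma measurable_rVZ (c : R) f : measurable_fun setT f ->
  measurable_fun setT (fun x => c *: f x).
Proof.
move=> mf; apply: measurable_fun_rVP => i; under eq_fun do rewrite mxE.
by apply: measurable_funM => //; exact: (measurableT_comp (measurable_rV_coord i)).
Qed.

Lemma measurable_rVB f g : measurable_fun setT f -> measurable_fun setT g ->
  measurable_fun setT (fun x => f x - g x).
Proof.
move=> mf mg; apply: measurable_rVD => //.
by under eq_fun do rewrite -scaleN1r; exact: measurable_rVZ.
Qed.

End measurable_rV_operations.

(** * Comparison of kernel energies *)

Section energy.
Context {R : realType} {n : nat}.
Local Notation mu := (lebesgue_rV n).
Implicit Types (u : 'rV[R]_n -> R) (K : 'rV[R]_n -> R).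
Local Open Scope ereal_scope.

Lemma integral_rV_shift (h : 'rV[R]_n) (f : 'rV[R]_n -> \bar R) :
  measurable_fun setT f -> (forall x, 0 <= f x) ->
  \int[mu]_x f (x + h)%R = \int[mu]_x f x.
Proof.
move=> mf f0; have := integral_rV_affine h (oner_neq0 R) mf f0.
rewrite normr1 expr1n invr1 mul1e => <-.
by under [in RHS]eq_integral do rewrite scale1r.
Qed.

Lemma integral_rV_reflect (h : 'rV[R]_n) (f : 'rV[R]_n -> \bar R) :
  measurable_fun setT f -> (forall x, 0 <= f x) ->
  \int[mu]_x f (h - x)%R = \int[mu]_x f x.
Proof.
move=> mf f0; have N10 : (-1 != 0 :> R)%R by rewrite oppr_eq0 oner_neq0.
have := integral_rV_affine h N10 mf f0.
rewrite normrN normr1 expr1n invr1 mul1e => <-.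
by under [in RHS]eq_integral do rewrite scaleN1r addrC.
Qed.

Definition incr2 u (z : 'rV[R]_n) : \bar R :=
  \int[mu]_x ((u (x + z) - u x) ^+ 2)%:E.

Definition kenergy K u : \bar R :=
  \int[mu \x mu]_z ((u z.1 - u z.2) ^+ 2 * K (z.1 - z.2))%:E.

Lemma incr2_ge0 u z : 0 <= incr2 u z.
Proof. by apply: integral_ge0 => x _; rewrite lee_fin sqr_ge0. Qed.

Lemma measurable_diff2 u : measurable_fun setT u ->
  measurable_fun setT (fun z : 'rV[R]_n * 'rV[R]_n => u z.1 - u z.2)%R.
Proof.
move=> mu_; apply: measurable_funB.
  by apply: measurableT_comp => //; exact: measurable_fst.
by apply: measurableT_comp => //; exact: measurable_snd.
Qed.

Lemma measurable_incr u : measurable_fun setT u ->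
  measurable_fun setT (fun z : 'rV[R]_n * 'rV[R]_n => u (z.2 + z.1) - u z.2)%R.
Proof.
move=> mu_; apply: measurable_funB.
  apply: measurableT_comp => //.
  by apply: measurable_rVD; [exact: measurable_snd|exact: measurable_fst].
by apply: measurableT_comp => //; exact: measurable_snd.
Qed.

Lemma measurable_incr2 u : measurable_fun setT u ->
  measurable_fun setT (incr2 u).
Proof.
move=> mu_; apply: (@measurable_fun_fubini_tonelli_F _ _ _ _ _ mu
  (fun z => ((u (z.2 + z.1) - u z.2) ^+ 2)%:E)).
  by apply/measurable_EFinP; apply: measurable_funX; exact: measurable_incr.
by move=> z; rewrite lee_fin sqr_ge0.
Qed.

Lemma measurable_shift (h : 'rV[R]_n) :
  measurable_fun setT (fun x : 'rV[R]_n => x + h)%R.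
Proof. by apply: measurable_rVD => //; exact: measurable_id. Qed.

Lemma measurable_sqr_incr u z : measurable_fun setT u ->
  measurable_fun setT (fun x : 'rV[R]_n => ((u (x + z)%R - u x) ^+ 2)%:E).
Proof.
move=> mu_; apply/measurable_EFinP; apply: measurable_funX.
apply: measurable_funB => //; apply: measurableT_comp => //.
exact: measurable_shift.
Qed.

(** By Tonelli and translation invariance the energy depends on [u] only through the squared L^2
    norms [incr2 u z] of its increments. Comparing two energies thus becomes a matter of
    inequalities for this one function of z. *)
Lemma kenergyE K u : measurable_fun setT u -> measurable_fun setT K ->
  (forall z, (0 <= K z)%R) ->
  kenergy K u = \int[mu]_z ((K z)%:E * incr2 u z).
Proof.
move=> mu_ mK K0.
have F0 (z : 'rV[R]_n * 'rV[R]_n) : 0 <= ((u z.1 - u z.2) ^+ 2 * K (z.1 - z.2))%:E.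
  by rewrite lee_fin mulr_ge0 ?sqr_ge0.
have mF : measurable_fun setT (fun z : 'rV[R]_n * 'rV[R]_n =>
    ((u z.1 - u z.2) ^+ 2 * K (z.1 - z.2))%:E).
  apply/measurable_EFinP; apply: measurable_funM.
    by apply: measurable_funX; exact: measurable_diff2.
  apply: measurableT_comp => //.
  by apply: measurable_rVB; [exact: measurable_fst|exact: measurable_snd].
rewrite /kenergy fubini_tonelli2// /fubini_G /=.
transitivity (\int[mu]_y \int[mu]_z (K z * (u (y + z) - u y) ^+ 2)%:E).
  apply: eq_integral => y _.
  rewrite -(@integral_rV_shift y (fun x => ((u x - u y) ^+ 2 * K (x - y))%:E))//.
  - by apply: eq_integral => z _; rewrite addrK mulrC [(z + y)%R]addrC.
  - apply/measurable_EFinP; apply: measurable_funM.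
      by apply: measurable_funX; apply: measurable_funB.
    by apply: measurableT_comp => //; exact: measurable_shift.
  - by move=> x; rewrite lee_fin mulr_ge0 ?sqr_ge0.
rewrite (@fubini_tonelli _ _ _ _ _ mu mu
  (fun p : 'rV[R]_n * 'rV[R]_n => (K p.2 * (u (p.1 + p.2)%R - u p.1) ^+ 2)%:E))/=; last 2 first.
- apply/measurable_EFinP; apply: measurable_funM.
    by apply: measurableT_comp => //; exact: measurable_snd.
  apply: measurable_funX; apply: measurable_funB; last first.
    by apply: measurableT_comp => //; exact: measurable_fst.
  apply: measurableT_comp => //.
  by apply: measurable_rVD; [exact: measurable_fst|exact: measurable_snd].
- by move=> x; rewrite lee_fin mulr_ge0 ?sqr_ge0.
apply: eq_integral => z _; rewrite -ge0_integralZl_EFin//.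
- by move=> x _; rewrite lee_fin sqr_ge0.
- exact: measurable_sqr_incr.
Qed.

(** The increment by z is the increment by z - w at x followed by the increment by w at x + z - w;
    the latter is moved back to x by translation invariance, and (a + b)^2 <= 2 a^2 + 2 b^2. *)
Lemma incr2_triangle u z w : measurable_fun setT u ->
  incr2 u z <= 2%:E * incr2 u w + 2%:E * incr2 u (z - w).
Proof.
move=> mu_.
rewrite /incr2 -(@integral_rV_shift (z - w)%R (fun x => ((u (x + w) - u x) ^+ 2)%:E)); last 2 first.
- exact: measurable_sqr_incr.
- by move=> x; rewrite lee_fin sqr_ge0.
have m1 : measurable_fun setT
    (fun x : 'rV[R]_n => ((u (x + (z - w) + w)%R - u (x + (z - w))%R) ^+ 2)%:E).
  apply: (measurableT_comp (measurable_sqr_incr w mu_)).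
  exact: measurable_shift.
rewrite -!ge0_integralZl_EFin//; last 3 first.
- by move=> x _; rewrite lee_fin sqr_ge0.
- exact: measurable_sqr_incr.
- by move=> x _; rewrite lee_fin sqr_ge0.
rewrite -ge0_integralD//; last 4 first.
- by move=> x _; rewrite mule_ge0// lee_fin sqr_ge0.
- exact: measurable_funeM.
- by move=> x _; rewrite mule_ge0// lee_fin sqr_ge0.
- by apply: measurable_funeM; exact: measurable_sqr_incr.
apply: ge0_le_integral => //.
- by move=> x _; rewrite lee_fin sqr_ge0.
- exact: measurable_sqr_incr.
- apply: emeasurable_funD; apply: measurable_funeM => //.
  exact: measurable_sqr_incr.
- move=> x _; rewrite -!EFinM -EFinD lee_fin.
  rewrite -addrA subrK; move: (u (x + z)%R) (u x) (u (x + (z - w))%R) => a b c.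
  by have := sqr_ge0 (a - c - (c - b))%R; nra.
Qed.

End energy.

Lemma measurable_fun_ge0_inv d (T : measurableType d) (R : realType)
    (f : T -> R) :
  measurable_fun setT f -> (forall x, 0 <= f x) ->
  measurable_fun setT (fun x => (f x)^-1).
Proof.
move=> mf f0; rewrite (_ : (fun _ => _) = (@powR R)^~ (-1) \o f); last first.
  by apply/funext => x /=; rewrite powR_inv1.
by apply: measurableT_comp => //; exact: measurable_powR.
Qed.

(** * Domination of one kernel energy by another through splittings *)

Section kernel_comparison.
Context {R : realType} {n : nat}.
Local Notation mu := (lebesgue_rV n).
Implicit Types (u : 'rV[R]_n -> R) (K : 'rV[R]_n -> R) (E : set 'rV[R]_n).
Local Open Scope ereal_scope.

Definition comparable_norms (alpha beta : R) (z w : 'rV[R]_n) :=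
  (alpha * enorm z <= enorm w <= beta * enorm z)%R.

Definition splittings E (alpha beta : R) (z : 'rV[R]_n) : set 'rV[R]_n :=
  [set w | [/\ E w, E (z - w)%R, comparable_norms alpha beta z w &
               comparable_norms alpha beta z (z - w)%R]].

Lemma splittings_sym E alpha beta z w :
  splittings E alpha beta z (z - w)%R = splittings E alpha beta z w :> Prop.
Proof.
rewrite /splittings /= opprB addrCA subrr addr0.
by apply/propext; split=> -[].
Qed.

Lemma measurable_comparable_norms alpha beta d (T : measurableType d)
    (f g : T -> 'rV[R]_n) :
  measurable_fun setT f -> measurable_fun setT g ->
  measurable [set t | comparable_norms alpha beta (f t) (g t)].
Proof.
move=> mf mg; have me (h : T -> 'rV[R]_n) : measurable_fun setT h ->
    measurable_fun setT (enorm \o h).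
  by move=> mh; apply: measurableT_comp => //; exact: measurable_enorm.
rewrite (_ : [set _ | _] =
    [set t | (alpha * enorm (f t) <= enorm (g t))%R] `&`
    [set t | (enorm (g t) <= beta * enorm (f t))%R]); last first.
  by apply/seteqP; split=> t; [move=> /andP|move=> []; rewrite /comparable_norms /= => -> ->].
apply: measurableI.
  rewrite -[X in measurable X]setTI; apply: measurable_fun_le => //.
    by apply: measurable_funM => //; exact: me.
  exact: me.
rewrite -[X in measurable X]setTI; apply: measurable_fun_le => //.
  exact: me.
by apply: measurable_funM => //; exact: me.
Qed.

Lemma measurable_splittings E alpha beta : measurable E ->
  measurable [set p : 'rV[R]_n * 'rV[R]_n | splittings E alpha beta p.1 p.2].
Proof.
move=> mE.
have mB : measurable_fun setT (fun p : 'rV[R]_n * 'rV[R]_n => p.1 - p.2)%R.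
  by apply: measurable_rVB; [exact: measurable_fst|exact: measurable_snd].
rewrite (_ : [set _ | _] = (snd @^-1` E `&` (fun p => p.1 - p.2)%R @^-1` E) `&`
  ([set p | comparable_norms alpha beta p.1 p.2] `&`
   [set p | comparable_norms alpha beta p.1 (p.1 - p.2)%R])); last first.
  by apply/seteqP; split=> p /= [] => [? ? ? ?|[? ?] [? ?]].
apply: measurableI; apply: measurableI.
- by rewrite -[X in measurable X]setTI; exact: measurable_snd.
- by rewrite -[X in measurable X]setTI; exact: mB.
- by apply: measurable_comparable_norms; [exact: measurable_fst|exact: measurable_snd].
- by apply: measurable_comparable_norms; [exact: measurable_fst|exact: mB].
Qed.

(* For w among the splittings of z, incr2 z <= 2 incr2 w + 2 incr2 (z - w); as
   w -> z - w preserves the splittings, averaging over them bounds incr2 z by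
   4 times the mean of incr2. *)
Lemma incr2_le_splittings E alpha beta u z : measurable E ->
  measurable_fun setT u ->
  mu (splittings E alpha beta z) * incr2 u z <=
  4%:E * \int[mu]_w ((\1_(splittings E alpha beta z) w)%:E * incr2 u w).
Proof.
move=> mE mu_; set A := splittings E alpha beta z.
have mA : measurable A.
  rewrite -[A]/((fun w => (z, w)) @^-1`
    [set p : 'rV[R]_n * 'rV[R]_n | splittings E alpha beta p.1 p.2]).
  rewrite -[X in measurable X]setTI; apply: measurable_pair1 => //.
  exact: measurable_splittings.
have mG := measurable_incr2 mu_.
have G0 := incr2_ge0 u.
have m1 : measurable_fun setT (fun w => (\1_A w : R)%:E).
  by apply/measurable_EFinP; exact: measurable_indic.
have i0 w : 0 <= (\1_A w : R)%:E by rewrite lee_fin.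
have mzw : measurable_fun setT (fun w : 'rV[R]_n => z - w)%R.
  by apply: measurable_rVB.
have mGz : measurable_fun setT (fun w : 'rV[R]_n => incr2 u (z - w)%R).
  exact: measurableT_comp.
rewrite -[X in mu X]setIT -integral_indic// -ge0_integralZr//.
apply: (@le_trans _ _ (\int[mu]_w
   (2%:E * ((\1_A w)%:E * incr2 u w) + 2%:E * ((\1_A w)%:E * incr2 u (z - w)%R)))).
  apply: ge0_le_integral => //.
  - by move=> w _; exact: mule_ge0.
  - exact: emeasurable_funM.
  - by apply: emeasurable_funD; apply: measurable_funeM; exact: emeasurable_funM.
  move=> w _; rewrite muleCA (muleCA 2%:E) -ge0_muleDr ?mule_ge0//.
  by rewrite lee_wpmul2l//; exact: incr2_triangle.
rewrite ge0_integralD//; last 4 first.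
- by move=> w _; rewrite mule_ge0// mule_ge0.
- by apply: measurable_funeM; exact: emeasurable_funM.
- by move=> w _; rewrite mule_ge0// mule_ge0.
- by apply: measurable_funeM; exact: emeasurable_funM.
have mM : measurable_fun setT (fun w => (\1_A w : R)%:E * incr2 u w).
  exact: emeasurable_funM.
have M0 w : 0 <= (\1_A w : R)%:E * incr2 u w by exact: mule_ge0.
rewrite !ge0_integralZl_EFin//; last 2 first.
- by move=> w _; exact: mule_ge0.
- exact: emeasurable_funM.
rewrite (_ : \int[mu]_w ((\1_A w)%:E * incr2 u (z - w)%R) =
             \int[mu]_w ((\1_A w)%:E * incr2 u w)).
  by rewrite -ge0_muleDl// -EFinD (_ : 2 + 2 = 4 :> R)%R//; ring.
rewrite -(integral_rV_reflect z mM M0); apply: eq_integral => w _; congr (_%:E * _);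
  rewrite !indicE; congr ((nat_of_bool _)%:R).
by apply/idP/idP => /set_mem h; apply/mem_set; move: h; rewrite /A splittings_sym.
Qed.

(** Since the splittings of z fill a volume of at least kappa |z|^n, [incr2_le_splittings] bounds
    [incr2 u z] by 4 / (kappa |z|^n) times the integral of [incr2 u] over them. Integrate against
    [K1] and exchange the integrals: for fixed w in E only the z of comparable norm remain, and the
    last hypothesis bounds their total weight by M [K2 w]. The assumption on [K1 0] disposes of z =
    0, for which no splittings are provided. *)
Lemma kenergy_compare u K1 K2 E (alpha beta kappa M : R) :
  measurable E -> measurable_fun setT u ->
  measurable_fun setT K1 -> (forall z, (0 <= K1 z)%R) ->
  measurable_fun setT K2 -> (forall z, (0 <= K2 z)%R) ->
  (0 < kappa)%R -> (0 <= M)%R -> K1 0%R = 0%R ->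
  (forall z, z != 0%R ->
     (kappa * enorm z ^+ n)%:E <= mu (splittings E alpha beta z)) ->
  (forall w, E w ->
     \int[mu]_(z in [set z | comparable_norms alpha beta z w])
       (K1 z / enorm z ^+ n)%:E <= (M * K2 w)%:E) ->
  kenergy K1 u <= (4 / kappa * M)%:E * kenergy K2 u.
Proof.
move=> mE mu_ mK1 K10 mK2 K20 kappa0 M0 K1z hA hM.
rewrite !kenergyE//.
pose S := [set p : 'rV[R]_n * 'rV[R]_n | splittings E alpha beta p.1 p.2].
have mS : measurable S by exact: measurable_splittings.
have mG := measurable_incr2 mu_.
have G0 := incr2_ge0 u.
have k40 : (0 <= 4 / kappa)%R by rewrite divr_ge0// ltW.
pose k z : R := (K1 z / enorm z ^+ n)%R.
have k0 z : (0 <= k z)%R by rewrite divr_ge0// exprn_ge0// enorm_ge0.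
have mk : measurable_fun setT k.
  rewrite /k; apply: measurable_funM => //.
  apply: measurable_fun_ge0_inv => [|x]; last by rewrite exprn_ge0// enorm_ge0.
  by apply: measurable_funX; exact: measurable_enorm.
pose F (p : 'rV[R]_n * 'rV[R]_n) := (k p.1)%:E * ((\1_S p)%:E * incr2 u p.2).
have F0 p : 0 <= F p by rewrite !mule_ge0// lee_fin.
have mF : measurable_fun setT F.
  apply: emeasurable_funM.
    by apply/measurable_EFinP; apply: measurableT_comp => //; exact: measurable_fst.
  apply: emeasurable_funM.
    by apply/measurable_EFinP; exact: measurable_indic.
  by apply: measurableT_comp => //; exact: measurable_snd.
have mF1 (z : 'rV[R]_n) : measurable_fun setT (fun w => F (z, w)).
  by apply: measurableT_comp => //; exact: measurable_pair1.
have mF2 (w : 'rV[R]_n) : measurable_fun setT (fun z => F (z, w)).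
  by apply: measurableT_comp => //; exact: measurable_pair2.
have mSz (z : 'rV[R]_n) : measurable_fun setT (fun w => (\1_S (z, w) : R)%:E * incr2 u w).
  apply: emeasurable_funM => //; apply/measurable_EFinP.
  by apply: (measurableT_comp (measurable_indic _)) => //; exact: measurable_pair1.
apply: (@le_trans _ _ (\int[mu]_z ((4 / kappa)%:E * \int[mu]_w F (z, w)))).
  apply: ge0_le_integral => //.
  - by move=> z _; rewrite mule_ge0// lee_fin.
  - by apply: emeasurable_funM => //; exact/measurable_EFinP.
  - apply: measurable_funeM.
    exact: (@measurable_fun_fubini_tonelli_F _ _ _ _ _ mu).
  move=> z _; have [->|z0] := eqVneq z 0%R.
    by rewrite K1z mul0e mule_ge0// ?lee_fin// integral_ge0.
  rewrite /F /= ge0_integralZl_EFin//; last first.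
    by move=> w _; rewrite mule_ge0// lee_fin.
  have zn : (0 < enorm z ^+ n)%R by rewrite exprn_gt0// enorm_gt0.
  have -> : (K1 z)%:E = (k z / kappa)%:E * (kappa * enorm z ^+ n)%:E.
    by rewrite -EFinM /k; congr EFin; field; rewrite !gt_eqF.
  rewrite -muleA.
  have := incr2_le_splittings alpha beta z mE mu_.
  rewrite [X in _ -> _ <= X]muleA -EFinM (_ : 4 / kappa * k z = (k z / kappa) * 4)%R; last by ring.
  rewrite [(k z / kappa * 4)%:E]EFinM -[X in _ -> _ <= X]muleA => h.
  apply: lee_wpmul2l; first by rewrite lee_fin divr_ge0// ltW.
  apply: le_trans (h); apply: lee_wpmul2r => //.
  exact: hA.
rewrite ge0_integralZl_EFin//; last 2 first.
- by move=> z _; exact: integral_ge0.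
- exact: (@measurable_fun_fubini_tonelli_F _ _ _ _ _ mu).
rewrite [(4 / kappa * M)%:E]EFinM -muleA; apply: lee_wpmul2l; first by rewrite lee_fin.
rewrite (fubini_tonelli F)//= -ge0_integralZl_EFin//; last 2 first.
- by move=> w _; rewrite mule_ge0// lee_fin.
- by apply: emeasurable_funM => //; exact/measurable_EFinP.
apply: ge0_le_integral => //.
- by move=> w _; exact: integral_ge0.
- exact: (@measurable_fun_fubini_tonelli_G _ _ _ _ _ mu).
- by apply: measurable_funeM; apply: emeasurable_funM => //; exact/measurable_EFinP.
move=> w _; have [Ew|Ew] := pselect (E w); last first.
  rewrite integral0_eq ?mule_ge0 ?lee_fin// => z _.
  by rewrite /F /= indicE memNset ?mul0e ?mule0// => -[].
rewrite muleA -EFinM.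
have mC : measurable [set z | comparable_norms alpha beta z w].
  by apply: measurable_comparable_norms => //; exact: measurable_id.
apply: (@le_trans _ _ (\int[mu]_z (((\1_[set z | comparable_norms alpha beta z w] z)%:E * (k
  z)%:E) * incr2 u w))).
  apply: ge0_le_integral => //.
  - apply: emeasurable_funM => //; apply: emeasurable_funM.
      by apply/measurable_EFinP; exact: measurable_indic.
    exact/measurable_EFinP.
  - move=> z _; rewrite /F /= muleA; apply: lee_wpmul2r => //.
    rewrite muleC; apply: lee_wpmul2r; first by rewrite lee_fin.
    rewrite lee_fin; have [Sz|Sz] := pselect (S (z, w)).
      by rewrite !indicE !mem_set//; case: Sz.
    by rewrite indicE memNset.
rewrite ge0_integralZr//; last 2 first.
- apply: emeasurable_funM; last exact/measurable_EFinP.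
  by apply/measurable_EFinP; exact: measurable_indic.
- by move=> z _; rewrite mule_ge0// lee_fin.
apply: lee_wpmul2r => //; apply: le_trans (hM _ Ew).
rewrite [leRHS]integral_mkcond le_eqVlt; apply/orP; left; apply/eqP.
apply: eq_integral => z _; rewrite patchE indicE.
by case: ifPn => _; rewrite ?mul1e ?mul0e.
Qed.

End kernel_comparison.

(** * The kernel of L(D) against the Gagliardo kernel *)

Section kernel.
Context {R : realType} {n : nat} (s : R) (a : 'rV[R]_n -> R) (C : set 'rV[R]_n)
  (hs : 0 < s < 1) (hA1 : condA1 s a) (hA2 : condA2 a) (hA3 : condA3 a C).
Local Notation mu := (lebesgue_rV n).

Implicit Types z : 'rV[R]_n.

Let p : R := n%:R + 2 * s.

Let p0 : 0 < p.
Proof. by rewrite /p ltr_wpDl// mulr_gt0//; case/andP: hs. Qed.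

(* The homogeneous extension of a, set to 0 at the origin. *)
Definition adir (z : 'rV[R]_n) : R := (a \_ sphere) (udir z).

Lemma measurable_sphere : measurable (@sphere R n).
Proof.
rewrite (_ : sphere = [set: 'rV[R]_n] `&` enorm @^-1` [set 1]).
  exact: measurable_enorm.
by rewrite setTI.
Qed.

Lemma measurable_adir : measurable_fun setT adir.
Proof.
apply: measurableT_comp; last exact: measurable_udir.
apply/(measurable_restrictT _ _).1; first exact: measurable_sphere.
by apply/measurable_EFinP; case: hA1 => /integrableP[].
Qed.

Lemma adir_ge0 z : 0 <= adir z.
Proof. by rewrite /adir patchE; case: ifPn => // /set_mem /hA2[]. Qed.

Lemma adirZ t z : 0 < t -> adir (t *: z) = adir z.
Proof. by move=> t0; rewrite /adir udirZ. Qed.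

Lemma sphereN (z : 'rV[R]_n) : sphere (- z) = sphere z :> Prop.
Proof. by rewrite /sphere /= enormN. Qed.

Lemma adirN z : adir (- z) = adir z.
Proof.
rewrite /adir udirN !patchE; case: ifPn => /= h; case: ifPn => h' //.
- by move/set_mem : h'; move/set_mem: h => + /hA2[].
- by exfalso; move/negP: h'; apply; apply/mem_set; move/set_mem: h; rewrite sphereN.
- by exfalso; move/negP: h; apply; apply/mem_set; rewrite sphereN; exact/set_mem.
Qed.

Lemma sphere_udir z : z != 0 -> sphere (udir z).
Proof. exact: enorm_udir. Qed.

Lemma adirE z : z != 0 -> adir z = a (udir z).
Proof. by move=> z0; rewrite /adir patchE mem_set//; exact: sphere_udir. Qed.

Lemma udir0 : udir (0 : 'rV[R]_n) = 0.
Proof. by rewrite /udir scaler0. Qed.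

Lemma adir0 : adir 0 = 0.
Proof.
rewrite /adir udir0 patchE memNset// /sphere /= enorm0 => /eqP.
by rewrite eq_sym oner_eq0.
Qed.

(** At the origin both sides vanish because the power of 0 is 0 and so is its inverse; elsewhere
    [udir z] lies on the sphere. The junk values of [a] off the sphere therefore never enter the
    kernel. *)
Lemma kernE z : kern s a z = adir z / enorm z `^ p.
Proof.
have [->|z0] := eqVneq z 0; last by rewrite /kern adirE.
by rewrite /kern adir0 enorm0 powR0 ?gt_eqF// invr0 mulr0 mulr0.
Qed.

Lemma kern_ge0 z : 0 <= kern s a z.
Proof. by rewrite kernE divr_ge0 ?adir_ge0// powR_ge0. Qed.

Lemma kernN z : kern s a (- z) = kern s a z.
Proof. by rewrite !kernE adirN enormN. Qed.

Lemma kern0 : kern s a 0 = 0.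
Proof. by rewrite kernE adir0 mul0r. Qed.

Lemma measurable_enorm_powRV : measurable_fun setT (fun z : 'rV[R]_n => (enorm z `^ p)^-1).
Proof.
apply: measurable_fun_ge0_inv => [|x]; last exact: powR_ge0.
by apply: (measurableT_comp (measurable_powR _)); exact: measurable_enorm.
Qed.

Lemma measurable_kern : measurable_fun setT (kern s a).
Proof.
rewrite (_ : kern s a = fun z => adir z / enorm z `^ p); last exact/funext/kernE.
by apply: measurable_funM; [exact: measurable_adir|exact: measurable_enorm_powRV].
Qed.

Lemma sym_coneZ (t : R) z : is_cone C -> 0 < t -> sym_cone C z -> sym_cone C (t *: z).
Proof.
move=> cC t0 [[y Cy <-]|Cz]; last by right; exact: cC.
by left; exists (t *: y); rewrite ?scalerN//; exact: cC.
Qed.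

Lemma kern_neq0 z : kern s a z != 0 -> sym_cone C z.
Proof.
have [->|z0] := eqVneq z 0; first by rewrite kern0 eqxx.
rewrite kernE adirE// mulf_eq0 => /norP[/eqP az _].
have [_ /(_ _ (sphere_udir z0))[/(_ az) h _]] := hA3.
have ez : 0 < enorm z by rewrite enorm_gt0.
rewrite -[z]scale1r -(mulfV (lt0r_neq0 ez)) -scalerA.
by apply: sym_coneZ => //; case: hA3 => -[].
Qed.

Lemma cone_neq0 z : C z -> z != 0.
Proof. by move=> Cz; apply/eqP => z0; case: hA3 => -[_ _ _ _]; rewrite -z0. Qed.

Lemma adir_gt0 z : C z -> 0 < adir z.
Proof.
move=> Cz; rewrite lt_neqAle adir_ge0 andbT eq_sym.
have z0 := cone_neq0 Cz; rewrite adirE//; apply/eqP.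
have [[_ _ _ cC _] /(_ _ (sphere_udir z0))[_ ]] := hA3; apply.
by right; apply: cC => //; rewrite invr_gt0 enorm_gt0.
Qed.

(** In dimension zero the only vector is 0, which the non-empty cone omits. Positivity of n allows
    the factor n of the sphere measure to be divided out in the next lemma. *)
Lemma dim_gt0 : (0 < n)%N.
Proof.
rewrite lt0n; apply/eqP => n0; have [[_ _ [z Cz] _ _] _] := hA3.
have /eqP := cone_neq0 Cz; apply; apply/rowP => i.
by have := ltn_ord i; rewrite {2}n0.
Qed.

(** The sphere measure is n times the image of Lebesgue measure on the punctured ball under [udir],
    so the integral of [a] over the sphere is n times that of [adir] over the ball. This is how
    integrability of [a] is used: afterwards everything is stated for Lebesgue measure. *)
Lemma integral_adir_lty : (\int[mu]_(z in eball 0%R 1%R) (adir z)%:E < +oo)%E.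
Proof.
have [/integrableP[mA]] := hA1.
rewrite (integral_mkcond sphere) => + _.
rewrite (_ : _ \_ _ = EFin \o (a \_ sphere)); last first.
  apply/funext => x /=; rewrite !patchE; case: ifPn => // /set_mem xS.
  by rewrite /= ger0_norm//; case: (hA2 xS).
have mas : measurable_fun setT (EFin \o (a \_ sphere)).
  apply/measurable_EFinP/(measurable_restrictT _ _).1; first exact: measurable_sphere.
  exact/measurable_EFinP.
have as0 x : (0 <= (EFin \o (a \_ sphere)) x)%E.
  by rewrite lee_fin patchE; case: ifPn => // /set_mem /hA2[].
have mPB := @measurable_punctured_ball R n.
have n0 : (0 < n%:R :> R) by rewrite ltr0n dim_gt0.
have mad : measurable_fun setT (EFin \o adir).
  by apply/measurable_EFinP; exact: measurable_adir.
rewrite ge0_integral_mscale//=; last by move=> x _; exact: as0.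
rewrite (_ : (\int[_]_x _)%E =
  (\int[pushforward (mrestr mu mPB) udir]_x (EFin \o (a \_ sphere)) x)%E)//.
rewrite (ge0_integral_pushforward measurable_udir)//=; last by move=> x _; exact: as0.
rewrite preimage_setT => h.
have h' : (n%:R%:E * \int[mrestr mu mPB]_x (adir x)%:E < +oo)%E := h.
have I0 : (0 <= \int[mrestr mu mPB]_x (adir x)%:E)%E.
  by apply: integral_ge0 => x _; rewrite lee_fin adir_ge0.
have : (\int[mrestr mu mPB]_x (adir x)%:E < +oo)%E.
  case: integral h' I0 => [r _ _|+ _|//]; first by rewrite ltry.
  by rewrite gt0_muley ?lte_fin.
apply: le_lt_trans; apply: (@le_trans _ _ (\int[mu]_(x in punctured_ball) (adir x)%:E)%E).
  rewrite (integral_mkcond (eball 0 1)) (integral_mkcond punctured_ball).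
  rewrite le_eqVlt; apply/orP; left; apply/eqP; apply: eq_integral => x _.
  rewrite !patchE; have [->|x0] := eqVneq x 0.
    by rewrite adir0; case: ifP => _; case: ifP.
  congr (if _ then _ else _); apply/idP/idP => /set_mem xB; apply/mem_set; move: xB.
    by rewrite eball0E /punctured_ball /= enorm_gt0 x0.
  by rewrite eball0E /punctured_ball /= => /andP[].
rewrite (eq_measure_integral (mrestr mu mPB)); last first.
  by move=> A mA' AB; rewrite /= /mrestr setIidl.
apply: ge0_subset_integral => //.
by move=> x _; rewrite lee_fin adir_ge0.
Qed.

(** On the cone [adir] is positive but no lower bound is available. These superlevel sets exhaust
    the cone as [del] decreases to 0, and on each of them the kernel is at least [del] times the
    Gagliardo kernel. *)
Definition good_dir (del : R) : set 'rV[R]_n := [set z | z != 0 /\ del <= adir z].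

Lemma measurable_good_dir del : measurable (good_dir del).
Proof.
rewrite (_ : good_dir del =
    ~` (enorm @^-1` [set 0]) `&` [set z | del <= adir z]); last first.
  by apply/seteqP; split=> z [/= z0 dz]; split=> //=; move: z0; rewrite -enorm_eq0 => /eqP.
apply: measurableI.
  apply: measurableC; rewrite -[X in measurable X]setTI.
  exact: measurable_enorm.
rewrite -[X in measurable X]setTI; apply: measurable_fun_le => //.
exact: measurable_adir.
Qed.

Lemma good_dirN del z : good_dir del (- z) = good_dir del z :> Prop.
Proof. by rewrite /good_dir /= oppr_eq0 adirN. Qed.

Lemma good_dirZ del t z : 0 < t -> good_dir del (t *: z) = good_dir del z :> Prop.
Proof. by move=> t0; rewrite /good_dir /= scaler_eq0 gt_eqF// adirZ. Qed.

(** The parts of a ball inside the cone that miss [good_dir] at level 1/(k+1) decrease to the empty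
    set, so their measure tends to 0 by continuity from above. The ball of radius 3 r still lies in
    the cone, which excludes 0: hence 3 r < |c|, and vectors in the ball of radius 2 r have norms
    bounded away from 0. The fraction 1/4 is chosen so that two such bad sets cover at most half of
    the smaller ball. *)
Lemma good_ball : exists c r del, [/\ 0 < r, 0 < del, 3 * r < enorm c &
  (mu (eball c (2 * r) `\` good_dir del) <= (4^-1)%:E * mu (eball c r))%E].
Proof.
have [[_ oC [c Cc] _ C0] _] := hA3.
have [r0 r00 r0C] := (open_enormP C).1 oC c Cc.
pose r := r0 / 4; have rp : 0 < r by rewrite divr_gt0.
have ballC z : enorm (z - c) <= 3 * r -> C z.
  by move=> zc; apply: r0C; rewrite enormB; apply: le_lt_trans zc _; rewrite /r; lra.
have cr : 3 * r < enorm c.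
  by rewrite ltNge; apply/negP => h; apply: C0; apply: ballC; rewrite sub0r enormN.
pose F k := eball c (2 * r) `\` good_dir k.+1%:R^-1.
have mF k : measurable (F k).
  by apply: measurableD; [exact: measurable_eball|exact: measurable_good_dir].
have capF : \bigcap_k F k = set0.
  apply/seteqP; split => // z Fz; have [zc _] := Fz 0%N I.
  have Cz : C z.
    by apply: ballC; move: zc rp; rewrite /eball /=; move: (enorm _) => y; lra.
  have [k /ltW kz] := exists_natSinv_lt (adir_gt0 Cz).
  by have [_] := Fz k I; apply; split => //; exact: cone_neq0.
have F0 : (mu (F 0%N) < +oo)%E.
  apply: le_lt_trans (lebesgue_rV_eball_lty c (2 * r)).
  by apply: le_measure; rewrite ?inE//; [exact: measurable_eball|exact: subDsetl].
have nF : {homo F : k m / (k <= m)%N >-> (m <= k)%O}.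
  move=> k m km; apply/subsetPset => z [zc zF]; split => // -[z0 kz]; apply: zF.
  split => //; apply: le_trans kz; rewrite lef_pV2 ?posrE//.
  by rewrite ler_nat.
have := @nonincreasing_cvg_mu _ _ _ mu F F0 mF _ nF.
rewrite capF measure0 => /(_ measurable0) cF.
have b0 := lebesgue_rV_eball_gt0 c rp.
have e0 : (0 < (4^-1)%:E * mu (eball c r))%E.
  by rewrite mule_gt0// lte_fin invr_gt0.
have [k kF] : exists k, (mu (F k) < (4^-1)%:E * mu (eball c r))%E.
  have : nbhs (0%E : \bar R) [set x | (x < (4^-1)%:E * mu (eball c r))%E].
    by apply: open_nbhs_nbhs; split => //; exact: open_ereal_lt_ereal.
  by move=> /cF[k _ /(_ k (leqnn k))] h; exists k.
by exists c, r, k.+1%:R^-1; split => //; exact: ltW.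
Qed.

(** Rescale z to a vector z' of norm r. For w' in the ball of radius r about c, both w' and w' - z'
    lie in the ball of radius 2 r, and discarding the w' for which one of them is bad leaves at
    least half of the volume. Scaling back gives w = t w' and z - w = -t (w' - z'), which is good
    because [adir] is even. The constants alpha and beta are the extreme ratios of |v| to r for v in
    the ball of radius 2 r, and kappa is half the volume of the ball of radius r divided by r^n. *)
Lemma splittings_good : exists alpha beta del kappa,
  [/\ 0 < alpha, 0 < beta, 0 < del, 0 < kappa &
  forall z, z != 0 ->
    ((kappa * enorm z ^+ n)%:E <= mu (splittings (good_dir del) alpha beta z))%E].
Proof.
have [c [r [del [r0 d0 cr hbad]]]] := good_ball.
set Bad := eball c (2 * r) `\` good_dir del in hbad.
have mBad : measurable Bad.
  by apply: measurableD; [exact: measurable_eball|exact: measurable_good_dir].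
pose b : R := fine (mu (eball c r)).
have bE : mu (eball c r) = b%:E.
  by rewrite /b fineK// ge0_fin_numE//; exact: lebesgue_rV_eball_lty.
have b0 : 0 < b by rewrite -lte_fin -bE lebesgue_rV_eball_gt0.
exists ((enorm c - 2 * r) / r), ((enorm c + 2 * r) / r), del, (b / 2 / r ^+ n).
have c0 : 0 < enorm c - 2 * r by lra.
have c1 : 0 < enorm c + 2 * r by lra.
split => //; rewrite ?divr_gt0 ?exprn_gt0// => z z0.
have ez : 0 < enorm z by rewrite enorm_gt0.
pose t := enorm z / r; have t0 : 0 < t by rewrite divr_gt0.
pose z' : 'rV[R]_n := t^-1 *: z.
have z'r : enorm z' = r.
  by rewrite enormZ gtr0_norm ?invr_gt0// /t; field; rewrite !gt_eqF.
pose Bad' : set 'rV[R]_n := [set w | Bad (1 *: w + (- z'))].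
pose S := eball c r `\` (Bad `|` Bad').
have mBad' : measurable Bad'.
  by rewrite -[X in measurable X]setTI; exact: measurable_rV_affine.
have mS : measurable S.
  by apply: measurableD; [exact: measurable_eball|exact: measurableU].
have hbad' : (mu Bad' <= (4^-1)%:E * mu (eball c r))%E.
  by rewrite /Bad' lebesgue_rV_affine// expr1n invr1 mul1e.
have muS : ((b / 2)%:E <= mu S)%E.
  have h1 : (mu (Bad `|` Bad') <= (b / 2)%:E)%E.
    apply: le_trans (measureU2 _ mBad mBad') _.
    apply: le_trans (leeD hbad hbad') _.
    by rewrite bE -EFinM -EFinD lee_fin; lra.
  have h2 : (b%:E <= mu S + (b / 2)%:E)%E.
    rewrite -bE; apply: (@le_trans _ _ (mu (S `|` (Bad `|` Bad')))).
      apply: le_measure; rewrite ?inE; first exact: measurable_eball.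
        by apply: measurableU => //; exact: measurableU.
      move=> w wc; have [h|h] := pselect ((Bad `|` Bad') w).
        by right.
      by left.
    apply: le_trans (measureU2 _ mS (measurableU _ _ mBad mBad')) _.
    exact: leeD.
  move: h2; rewrite -leeBlDr// -EFinB; apply: le_trans.
  by rewrite lee_fin; lra.
have mSt : measurable [set w | S (t^-1 *: w + 0)].
  by rewrite -[X in measurable X]setTI; exact: measurable_rV_affine.
apply: (@le_trans _ _ (mu [set w | S (t^-1 *: w + 0)])).
  rewrite lebesgue_rV_affine ?invr_gt0// exprVn invrK.
  have -> : (b / 2 / r ^+ n * enorm z ^+ n)%:E = ((t ^+ n)%:E * (b / 2)%:E)%E.
    by rewrite -EFinM /t expr_div_n; congr EFin; field; rewrite expf_neq0// gt_eqF.
  by apply: lee_wpmul2l; rewrite // lee_fin exprn_ge0// ltW.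
apply: le_measure; rewrite ?inE//.
  rewrite -[X in measurable X]/((fun w => (z, w)) @^-1`
    [set q : 'rV[R]_n * 'rV[R]_n | splittings (good_dir del) ((enorm c - 2 * r) / r) ((enorm c +
      2 * r) / r) q.1 q.2]).
  rewrite -[X in measurable X]setTI; apply: measurable_pair1 => //.
  apply: measurable_splittings; exact: measurable_good_dir.
move=> w; rewrite /= addr0 => -[]; set w' := t^-1 *: w => w'c /not_orP[nb1 nb2].
have wE : w = t *: w' by rewrite scalerA mulfV ?scale1r// gt_eqF.
have zE : z = t *: z' by rewrite scalerA mulfV ?scale1r// gt_eqF.
have w'c2 : eball c (2 * r) w' by apply: le_trans w'c _; lra.
have g1 : good_dir del w'.
  by apply: contrapT => h; apply: nb1; split.
have w'zc : eball c (2 * r) (w' - z').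
  rewrite /eball /= addrAC; apply: le_trans (enormD _ _) _.
  rewrite enormN z'r; have : enorm (w' - c) <= r by exact: w'c.
  by lra.
have g2 : good_dir del (w' - z').
  by apply: contrapT => h; apply: nb2; rewrite /Bad' /= scale1r; split.
have zw : z - w = - (t *: (w' - z')) by rewrite [in LHS]wE [in LHS]zE scalerBr opprB.
have cmp v : eball c (2 * r) v -> comparable_norms ((enorm c - 2 * r) / r)
    ((enorm c + 2 * r) / r) z (t *: v).
  rewrite /eball /= => vc; rewrite /comparable_norms enormZ gtr0_norm//.
  have l1 : enorm c - 2 * r <= enorm v.
    by have := enorm_sub_le c v; rewrite enormB; lra.
  have l2 : enorm v <= enorm c + 2 * r.
    by have := enorm_sub_le v c; lra.
  rewrite /t mulrAC [X in _ <= X <= _]mulrAC [X in _ <= _ <= X]mulrAC.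
  rewrite !ler_pM2r ?invr_gt0// ![_ * enorm z]mulrC !ler_pM2l//.
  by rewrite l1.
split; rewrite ?zw.
- by rewrite wE good_dirZ.
- by rewrite good_dirN good_dirZ.
- by rewrite wE; exact: cmp.
- by rewrite /comparable_norms enormN; exact: cmp.
Qed.

(** On the shell |w| / beta <= |z| <= |w| / alpha the powers of |z| are bounded by their values at
    the inner radius; the rest is at most the integral of [b] over the outer ball, which homogeneity
    reduces to the unit ball. The n-th powers of |w| cancel and |w|^(-p) remains. *)
Lemma integral_shell_le (b : 'rV[R]_n -> R) (alpha beta : R) :
  0 < alpha -> 0 < beta -> measurable_fun setT b -> (forall z, 0 <= b z) ->
  (forall (t : R) z, 0 < t -> b (t *: z) = b z) ->
  (\int[mu]_(z in eball 0%R 1%R) (b z)%:E < +oo)%E ->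
  exists2 M, 0 <= M & forall w, w != 0 ->
    (\int[mu]_(z in [set z | comparable_norms alpha beta z w])
       (b z / enorm z `^ p / enorm z ^+ n)%:E <= (M / enorm w `^ p)%:E)%E.
Proof.
move=> al0 be0 mb b0 bZ bfin.
pose I1 := fine (\int[mu]_(z in eball 0%R 1%R) (b z)%:E).
have I1E : (\int[mu]_(z in eball 0%R 1%R) (b z)%:E)%E = I1%:E.
  by rewrite fineK// ge0_fin_numE//; apply: integral_ge0 => z _; rewrite lee_fin.
have I10 : 0 <= I1.
  by rewrite -lee_fin -I1E; apply: integral_ge0 => z _; rewrite lee_fin.
exists (beta `^ p * beta ^+ n / alpha ^+ n * I1).
  by rewrite !mulr_ge0 ?powR_ge0 ?exprn_ge0 ?invr_ge0 ?exprn_ge0// ltW.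
move=> w w0; have ew : 0 < enorm w by rewrite enorm_gt0.
pose r1 := enorm w / beta; pose r2 := enorm w / alpha.
have r10 : 0 < r1 by rewrite divr_gt0.
have r20 : 0 < r2 by rewrite divr_gt0.
have mC : measurable [set z | comparable_norms alpha beta z w].
  by apply: measurable_comparable_norms => //; exact: measurable_id.
have mbE : measurable_fun setT (EFin \o b) by exact/measurable_EFinP.
apply: (@le_trans _ _ (\int[mu]_(z in eball 0 r2)
    ((r1 `^ p)^-1 / r1 ^+ n * b z)%:E)%E).
  rewrite (integral_mkcond [set z | comparable_norms alpha beta z w]).
  rewrite (integral_mkcond (eball 0 r2)).
  apply: ge0_le_integral => //.
  - move=> z _; rewrite patchE; case: ifP => // _; rewrite lee_fin.
    by rewrite !mulr_ge0 ?b0 ?invr_ge0 ?powR_ge0 ?exprn_ge0 ?enorm_ge0.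
  - apply/(measurable_restrictT _ _).1 => //; apply: measurable_funTS.
    apply/measurable_EFinP; apply: measurable_funM.
      by apply: measurable_funM => //; exact: measurable_enorm_powRV.
    apply: measurable_fun_ge0_inv; first by apply: measurable_funX; exact: measurable_enorm.
    by move=> z; rewrite exprn_ge0// enorm_ge0.
  - apply/(measurable_restrictT _ _).1; first exact: measurable_eball.
    by apply: measurable_funTS; apply/measurable_EFinP; exact: measurable_funM.
  - move=> z _; rewrite !patchE; case: ifPn => [/set_mem /= /andP[zw1 zw2]|_].
      have zr2 : eball 0 r2 z by rewrite eball0E ler_pdivlMr// mulrC.
      have zr1 : r1 <= enorm z by rewrite ler_pdivrMr// mulrC.
      rewrite mem_set// lee_fin [leRHS]mulrC -mulrA ler_wpM2l//.
      have ez := lt_le_trans r10 zr1.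
      apply: ler_pM; rewrite ?invr_ge0 ?powR_ge0 ?exprn_ge0 ?enorm_ge0//.
        by rewrite lef_pV2 ?posrE ?powR_gt0// ge0_ler_powR ?nnegrE// ltW.
      rewrite lef_pV2 ?posrE ?exprn_gt0//.
      by apply: lerXn2r => //; rewrite nnegrE ltW.
    case: ifPn => // _; rewrite lee_fin !mulr_ge0 ?b0 ?invr_ge0 ?powR_ge0 ?exprn_ge0//.
    exact: ltW.
under eq_integral do rewrite EFinM.
rewrite ge0_integralZl_EFin//; last 4 first.
- exact: measurable_eball.
- by move=> z _; rewrite lee_fin.
- exact: measurable_funTS.
- by rewrite mulr_ge0 ?invr_ge0 ?powR_ge0 ?exprn_ge0// ltW.
rewrite integral_homogeneous//; last by move=> t z t0; rewrite bZ.
rewrite I1E -!EFinM lee_fin le_eqVlt; apply/orP; left; apply/eqP.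
rewrite /r1 /r2 powRM ?invr_ge0 ?ltW//.
have bep : 0 < beta `^ p by rewrite powR_gt0.
have -> : beta^-1 `^ p = (beta `^ p)^-1.
  apply: (mulIf (lt0r_neq0 bep)); rewrite mulVf ?gt_eqF//.
  by rewrite -powRM ?invr_ge0 ?ltW// mulVf ?gt_eqF// powR1.
rewrite !expr_div_n.
field.
by rewrite !expf_neq0 ?gt_eqF ?powR_gt0.
Qed.

Lemma gagliardoE u : gagliardo s u = kenergy (fun z => (enorm z `^ p)^-1) u.
Proof. by []. Qed.

(** The same splittings serve both inequalities with the kernels exchanged. For the first, the shell
    bound is used with b = 1 and the kernel is at least [del] |w|^(-p) in good directions, whence M2
    / [del]. For the second, it is used with b = [adir], so integrability of [a] replaces
    boundedness. *)
Lemma kenergy_gagliardo : exists2 K, 0 < K &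
  forall u, measurable_fun setT u ->
    (gagliardo s u <= K%:E * kenergy (kern s a) u)%E /\
    (kenergy (kern s a) u <= K%:E * gagliardo s u)%E.
Proof.
have [al [be [del [ka [al0 be0 del0 ka0 hA]]]]] := splittings_good.
have [|M1 M10 hM1] := integral_shell_le al0 be0 measurable_adir adir_ge0 (fun t z => @adirZ t z).
  exact: integral_adir_lty.
have fin1 : (\int[mu]_(z in eball 0%R 1%R) (1 : R)%:E < +oo)%E.
  rewrite integral_cst ?mul1e; [exact: lebesgue_rV_eball_lty|exact: measurable_eball].
have [M2 M20 hM2] := @integral_shell_le (fun=> 1) _ _ al0 be0
  (measurable_cst _) (fun=> ler01) (fun _ _ _ => erefl) fin1.
pose K := 4 / ka * (M2 / del) + 4 / ka * M1 + 1.
have ka1 := ltW ka0; have del1 := ltW del0.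
have t1 : 0 <= 4 / ka * (M2 / del) by rewrite mulr_ge0 ?divr_ge0.
have t2 : 0 <= 4 / ka * M1 by rewrite mulr_ge0 ?divr_ge0.
have K0 : 0 < K by rewrite /K; lra.
have mE := measurable_good_dir del.
exists K => // u mu_; split.
- rewrite gagliardoE; apply: (@le_trans _ _ ((4 / ka * (M2 / del))%:E * kenergy (kern s a) u)%E).
    apply: (@kenergy_compare _ _ _ _ _ (good_dir del) al be) => //.
    + exact: measurable_enorm_powRV.
    + by move=> z; rewrite invr_ge0 powR_ge0.
    + exact: measurable_kern.
    + exact: kern_ge0.
    + by rewrite divr_ge0.
    + by rewrite enorm0 powR0 ?invr0// gt_eqF.
    + move=> w [w0 dw].
      under eq_integral do rewrite -[X in (X / _ ^+ n)%R]mul1r.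
      apply: le_trans (hM2 w w0) _; rewrite lee_fin kernE.
      have ew : 0 < enorm w `^ p by rewrite powR_gt0// enorm_gt0.
      rewrite mulrA ler_pM2r ?invr_gt0// mulrAC -mulrA ler_peMr//.
      by rewrite ler_pdivlMr ?mul1r.
  apply: lee_wpmul2r; last by rewrite lee_fin /K; lra.
  apply: integral_ge0 => z _; rewrite lee_fin mulr_ge0 ?sqr_ge0//; exact: kern_ge0.
- pose G := fun z : 'rV[R]_n => (enorm z `^ p)^-1.
  have -> : gagliardo s u = kenergy G u by [].
  apply: (@le_trans _ _ ((4 / ka * M1)%:E * kenergy G u)%E).
    apply: (@kenergy_compare _ _ _ _ _ (good_dir del) al be) => //.
    + exact: measurable_kern.
    + exact: kern_ge0.
    + exact: measurable_enorm_powRV.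
    + by move=> z; rewrite invr_ge0 powR_ge0.
    + exact: kern0.
    + move=> w [w0 dw]; under eq_integral do rewrite kernE.
      exact: hM1.
  apply: lee_wpmul2r; last by rewrite lee_fin /K; lra.
  by apply: integral_ge0 => z _; rewrite lee_fin mulr_ge0 ?sqr_ge0// invr_ge0 powR_ge0.
Qed.

End kernel.

(** * Finite rank perturbations of an inner product *)

Section hilbert.
Context {R : realType} {E : lmodType R}.
Implicit Types (u v w : E) (V N : set E) (l : E -> R) (D : E -> E -> R).

Definition lin_subspace V := V 0 /\ forall (c : R) u v, V u -> V v -> V (c *: u + v).

(** Linearity is required on [V] only: the forms considered below are integrals, and additivity may
    fail at functions for which these diverge. *)
Definition linear_on V l :=
  forall (c : R) u v, V u -> V v -> l (c *: u + v) = c * l u + l v.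

(** Definiteness is not asked for, since functions that vanish almost everywhere are not identified
    with 0; vanishing of D u u plays the role of u = 0 throughout. *)
Definition semi_inner_product V D :=
  [/\ forall u v, V u -> V v -> D u v = D v u,
      forall w, V w -> linear_on V (D^~ w) &
      forall u, V u -> 0 <= D u u].

Definition sip_complete V D := forall U : nat -> E, (forall k, V (U k)) ->
  (forall e : R, 0 < e -> exists M, forall i j, (M <= i)%N -> (M <= j)%N ->
     D (U i - U j) (U i - U j) < e) ->
  exists2 g, V g & forall e : R, 0 < e -> exists M, forall i, (M <= i)%N ->
     D (U i - g) (U i - g) < e.

Lemma subspaceB V u v : lin_subspace V -> V u -> V v -> V (u - v).
Proof. by move=> [_ VD] Vu Vv; rewrite addrC -scaleN1r; exact: VD. Qed.

Lemma subspaceD V u v : lin_subspace V -> V u -> V v -> V (u + v).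
Proof. by move=> [_ VD] Vu Vv; rewrite -[u]scale1r; exact: VD. Qed.

Lemma subspaceZ V (c : R) u : lin_subspace V -> V u -> V (c *: u).
Proof. by move=> [V0 VD] Vu; rewrite -[_ *: _]addr0; exact: VD. Qed.

Lemma subspace_sum V m (c : 'I_m -> R) (e : 'I_m -> E) : lin_subspace V ->
  (forall i, V (e i)) -> V (\sum_i c i *: e i).
Proof.
move=> [V0 VD] Ve; elim/big_ind : _ => // [u v|i _]; first exact: subspaceD.
exact: subspaceZ.
Qed.

Lemma linear_on0 V l : lin_subspace V -> linear_on V l -> l 0 = 0.
Proof.
move=> [V0 _] lV; have := lV 1 0 0 V0 V0.
by rewrite scale1r addr0 mul1r => /eqP; rewrite -subr_eq subrr => /eqP <-.
Qed.

Lemma linear_on_sum V l m (c : 'I_m -> R) (e : 'I_m -> E) : lin_subspace V ->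
  linear_on V l -> (forall i, V (e i)) ->
  l (\sum_i c i *: e i) = \sum_i c i * l (e i).
Proof.
move=> sV lV Ve; elim: m => [|m IH] in c e Ve *.
  by rewrite !big_ord0; exact: linear_on0 lV.
rewrite !big_ord_recl lV; last exact: subspace_sum.
  by rewrite IH.
exact: Ve.
Qed.

Section semi_inner_product.
Variables (V : set E) (D : E -> E -> R).
Context (sV : lin_subspace V) (DV : semi_inner_product V D).

Let Dsym u v : V u -> V v -> D u v = D v u. Proof. by case: DV => + _ _; apply. Qed.
Let Dlin w : V w -> linear_on V (D^~ w). Proof. by case: DV => _ + _; apply. Qed.
Let D0 u : V u -> 0 <= D u u. Proof. by case: DV => _ _; apply. Qed.

Lemma sip_expand (c : R) u v : V u -> V v ->
  D (c *: u + v) (c *: u + v) = c ^+ 2 * D u u + 2 * c * D u v + D v v.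
Proof.
move=> Vu Vv; have Vw : V (c *: u + v) by apply: sV.2.
rewrite Dlin// [D u _]Dsym// [D v _]Dsym// !Dlin// [D v u]Dsym//.
by ring.
Qed.

Lemma sipBB u v : V u -> V v -> D (u - v) (u - v) = D u u - 2 * D u v + D v v.
Proof.
move=> Vu Vv; rewrite addrC -scaleN1r sip_expand// [D v u]Dsym//.
by ring.
Qed.

Lemma sip_quasi_triangle u v w : V u -> V v -> V w ->
  D (u - w) (u - w) <= 2 * D (u - v) (u - v) + 2 * D (v - w) (v - w).
Proof.
move=> Vu Vv Vw.
have V1 : V (u - v) by exact: subspaceB.
have V2 : V (v - w) by exact: subspaceB.
have := D0 (subspaceB sV V1 V2); rewrite sipBB// => h.
have -> : u - w = 1 *: (u - v) + (v - w) by rewrite scale1r addrA subrK.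
by rewrite sip_expand//; lra.
Qed.

Lemma sip_CauchySchwarz u v : V u -> V v -> D u v ^+ 2 <= D u u * D v v.
Proof.
move=> Vu Vv; have h t := D0 (sV.2 t u v Vu Vv).
have {}h t : 0 <= t ^+ 2 * D u u + 2 * t * D u v + D v v by rewrite -sip_expand.
have [uu0|uu0] := eqVneq (D u u) 0.
  rewrite uu0 mul0r; have [->|x0] := eqVneq (D u v) 0; first by rewrite expr0n.
  (* With D u u = 0 the quadratic polynomial is affine in t, and at this t it takes the value -1. *)
  have := h (- (D v v + 1) / (2 * D u v)); rewrite uu0 mulr0 add0r.
  have -> : 2 * (- (D v v + 1) / (2 * D u v)) * D u v = - (D v v + 1) by field.
  by lra.
have uup : 0 < D u u by rewrite lt_neqAle eq_sym uu0 D0.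
have := h (- D u v / D u u).
have -> : (- D u v / D u u) ^+ 2 * D u u + 2 * (- D u v / D u u) * D u v + D v v =
   (D u u * D v v - D u v ^+ 2) / D u u by field.
by rewrite pmulr_lge0 ?invr_gt0// subr_ge0.
Qed.

(** A sequence in N minimising J(v) = D v v - 2 l v is Cauchy, and its limit g represents l. As N
    need not be closed, g is only found in V, but within any distance of N. For N = V this is the
    Riesz representation; for l = D w it is the orthogonal projection of w onto the closure of N. *)
Lemma riesz_approx N l (K : R) : sip_complete V D ->
  lin_subspace N -> N `<=` V -> linear_on N l -> 0 <= K ->
  (forall v, N v -> l v ^+ 2 <= K * D v v) ->
  exists g, [/\ V g, forall r, N r -> D g r = l r &
    forall e : R, 0 < e -> exists2 r, N r & D (g - r) (g - r) < e].
Proof.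
move=> cV sN NV lN K0 lK.
pose J v := D v v - 2 * l v.
have JK v : N v -> - K <= J v.
  move=> Nv; have := lK v Nv; have := D0 (NV v Nv); rewrite /J.
  set d := D v v; set x := l v => d0 xK.
  have : 2 * x <= d + K.
    rewrite leNgt; apply/negP => h.
    by have := sqr_ge0 (d - K); nra.
  by lra.
pose S := [set J v | v in N].
have S0 : S !=set0 by exists (J 0), 0 => //; case: sN.
have Slb : has_lbound S by exists (- K) => _ [v Nv <-]; exact: JK.
pose m := inf S.
have mJ v : N v -> m <= J v by move=> Nv; apply: ge_inf => //; exists v.
have near_m (k : nat) : exists v, N v /\ J v < m + k.+1%:R^-1.
  have [_ [v Nv <-] h] := @inf_adherent _ S k.+1%:R^-1 ltac:(by rewrite invr_gt0) (conj S0 Slb).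
  by exists v.
have [U hU] := choice near_m.
have NU k := (hU k).1; have JU k := (hU k).2.
(* Parallelogram law: D(u - v, u - v) = 2 J(u) + 2 J(v) - 4 J((u + v) / 2), and J is at least m at
   the midpoint. *)
have par u v : N u -> N v -> D (u - v) (u - v) <= 2 * (J u - m) + 2 * (J v - m).
  move=> Nu Nv; have Nw : N (2^-1 *: (u + v)) by apply: subspaceZ => //; exact: subspaceD.
  have := mJ _ Nw; rewrite /J.
  have -> : l (2^-1 *: (u + v)) = 2^-1 * (l u + l v).
    have := lN 2^-1 (u + v) 0 (subspaceD sN Nu Nv) sN.1.
    rewrite addr0 (linear_on0 sN lN) addr0 => ->.
    by have := lN 1 u v Nu Nv; rewrite scale1r mul1r => ->.
  have Vu := NV u Nu; have Vv := NV v Nv.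
  have -> : D (2^-1 *: (u + v)) (2^-1 *: (u + v)) = 4^-1 * (D u u + 2 * D u v + D v v).
    have := sip_expand 2^-1 (subspaceD sV Vu Vv) sV.1.
    rewrite addr0 => ->.
    have D00 w : V w -> D w 0 = 0.
      by move=> Vw; rewrite Dsym ?(linear_on0 sV (Dlin Vw))//; case: sV.
    have V0 := sV.1; have Vuv := subspaceD sV Vu Vv; rewrite !D00//.
    have := sip_expand 1 Vu Vv; rewrite scale1r => ->.
    by field.
  by rewrite sipBB//; lra.
have cauchyU : forall e : R, 0 < e -> exists M, forall i j, (M <= i)%N -> (M <= j)%N ->
     D (U i - U j) (U i - U j) < e.
  move=> e e0; have e4 : 0 < e / 4 by rewrite divr_gt0.
  have [M _ /(_ _ _) hM] := near_infty_natSinv_lt (PosNum e4).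
  exists M => i j /hM /= Mi /hM /= Mj.
  apply: le_lt_trans (par _ _ (NU i) (NU j)) _.
  have := JU i; have := JU j.
  move: (i.+1%:R^-1) (j.+1%:R^-1) Mi Mj => x y; lra.
have [g Vg gU] := cV U (fun k => NV _ (NU k)) cauchyU.
exists g; split => // [r Nr|e e0]; last first.
  have [M hM] := gU e e0; exists (U M) => //.
  have := hM M (leqnn M); rewrite !sipBB//; try exact: NV.
  by rewrite [D g (U M)]Dsym//; [lra|exact: NV].
have Vr := NV r Nr; have d0 := D0 Vr; set d := D r r in d0.
have del k : (D (U k) r - l r) ^+ 2 <= (d + 1) * k.+1%:R^-1.
  (* Almost minimality of U k, tested at U k + t r, says that t^2 d + 2 t x >= -1/(k+1). The nearly
     optimal t has denominator d + 1 because d may be 0. *)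
  set x := D (U k) r - l r; pose t := - x / (d + 1).
  have Vk := NV _ (NU k).
  have := mJ _ (sN.2 t r (U k) Nr (NU k)); have := JU k.
  rewrite /J sip_expand// lN// -/d [D r _]Dsym//.
  move: (k.+1%:R^-1) => y h1 h2.
  have h3 : - y <= t ^+ 2 * d + 2 * t * x by rewrite /x; lra.
  have d1 : 0 < d + 1 by lra.
  have h4 : t ^+ 2 * d + 2 * t * x = - (x ^+ 2 * ((d + 2) / (d + 1) ^+ 2)).
    by rewrite /t; field; rewrite gt_eqF.
  have h5 : x ^+ 2 * ((d + 2) / (d + 1) ^+ 2) <= y by lra.
  have h6 : (d + 1)^-1 <= (d + 2) / (d + 1) ^+ 2.
    rewrite ler_pdivlMr ?exprn_gt0// expr2 mulrA mulVf ?gt_eqF// mul1r; lra.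
  have h7 : x ^+ 2 * (d + 1)^-1 <= y.
    by apply: le_trans h5; rewrite ler_wpM2l ?sqr_ge0.
  by move: h7; rewrite ler_pdivrMr// mulrC.
(* Both D (U k) r - l r and D (U k - g) r have square at most e / 4 for large k, which (x - y)^2 <=
   2 x^2 + 2 y^2 turns into e. *)
have : (D g r - l r) ^+ 2 <= 0.
  apply/ler_addgt0Pr => e e0; rewrite add0r.
  have d1 : 0 < 4 * (d + 1) by lra.
  have e1 : 0 < e / (4 * (d + 1)) by rewrite divr_gt0.
  have [M1 hM1] := gU _ e1.
  have [M2 _ hM2] := near_infty_natSinv_lt (PosNum e1).
  pose k := maxn M1 M2.
  have := hM2 k (leq_maxr _ _); have := hM1 k (leq_maxl _ _) => /= h1 h2.
  have Vk := NV _ (NU k).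
  have := sip_CauchySchwarz (subspaceB sV Vk Vg) Vr; rewrite -/d.
  have -> : D (U k - g) r = D (U k) r - D g r.
    by rewrite addrC -scaleN1r Dlin//; ring.
  have := del k; have := D0 (subspaceB sV Vk Vg).
  move: (k.+1%:R^-1) h2 (D (U k - g) (U k - g)) h1 (D (U k) r) (D g r) (l r) => y hy z hz b c f z0.
  set ee := e / _ in hy hz.
  have ee1 : e = 4 * (d + 1) * ee by rewrite /ee mulrC divfK// gt_eqF.
  move=> hb hc.
  have hb' : (b - f) ^+ 2 <= (d + 1) * ee by apply: le_trans hb _; rewrite ler_wpM2l//; lra.
  have hc' : (b - c) ^+ 2 <= ee * (d + 1).
    apply: le_trans hc _; apply: ler_pM => //; lra.
  have -> : c - f = (b - f) - (b - c) by ring.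
  have := sqr_ge0 ((b - f) + (b - c)).
  by rewrite ee1; nra.
by move=> h; apply/eqP; rewrite -subr_eq0 -sqrf_eq0 eq_le h sqr_ge0.
Qed.

End semi_inner_product.

Section finite_rank_perturbation.
Variables (V N : set E) (D : E -> E -> R) (m : nat) (p : 'I_m -> E -> R) (K : R).
Context (sV : lin_subspace V) (DV : semi_inner_product V D) (cV : sip_complete V D)
  (sN : lin_subspace N) (NV : N `<=` V) (K0 : 0 <= K)
  (lp : forall i, linear_on V (p i))
  (bp : forall i v, V v -> p i v ^+ 2 <= K * D v v).

Let sip_eq0 u v : V u -> V v -> D u u = 0 -> D u v = 0.
Proof.
move=> Vu Vv u0; apply/eqP; rewrite -sqrf_eq0 eq_le sqr_ge0 andbT.
by apply: le_trans (sip_CauchySchwarz sV DV Vu Vv) _; rewrite u0 mul0r.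
Qed.

Let p_eq0 i u : V u -> D u u = 0 -> p i u = 0.
Proof.
move=> Vu u0; apply/eqP; rewrite -sqrf_eq0 eq_le sqr_ge0 andbT.
by apply: le_trans (bp i Vu) _; rewrite u0 mulr0.
Qed.

(* A(u, v) := D(u, v) - \sum_i p_i(u) p_i(v) is represented in the inner
   product D by the identity minus a finite rank operator, so its injectivity
   makes it surjective: any g orthogonal to N is represented by some phi with
   A(phi, -) = D(g, -), which vanishes on N. *)
Lemma dense_of_finite_rank_perturbation :
  (forall phi, V phi -> (forall v, V v -> D phi v = \sum_i p i phi * p i v) ->
     D phi phi = 0) ->
  (forall phi, V phi -> (forall r, N r -> D phi r = \sum_i p i phi * p i r) ->
     D phi phi = 0) ->
  forall w, V w -> forall e : R, 0 < e -> exists2 r, N r & D (w - r) (w - r) < e.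
Proof.
move=> injA testN w Vw e0 e0_gt0.
have [Dsym Dlin D0] := DV.
have [|||g0 [Vg0 g0N g0e]] := @riesz_approx V D sV DV N (D w) (D w w) cV sN NV.
- move=> c u v Nu Nv; have Vu := NV Nu; have Vv := NV Nv.
  by rewrite [D w _]Dsym ?Dlin ?[D w u]Dsym ?[D w v]Dsym//; exact: sV.2.
- exact: D0.
- by move=> v Nv; have := sip_CauchySchwarz sV DV Vw (NV Nv).
(* g0 is the projection of w onto the closure of N, so g is orthogonal to N and the claim reduces to
   D g g = 0. *)
pose g := w - g0; have Vg : V g by exact: subspaceB.
have DB u v x : V u -> V v -> V x -> D (u - v) x = D u x - D v x.
  by move=> Vu Vv Vx; rewrite addrC -scaleN1r Dlin//; ring.
have gN r : N r -> D g r = 0.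
  by move=> Nr; rewrite DB//; [rewrite g0N// subrr|exact: NV].
have ex_e i : exists ei, V ei /\ forall v, V v -> D ei v = p i v.
  have [ei [Vei eiE _]] := riesz_approx sV DV cV sV (fun v h => h) (lp i) K0 (bp i).
  by exists ei.
have [ee hee] := choice ex_e.
have Vee i := (hee i).1; have eeE i := (hee i).2.
pose M : 'M[R]_m := \matrix_(i, j) p j (ee i).
(* A row c fixed by M gives psi = \sum_i c_i e_i with p_j(psi) = c_j and A(psi, -) = 0; injectivity
   of A makes psi null, so every c_j = p_j(psi) vanishes. *)
have MU : 1%:M - M \in unitmx.
  rewrite -row_free_unit; apply: inj_row_free => c.
  rewrite mulmxBr mulmx1 => /eqP; rewrite subr_eq0 => /eqP cM.
  pose psi := \sum_i c ord0 i *: ee i.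
  have Vpsi : V psi by exact: subspace_sum.
  have ppsi j : p j psi = c ord0 j.
    rewrite (linear_on_sum _ sV (lp j) Vee) [in RHS]cM mxE.
    by apply: eq_bigr => i _; rewrite mxE.
  have psi0 : D psi psi = 0.
    apply: injA => // v Vv; rewrite (linear_on_sum _ sV (Dlin v Vv) Vee).
    by apply: eq_bigr => i _; rewrite ppsi eeE.
  by apply/rowP => j; rewrite mxE -ppsi p_eq0.
(* This c is the consistency condition p_j(phi) = c_j for phi = g + \sum_i c_i e_i, under which
   A(phi, -) = D(g, -). *)
pose c := (\row_j p j g) *m invmx (1%:M - M).
have cE j : c ord0 j = p j g + \sum_i c ord0 i * p j (ee i).
  have : c *m (1%:M - M) = \row_j p j g by rewrite mulmxKV.
  rewrite mulmxBr mulmx1 => /rowP/(_ j); rewrite !mxE => /eqP.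
  rewrite subr_eq => /eqP ->; congr (_ + _).
  by apply: eq_bigr => i _; rewrite [M _ _]mxE.
pose phi := 1 *: g + \sum_i c ord0 i *: ee i.
have Vsum : V (\sum_i c ord0 i *: ee i) by exact: subspace_sum.
have Vphi : V phi by exact: sV.2.
have pphi j : p j phi = c ord0 j.
  by rewrite lp// mul1r (linear_on_sum _ sV (lp j) Vee) -cE.
have Dphi v : V v -> D phi v = D g v + \sum_i p i phi * p i v.
  move=> Vv; rewrite Dlin// mul1r (linear_on_sum _ sV (Dlin v Vv) Vee).
  by congr (_ + _); apply: eq_bigr => i _; rewrite pphi eeE.
have phi0 : D phi phi = 0.
  by apply: testN => // r Nr; rewrite Dphi ?gN ?add0r//; exact: NV.
(* phi is null, hence so are D phi g and all p_i(phi), and the identity for [D phi] evaluated at g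
   leaves D g g. *)
have gg0 : D g g = 0.
  have := Dphi g Vg; rewrite (sip_eq0 Vphi Vg phi0).
  by rewrite big1 ?addr0// => i _; rewrite p_eq0// mul0r.
have e2 : 0 < e0 / 2 by rewrite divr_gt0.
have [r Nr hr] := g0e _ e2; exists r => //.
apply: le_lt_trans (sip_quasi_triangle sV DV Vw Vg0 (NV Nr)) _.
by rewrite -/g gg0; lra.
Qed.

End finite_rank_perturbation.
End hilbert.

(** * Square integrable functions and the space H^s *)

Section square_integrable.
Context d (T : measurableType d) (R : realType) (m : {measure set T -> \bar R}).
Implicit Types f g h : T -> R.
Local Open Scope ereal_scope.

Definition sqn f : \bar R := \int[m]_x (f x ^+ 2)%:E.

Definition sqint f := measurable_fun setT f /\ sqn f < +oo.

Definition ip f g : R := (\int[m]_x (f x * g x))%R.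

Lemma sqn_ge0 f : 0 <= sqn f.
Proof. by apply: integral_ge0 => x _; rewrite lee_fin sqr_ge0. Qed.

Lemma measurable_sqr f : measurable_fun setT f ->
  measurable_fun setT (fun x => (f x ^+ 2)%:E).
Proof. by move=> mf; apply/measurable_EFinP; exact: measurable_funX. Qed.

Lemma sqint_Lfun f : sqint f <-> f \in Lfun m 2%:E.
Proof.
split=> [[mf ff]|fL]; last first.
  have := Lfun2_integrable_sqr fL => /(integrable_lty measurableT) h; split => //.
  by move/sub_Lfun_mfun : fL; rewrite inE.
have E : (Lnorm m 2%:E (EFin \o f) `^ 2)%E = sqn f.
  rewrite powR_Lnorm//; apply: eq_integral => x _ /=.
  by rewrite powR_mulrn// real_normK ?num_real.
apply/andP; rewrite !inE; split => //; rewrite /= /finite_norm.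
have := Lnorm_ge0 m 2%:E (EFin \o f); move: ff; rewrite -E.
by case: (Lnorm m 2%:E _) => [r _ _|+ _|//]; [rewrite ltry|rewrite poweRyr].
Qed.

Lemma sqnD f g : measurable_fun setT f -> measurable_fun setT g ->
  sqn (fun x => f x + g x)%R <= 2%:E * sqn f + 2%:E * sqn g.
Proof.
move=> mf mg; have mf2 := measurable_sqr mf; have mg2 := measurable_sqr mg.
rewrite /sqn -!ge0_integralZl_EFin//; try (by move=> x _; rewrite lee_fin sqr_ge0).
rewrite -ge0_integralD//; try (by move=> x _; rewrite mule_ge0// lee_fin sqr_ge0);
  try exact: measurable_funeM.
apply: ge0_le_integral => //.
- by move=> x _; rewrite lee_fin sqr_ge0.
- by apply: measurable_sqr; exact: measurable_funD.
- by apply: emeasurable_funD; exact: measurable_funeM.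
- move=> x _; rewrite -!EFinM -EFinD lee_fin.
  by have := sqr_ge0 (f x - g x)%R; nra.
Qed.

Lemma sqnZ (c : R) f : measurable_fun setT f ->
  sqn (fun x => c * f x)%R = (c ^+ 2)%:E * sqn f.
Proof.
move=> mf; rewrite /sqn -ge0_integralZl_EFin ?sqr_ge0//.
- by apply: eq_integral => x _; rewrite exprMn EFinM.
- by move=> x _; rewrite lee_fin sqr_ge0.
- exact: measurable_sqr.
Qed.

Lemma sqintD (c : R) f g : sqint f -> sqint g ->
  sqint (fun x => c * f x + g x)%R.
Proof.
move=> [mf ff] [mg gg].
have mcf : measurable_fun setT (fun x => c * f x)%R by exact: measurable_funM.
split; first exact: measurable_funD.
apply: le_lt_trans (sqnD mcf mg) _; rewrite sqnZ//.
by rewrite lte_add_pinfty// lte_mul_pinfty// ?lee_fin ?sqr_ge0// lte_mul_pinfty// lee_fin sqr_ge0.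
Qed.

Lemma sqint_mul f g : sqint f -> sqint g ->
  m.-integrable setT (EFin \o (fun x => f x * g x)%R).
Proof.
move=> [mf ff] [mg gg]; apply/integrableP; split.
  by apply/measurable_EFinP; exact: measurable_funM.
apply: (@le_lt_trans _ _ (sqn f + sqn g)); last exact: lte_add_pinfty.
rewrite /sqn -ge0_integralD//; try (by move=> x _; rewrite lee_fin sqr_ge0);
  try exact: measurable_sqr.
apply: ge0_le_integral => //.
- apply: measurableT_comp => //; apply/measurable_EFinP; exact: measurable_funM.
- by apply: emeasurable_funD; exact: measurable_sqr.
- move=> x _; rewrite /= -EFinD lee_fin ler_norml; apply/andP; split.
    by have := sqr_ge0 (f x + g x)%R; have := sqr_ge0 (f x); have := sqr_ge0 (g x); nra.
  by have := sqr_ge0 (f x - g x)%R; have := sqr_ge0 (f x); have := sqr_ge0 (g x); nra.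
Qed.

Lemma ipC f g : ip f g = ip g f.
Proof. by apply: eq_Rintegral => x _; rewrite mulrC. Qed.

Lemma ip_linear (c : R) f g h : sqint f -> sqint g -> sqint h ->
  (ip (fun x => c * f x + g x) h = c * ip f h + ip g h)%R.
Proof.
move=> Lf Lg Lh; have fh := sqint_mul Lf Lh; have gh := sqint_mul Lg Lh.
rewrite /ip -RintegralZl// -RintegralD//.
  by apply: eq_Rintegral => x _; rewrite mulrDl mulrA.
have := integrableZl measurableT c fh.
by congr (integrable _ _ _); apply/funext => x; rewrite /= EFinM.
Qed.

Lemma ip_sqn f : sqint f -> (ip f f)%:E = sqn f.
Proof.
move=> Lf; have := integrable_fin_num measurableT (sqint_mul Lf Lf).
rewrite /ip /Rintegral /sqn => h.
by rewrite fineK//; apply: eq_integral => x _; rewrite expr2.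
Qed.

Lemma ip_ge0 f : sqint f -> (0 <= ip f f)%R.
Proof. by move=> Lf; rewrite -lee_fin ip_sqn// sqn_ge0. Qed.

Lemma sqn_ae f g : measurable_fun setT f -> measurable_fun setT g ->
  f = g %[ae m] -> sqn f = sqn g.
Proof.
move=> mf mg fg; apply: ge0_ae_eq_integral => //; try exact: measurable_sqr;
  try (by move=> x _; rewrite lee_fin sqr_ge0).
by apply: filterS fg => x /= + _ => ->.
Qed.

Lemma sqn_fatou (F : nat -> T -> R) f (c : \bar R) :
  (forall k, measurable_fun setT (F k)) -> (forall k, sqn (F k) <= c) ->
  (forall x, F k x @[k --> \oo] --> f x) -> sqn f <= c.
Proof.
move=> mF Fc Ff.
have := fatou m measurableT (fun k => measurable_sqr (mF k))
  (fun k x _ => (_ : 0 <= (F k x ^+ 2)%:E)).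
move=> /(_ (fun k x => _)) h.
apply: le_trans (_ : _ <= limn_einf (fun k => sqn (F k))) _; last first.
  rewrite limn_einf_lim; apply: lime_le; first exact: is_cvg_einfs.
  apply: nearW => k; apply: le_trans (Fc k); apply: ereal_inf_lbound.
  by exists k => //=.
apply: le_trans (h _); last by move=> k x; rewrite lee_fin sqr_ge0.
rewrite le_eqVlt; apply/orP; left; apply/eqP; apply: eq_integral => x _.
have cv : (F k x ^+ 2)%:E @[k --> \oo] --> (f x ^+ 2)%:E.
  apply/fine_cvgP; split; first exact: nearW.
  rewrite expr2; under eq_fun do rewrite /= expr2.
  exact: cvgM (Ff x) (Ff x).
by rewrite (cvg_limn_einf_sup cv).1.
Qed.

(* The weights 4^k make the telescoping series of a rapidly Cauchy sequence
   converge geometrically at every point where the weighted sum is finite. *)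
Lemma rapidly_cauchy_ae_cvg (F : nat -> T -> R) :
  (forall k, measurable_fun setT (F k)) ->
  (forall k, sqn (fun x => F k.+1 x - F k x)%R <= (16^-1 ^+ k)%:E) ->
  exists G : set T, [/\ measurable G, m (~` G) = 0 &
    forall x, G x -> cvgn (F ^~ x)].
Proof.
move=> mF F16.
pose D k x := (F k.+1 x - F k x)%R.
have mD k : measurable_fun setT (D k) by exact: measurable_funB.
pose t k x : \bar R := (4 ^+ k)%:E * (D k x ^+ 2)%:E.
have t0 k x : 0 <= t k x by rewrite mule_ge0// lee_fin ?sqr_ge0 ?exprn_ge0.
have mt k : measurable_fun setT (t k).
  by apply: measurable_funeM; exact: measurable_sqr.
pose S x := \sum_(0 <= k <oo) t k x.
have S0 x : 0 <= S x by exact: nneseries_ge0.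
have mS : measurable_fun setT S.
  apply: (emeasurable_fun_cvg (fun N x => \sum_(0 <= k < N) t k x)).
    by move=> N; exact: emeasurable_sum.
  by move=> x _; exact: is_cvg_nneseries.
have intS : \int[m]_x S x <= 2%:E.
  rewrite integral_nneseries//.
  apply: lime_le.
    by apply: is_cvg_nneseries => k _ _; exact: integral_ge0.
  apply: nearW => N; apply: (@le_trans _ _ (\sum_(0 <= k < N) (4^-1 ^+ k)%:E)).
    apply: lee_sum => k _; rewrite ge0_integralZl_EFin ?exprn_ge0//; last 2 first.
    - by move=> x _; rewrite lee_fin sqr_ge0.
    - exact: measurable_sqr.
    apply: (@le_trans _ _ ((4 ^+ k)%:E * (16^-1 ^+ k)%:E)).
      by apply: lee_wpmul2l; rewrite ?lee_fin ?exprn_ge0//; exact: F16.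
    rewrite -EFinM lee_fin -exprMn le_eqVlt; apply/orP; left; apply/eqP.
    by congr (_ ^+ k)%R; field.
  rewrite sumEFin lee_fin; apply: (@le_trans _ _ (4 / 3 * (1 - 4^-1 ^+ N))%R).
    elim: N => [|N IH]; first by rewrite big_nil expr0 subrr mulr0.
    rewrite big_nat_recr//= exprS; apply: le_trans (lerD IH (lexx _)) _.
    by set y := (_ ^+ N)%R; lra.
  have : (0 <= (4^-1 : R) ^+ N)%R by rewrite exprn_ge0// invr_ge0.
  by set y := (_ ^+ N)%R; lra.
have iS : m.-integrable setT S.
  apply/integrableP; split => //.
  under eq_integral do rewrite gee0_abs//.
  by apply: le_lt_trans intS _; rewrite ltry.
pose G := [set x | S x \is a fin_num].
have mG : measurable G by have := emeasurable_fin_num measurableT mS; rewrite setTI.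
exists G; split => //.
  apply: measure_negligible; first exact: measurableC.
  have := integrable_ae measurableT iS.
  by apply: filterS => x /(_ Logic.I).
move=> x Gx; set M := fine (S x).
have SM : S x = M%:E by rewrite fineK.
have M0 : (0 <= M)%R by rewrite fine_ge0.
have dk k : (`|D k x| <= Num.sqrt M * 2^-1 ^+ k)%R.
  have h : (4 ^+ k * D k x ^+ 2 <= M)%R.
    rewrite -lee_fin -SM EFinM.
    apply: le_trans (nneseries_lim_ge (m := 0%N) k.+1 _); last by move=> ? _ _; exact: t0.
    rewrite big_nat_recr//= leeDr//; exact: sume_ge0.
  rewrite -(@ler_pXn2r _ 2)// ?nnegrE ?mulr_ge0 ?sqrtr_ge0 ?exprn_ge0 ?invr_ge0//.
  rewrite real_normK ?num_real// exprMn sqr_sqrtr// -exprM mulnC exprM.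
  have -> : ((2^-1 : R) ^+ 2 = 4^-1)%R by field.
  by rewrite exprVn ler_pdivlMr ?exprn_gt0// mulrC.
have cD : cvgn (series (fun k => D k x)).
  apply: normed_cvg.
  apply: (@series_le_cvg _ _ (geometric (Num.sqrt M) 2^-1)) => //.
  - by move=> k; exact: normr_ge0.
  - by move=> k; rewrite /= mulr_ge0 ?sqrtr_ge0 ?exprn_ge0 ?invr_ge0.
  - by apply: is_cvg_geometric_series; rewrite ger0_norm ?invr_ge0// invf_lt1 ?ltr1n.
rewrite (_ : (fun k => F k x) = (fun k => F 0%N x + series (fun k => D k x) k)%R).
  by apply: is_cvgD => //; exact: is_cvg_cst.
apply/funext => k; rewrite (eq_sum_telescope (F ^~ x)).
by [].
Qed.

End square_integrable.

Section almost_everywhere_product.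
Context d1 d2 (T1 : measurableType d1) (T2 : measurableType d2) (R : realType)
  (m1 : {sigma_finite_measure set T1 -> \bar R})
  (m2 : {sigma_finite_measure set T2 -> \bar R}).
Local Open Scope ereal_scope.

Lemma ae_product1 (P : T1 -> Prop) : {ae m1, forall x, P x} ->
  {ae m1 \x m2, forall z, P z.1}.
Proof.
move=> [A [mA A0 PA]]; exists (A `*` setT); split.
- exact: measurableX.
- transitivity (0 * m2 setT); last by rewrite mul0e.
  by rewrite -A0; exact: product_measure1E.
- by move=> z /= Pz; split => //; exact: PA.
Qed.

Lemma ae_product2 (P : T2 -> Prop) : {ae m2, forall x, P x} ->
  {ae m1 \x m2, forall z, P z.2}.
Proof.
move=> [A [mA A0 PA]]; exists (setT `*` A); split.
- exact: measurableX.
- transitivity (m1 setT * 0); last by rewrite mule0.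
  by rewrite -A0; exact: product_measure1E.
- by move=> z /= Pz; split => //; exact: PA.
Qed.

End almost_everywhere_product.

(** * Kernel energies as L^2 norms on the product space *)

Section nonlocal_gradient.
Context {R : realType} {n : nat}.
Local Notation mu := (lebesgue_rV n).
Local Notation rV2 := ('rV[R]_n * 'rV[R]_n)%type.
Implicit Types (u v : 'rV[R]_n -> R) (K : 'rV[R]_n -> R).
Local Open Scope ereal_scope.

(** With the square root of the kernel built in, a kernel energy is a squared L^2 norm on the
    product space and its bilinear form an L^2 inner product, so linearity, integrability of
    products and Fatou are inherited from L^2. *)
Definition nlgrad K u (z : 'rV[R]_n * 'rV[R]_n) : R :=
  ((u z.1 - u z.2) * Num.sqrt (K (z.1 - z.2)))%R.

Lemma nlgradD K (c : R) u v :
  nlgrad K (c *: u + v)%R = (fun z => c * nlgrad K u z + nlgrad K v z)%R.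
Proof.
apply/funext => z; rewrite /nlgrad !fctE.
by rewrite /GRing.scale/=; ring.
Qed.

Lemma measurable_kernel_diff K : measurable_fun setT K ->
  measurable_fun setT (fun z : rV2 => K (z.1 - z.2)%R).
Proof.
move=> mK; apply: measurableT_comp => //.
by apply: measurable_rVB; [exact: measurable_fst|exact: measurable_snd].
Qed.

Lemma measurable_fun_sqrt d (T : measurableType d) (f : T -> R) :
  measurable_fun setT f -> (forall x, (0 <= f x)%R) ->
  measurable_fun setT (fun x => Num.sqrt (f x)).
Proof.
move=> mf f0; rewrite (_ : (fun _ => _) = (@powR R)^~ (2^-1)%R \o f); last first.
  by apply/funext => x /=; rewrite powR12_sqrt.
by apply: measurableT_comp => //; exact: measurable_powR.
Qed.

Lemma measurable_nlgrad K u : measurable_fun setT K -> (forall z, (0 <= K z)%R) ->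
  measurable_fun setT u -> measurable_fun setT (nlgrad K u).
Proof.
move=> mK K0 mu_; apply: measurable_funM; first exact: measurable_diff2.
apply: measurable_fun_sqrt => //; exact: measurable_kernel_diff.
Qed.

Lemma kenergy_sqn K u : (forall z, (0 <= K z)%R) ->
  kenergy K u = sqn (mu \x mu) (nlgrad K u).
Proof.
move=> K0; apply: eq_integral => z _; rewrite /nlgrad exprMn sqr_sqrtr//.
Qed.

Lemma sqint_nlgrad K u : measurable_fun setT K -> (forall z, (0 <= K z)%R) ->
  measurable_fun setT u -> kenergy K u < +oo -> sqint (mu \x mu) (nlgrad K u).
Proof.
move=> mK K0 mu_ Ku; split; first exact: measurable_nlgrad.
by rewrite -kenergy_sqn.
Qed.

Lemma nlgrad_ae K u v : u = v %[ae mu] -> nlgrad K u = nlgrad K v %[ae mu \x mu].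
Proof.
move=> uv.
have h1 := ae_product1 mu uv; have h2 := ae_product2 mu uv.
by apply: filterS2 h1 h2 => z /= h1 h2 _; rewrite /nlgrad h1 ?h2.
Qed.

Lemma kenergy_ae K u v : measurable_fun setT K -> (forall z, (0 <= K z)%R) ->
  measurable_fun setT u -> measurable_fun setT v ->
  u = v %[ae mu] -> kenergy K u = kenergy K v.
Proof.
move=> mK K0 mu_ mv uv; rewrite !kenergy_sqn//; apply: sqn_ae.
- exact: measurable_nlgrad.
- exact: measurable_nlgrad.
- exact: nlgrad_ae.
Qed.

End nonlocal_gradient.

(** * The space H^s and its completeness *)

Section sobolev.
Context {R : realType} {n : nat} (s : R).
Local Notation mu := (lebesgue_rV n).
Implicit Types (u v : 'rV[R]_n -> R).

Definition gkern (z : 'rV[R]_n) : R := (enorm z `^ (n%:R + 2 * s))^-1.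

Lemma gkern_ge0 z : 0 <= gkern z. Proof. by rewrite invr_ge0 powR_ge0. Qed.

Lemma measurable_gkern : measurable_fun setT gkern.
Proof.
apply: measurable_fun_ge0_inv => [|x]; last exact: powR_ge0.
by apply: (measurableT_comp (measurable_powR _)); exact: measurable_enorm.
Qed.

Lemma HsP u : Hs s u <-> sqint mu u /\ sqint (mu \x mu)%E (nlgrad gkern u).
Proof.
split=> [[/sqint_Lfun Lu gu]|[Lu gu]].
  split => //; apply: sqint_nlgrad => //; first exact: measurable_gkern.
    exact: gkern_ge0.
  by case: Lu.
split; first exact/sqint_Lfun.
rewrite [gagliardo _ _](_ : _ = kenergy gkern u)// kenergy_sqn; last exact: gkern_ge0.
by case: gu.
Qed.

Lemma Hs_measurable u : Hs s u -> measurable_fun setT u.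
Proof. by move=> /HsP[[]]. Qed.

Definition Hs_ip u v : R := ip mu u v + ip (mu \x mu)%E (nlgrad gkern u) (nlgrad gkern v).

Lemma Hs_subspace : lin_subspace (@Hs R n s : set ('rV[R]_n -> R)).
Proof.
rewrite /lin_subspace; split.
  apply/HsP; split; (split; [|rewrite /sqn integral0_eq// => x _]).
  - exact: measurable_cst.
  - by rewrite expr0n.
  - by rewrite (_ : nlgrad _ _ = cst 0)//; apply/funext => z; rewrite /nlgrad subrr mul0r.
  - by rewrite /nlgrad subrr mul0r expr0n.
move=> c u v /HsP[u1 u2] /HsP[v1 v2]; apply/HsP; split.
  exact: (sqintD c u1 v1).
rewrite nlgradD; exact: sqintD.
Qed.

Lemma Hs_semi_inner_product : semi_inner_product (@Hs R n s : set ('rV[R]_n -> R)) Hs_ip.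
Proof.
rewrite /semi_inner_product; split.
- by move=> u v _ _; rewrite /Hs_ip ipC (ipC (mu \x mu)%E).
- move=> w /HsP[w1 w2] c u v /HsP[u1 u2] /HsP[v1 v2].
  by rewrite /Hs_ip nlgradD !ip_linear//; ring.
- by move=> u /HsP[u1 u2]; rewrite addr_ge0// ip_ge0.
Qed.

Lemma Hs_normE u : Hs s u -> Hs_norm s u = Num.sqrt (Hs_ip u u).
Proof.
move=> /HsP[u1 u2]; congr (Num.sqrt (_ + _)).
rewrite [gagliardo _ _](_ : _ = kenergy gkern u)// kenergy_sqn; last exact: gkern_ge0.
by rewrite -ip_sqn.
Qed.

Lemma Hs_ae u v : Hs s u -> measurable_fun setT v -> u = v %[ae mu] -> Hs s v.
Proof.
move=> /HsP[[mu_ u1] [mgu u2]] mv uv; apply/HsP; split; split => //.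
- by rewrite -(sqn_ae mu_ mv uv).
- by apply: measurable_nlgrad => //; [exact: measurable_gkern|exact: gkern_ge0].
- rewrite -kenergy_sqn; last exact: gkern_ge0.
  rewrite -(kenergy_ae measurable_gkern gkern_ge0 mu_ mv uv) kenergy_sqn//.
  exact: gkern_ge0.
Qed.

Lemma Hs_ip_ae0 u : measurable_fun setT u -> u = cst 0 %[ae mu] -> Hs s u /\ Hs_ip u u = 0.
Proof.
move=> mu_ u0.
have Hs0 : Hs s (cst 0 : 'rV[R]_n -> R) by exact: Hs_subspace.1.
have u0' : cst 0 = u %[ae mu] by apply: filterS u0 => x /= h _; rewrite h.
have Hu : Hs s u by exact: Hs_ae Hs0 mu_ u0'.
split => //; move/HsP : (Hu) => [u1 u2].
apply/EFin_inj; rewrite /Hs_ip EFinD !ip_sqn//.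
rewrite (sqn_ae mu_ (measurable_cst _) u0) -kenergy_sqn; last exact: gkern_ge0.
rewrite (kenergy_ae measurable_gkern gkern_ge0 mu_ (measurable_cst _) u0).
rewrite /sqn integral0_eq; last by move=> x _; rewrite expr0n.
by rewrite /kenergy integral0_eq ?adde0// => z _; rewrite subrr expr0n mul0r.
Qed.

(** A rapidly Cauchy subsequence converges almost everywhere. Fatou, applied to the L^2 part and to
    the nonlocal gradient of U i minus the subsequence, then bounds the distance from U i to the
    limit, for the whole sequence at once. *)
Lemma Hs_complete : sip_complete (@Hs R n s : set ('rV[R]_n -> R)) Hs_ip.
Proof.
move=> U HU cU.
have mU k := Hs_measurable (HU k).
have HB i j : Hs s (U i - U j) by exact: subspaceB Hs_subspace (HU i) (HU j).
have ex_sg k : exists M, forall i j, (M <= i)%N -> (M <= j)%N ->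
    Hs_ip (U i - U j) (U i - U j) < 16^-1 ^+ k.
  by apply: cU; rewrite exprn_gt0// invr_gt0.
have [sg hsg] := choice ex_sg.
(* Both tau k and tau k.+1 are at least sg k, so consecutive terms are closer than 16^-k; and tau k
   >= k, so the subsequence passes any given index. *)
pose tau k := (\sum_(i < k.+1) sg i + k)%N.
have tau1 k : (sg k <= tau k)%N by rewrite /tau big_ord_recr/= -addnA addnCA leq_addr.
have tau2 k : (sg k <= tau k.+1)%N.
  by rewrite /tau big_ord_recr big_ord_recr/= -!addnA addnCA leq_addr.
have tau3 k : (k <= tau k)%N by rewrite /tau leq_addl.
pose F k := U (tau k).
have mF k : measurable_fun setT (F k) by exact: mU.
have ip_split u : Hs s u -> (Hs_ip u u)%:E =
    (sqn mu u + sqn (mu \x mu) (nlgrad gkern u))%E.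
  by move=> /HsP[u1 u2]; rewrite /Hs_ip EFinD !ip_sqn.
have sqn_le u (c : R) : Hs s u -> Hs_ip u u <= c ->
    (sqn mu u <= c%:E)%E /\ (sqn (mu \x mu) (nlgrad gkern u) <= c%:E)%E.
  move=> Hu; rewrite -lee_fin ip_split// => h; split; apply: le_trans h.
    by rewrite leeDl// sqn_ge0.
  by rewrite leeDr// sqn_ge0.
have [G [mG G0 cG]] := @rapidly_cauchy_ae_cvg _ _ _ mu F mF (fun k =>
  (sqn_le _ _ (HB _ _) (ltW (hsg k _ _ (tau2 k) (tau1 k)))).1).
(* Setting the functions to 0 on the null set makes them converge at every point; the limit is then
   Borel, and the nonlocal gradients converge at every point of the product. *)
pose V k := F k \_ G.
have mV k : measurable_fun setT (V k).
  by apply/(measurable_restrictT _ _).1 => //; exact: measurable_funTS.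
pose g x := limn (V ^~ x).
have Vg x : V k x @[k --> \oo] --> g x.
  rewrite /g /V; have [Gx|Gx] := pselect (G x).
    under eq_fun do rewrite patchE mem_set//.
    exact: cG.
  under eq_fun do rewrite patchE memNset//.
  exact: is_cvg_cst.
have mg : measurable_fun setT g.
  by apply: (@measurable_fun_cvg _ _ _ _ V).
have VF k : F k = V k %[ae mu].
  exists (~` G); split => //; first exact: measurableC.
  move=> x /=; apply: contra_not => Gx _; rewrite /V patchE mem_set//.
(* The bound is c + c because each of the two parts of the norm is separately at most c. *)
have key i (c : R) (M : nat) : (forall j, (M <= j)%N -> Hs_ip (U i - U j) (U i - U j) <= c) ->
    Hs s (U i - g) /\ Hs_ip (U i - g) (U i - g) <= c + c.
  move=> hM.
  have sM k : (M <= tau (k + M))%N by apply: leq_trans (tau3 _); rewrite leq_addl.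
  have mUV k : measurable_fun setT (U i - V (k + M)%N).
    exact: measurable_funB.
  have mUF k : measurable_fun setT (U i - F (k + M)%N).
    exact: measurable_funB.
  have aeUV k : U i - F (k + M)%N = U i - V (k + M)%N %[ae mu].
    by apply: filterS (VF (k + M)%N) => x h _ ; rewrite !fctE h.
  have cv x : (U i - V (k + M)%N) x @[k --> \oo] --> (U i - g) x.
    rewrite !fctE; apply: cvgB; first exact: cvg_cst.
    by have := Vg x; rewrite -(cvg_shiftn M).
  have s1 : (sqn mu (U i - g)%R <= c%:E)%E.
    apply: (@sqn_fatou _ _ _ mu (fun k => U i - V (k + M)%N)) => //.
    move=> k; rewrite -(sqn_ae (mUF k) (mUV k) (aeUV k)).
    exact: (sqn_le _ _ (HB _ _) (hM _ (sM k))).1.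
  have s2 : (sqn (mu \x mu) (nlgrad gkern (U i - g)%R) <= c%:E)%E.
    apply: (@sqn_fatou _ _ _ (mu \x mu)%E (fun k => nlgrad gkern (U i - V (k + M)%N))).
    - by move=> k; apply: measurable_nlgrad => //; [exact: measurable_gkern|exact: gkern_ge0].
    - move=> k; rewrite -kenergy_sqn; last exact: gkern_ge0.
      rewrite -(kenergy_ae measurable_gkern gkern_ge0 (mUF k) (mUV k) (aeUV k)).
      rewrite kenergy_sqn; last exact: gkern_ge0.
      exact: (sqn_le _ _ (HB _ _) (hM _ (sM k))).2.
    - by move=> z; apply: cvgMl; apply: cvgB; exact: cv.
  have mUg : measurable_fun setT (U i - g) by exact: measurable_funB.
  have Hug : Hs s (U i - g).
    apply/HsP; split; split => //.
    - by apply: le_lt_trans s1 _; rewrite ltry.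
    - by apply: measurable_nlgrad => //; [exact: measurable_gkern|exact: gkern_ge0].
    - by apply: le_lt_trans s2 _; rewrite ltry.
  by split => //; rewrite -lee_fin ip_split// EFinD leeD.
have Hg : Hs s g.
  have [M hM] := cU 1 ltr01.
  have [|Hug _] := key M 1 M; first by move=> j Mj; exact/ltW/hM.
  have := subspaceB Hs_subspace (HU M) Hug.
  by rewrite opprB addrCA subrr addr0.
exists g => // e e0.
have e4 : 0 < e / 4 by rewrite divr_gt0.
have [M hM] := cU _ e4; exists M => i Mi.
have [|_ h] := key i (e / 4) M; first by move=> j Mj; exact/ltW/hM.
by apply: le_lt_trans h _; lra.
Qed.

End sobolev.

Section square_integrable_inner_product.
Context d (T : measurableType d) (R : realType) (m : {measure set T -> \bar R}).

Lemma sqint_subspace : lin_subspace (@sqint d T R m : set (T -> R)).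
Proof.
rewrite /lin_subspace; split; last by move=> c u v; exact: sqintD.
split; first exact: measurable_cst.
by rewrite /sqn integral0_eq// => x _; rewrite expr0n.
Qed.

Lemma sqint_semi_inner_product :
  semi_inner_product (@sqint d T R m : set (T -> R)) (ip m).
Proof.
rewrite /semi_inner_product; split.
- by move=> u v _ _; exact: ipC.
- by move=> w Lw c u v Lu Lv; exact: ip_linear.
- by move=> u Lu; exact: ip_ge0.
Qed.

Lemma ip_CauchySchwarz f g : sqint m f -> sqint m g ->
  ip m f g ^+ 2 <= ip m f f * ip m g g.
Proof.
exact: (sip_CauchySchwarz sqint_subspace sqint_semi_inner_product).
Qed.

Lemma sqintZ (c : R) f : sqint m f -> sqint m (fun x => c * f x).
Proof.
move=> [mf ff]; split; first exact: measurable_funM.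
by rewrite sqnZ// lte_mul_pinfty// ?lee_fin ?sqr_ge0.
Qed.

Lemma ipZl (c : R) f h : sqint m f -> sqint m h ->
  ip m (fun x => c * f x) h = c * ip m f h.
Proof.
move=> Lf Lh; rewrite /ip -RintegralZl//; last exact: sqint_mul.
by apply: eq_Rintegral => x _; rewrite mulrA.
Qed.

Lemma sqint_indic A : measurable A -> (m A < +oo)%E -> sqint m (\1_A).
Proof.
move=> mA Afin; split; first exact: measurable_indic.
rewrite /sqn (eq_integral (fun x => (\1_A x)%:E)).
  by rewrite integral_indic// setIT.
by move=> x _; rewrite indicE; case: (x \in A); rewrite ?expr1n ?expr0n.
Qed.

Lemma ip_indic A : measurable A -> (m A < +oo)%E -> (ip m \1_A \1_A)%:E = m A.
Proof.
move=> mA Afin; rewrite ip_sqn; last exact: sqint_indic.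
rewrite /sqn (eq_integral (fun x => (\1_A x)%:E)).
  by rewrite integral_indic// setIT.
by move=> x _; rewrite indicE; case: (x \in A); rewrite ?expr1n ?expr0n.
Qed.

End square_integrable_inner_product.

(** * The fractional Poincare inequality *)

Section fractional_poincare.
Context {R : realType} {n : nat} (s : R) (hs : 0 < s < 1).
Local Notation mu := (lebesgue_rV n).
Local Notation gkern := (@gkern R n s).
Implicit Types (u : 'rV[R]_n -> R) (A : set 'rV[R]_n).
Let p : R := n%:R + 2 * s.

Let p0 : 0 < p.
Proof. by rewrite /p ltr_wpDl// mulr_gt0//; case/andP: hs. Qed.

(* Cauchy-Schwarz applied to k u(x) - \int_A u = \int_A (u(x) - u(y)) dy,
   where k is the measure of A. *)
Lemma sqr_le_oscillation A (k : R) u x : measurable A -> mu A = k%:E -> 0 < k ->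
  sqint mu u ->
  ((u x ^+ 2)%:E <= (2 / k)%:E * \int[mu]_y (\1_A y * (u x - u y) ^+ 2)%:E
    + (2 / k ^+ 2 * ip mu \1_A u ^+ 2)%:E)%E.
Proof.
move=> mA Ak k0 Lu.
have Afin : (mu A < +oo)%E by rewrite Ak ltry.
have L1 := sqint_indic mA Afin.
pose g y : R := \1_A y * (u x - u y).
have L1u : sqint mu (fun y => \1_A y * u y).
  split; first by apply: measurable_funM; [exact: measurable_indic|case: Lu].
  apply: le_lt_trans (_ : _ <= sqn mu u)%E _; last by case: Lu.
  apply: ge0_le_integral => //.
  - by move=> y _; rewrite lee_fin sqr_ge0.
  - by apply: measurable_sqr; apply: measurable_funM; [exact: measurable_indic|case: Lu].
  - by apply: measurable_sqr; case: Lu.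
  - move=> y _; rewrite lee_fin exprMn indicE; case: (y \in A); rewrite ?expr1n ?mul1r//.
    by rewrite expr0n mul0r sqr_ge0.
have gE : g = (fun y => (-1) * (\1_A y * u y) + u x * \1_A y).
  by apply/funext => y; rewrite /g; ring.
have L1x := sqintZ (u x) L1.
have Lg : sqint mu g by rewrite gE; exact: sqintD.
have ipg : ip mu \1_A g = k * u x - ip mu \1_A u.
  rewrite gE ipC ip_linear// ipZl//.
  have -> : ip mu (fun y => \1_A y * u y) \1_A = ip mu \1_A u.
    apply: eq_Rintegral => y _; rewrite indicE; case: (y \in A); rewrite ?mul1r ?mulr1//.
    by rewrite !mul0r.
  have -> : ip mu \1_A \1_A = k by apply/EFin_inj; rewrite ip_indic.
  by ring.
have ggE : (\int[mu]_y (\1_A y * (u x - u y) ^+ 2)%:E)%E = (ip mu g g)%:E.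
  rewrite ip_sqn//; apply: eq_integral => y _; rewrite /g exprMn indicE.
  by case: (y \in A); rewrite ?expr1n ?expr0n.
have := ip_CauchySchwarz L1 Lg.
have -> : ip mu \1_A \1_A = k by apply/EFin_inj; rewrite ip_indic.
rewrite ipg ggE -EFinM -EFinD lee_fin.
move: (ip mu g g) (ip mu \1_A u) (u x) => G P v h.
have h2 : (k * v) ^+ 2 <= 2 * (k * G) + 2 * P ^+ 2.
  apply: (@le_trans _ _ (2 * (k * v - P) ^+ 2 + 2 * P ^+ 2)); last by lra.
  by have := sqr_ge0 (k * v - 2 * P); nra.
have -> : 2 / k * G + 2 / k ^+ 2 * P ^+ 2 = (2 * (k * G) + 2 * P ^+ 2) / k ^+ 2.
  by field; rewrite gt_eqF.
by rewrite ler_pdivlMr ?exprn_gt0// mulrC -exprMn.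
Qed.

Lemma measurable_indicM A (f : 'rV[R]_n -> R) : measurable A -> measurable_fun setT f ->
  measurable_fun setT (fun x => \1_A x * f x).
Proof. by move=> mA mf; apply: measurable_funM => //; exact: measurable_indic. Qed.

(** Integrate [sqr_le_oscillation] over A. On A x A off the diagonal |x - y| <= delta, so 1 <=
    delta^p [gkern], which inserts the kernel into the mean oscillation; on the diagonal the
    oscillation is 0. *)
Lemma poincare_cell A (k delta : R) u : measurable A -> mu A = k%:E -> 0 < k ->
  0 <= delta -> (forall x y, A x -> A y -> enorm (x - y) <= delta) -> sqint mu u ->
  (\int[mu]_x (\1_A x * u x ^+ 2)%:E <=
    (2 * delta `^ p / k)%:E *
      \int[mu \x mu]_z (\1_A z.1 * \1_A z.2 * ((u z.1 - u z.2) ^+ 2 * gkern (z.1 - z.2)))%:E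
    + (2 / k * ip mu \1_A u ^+ 2)%:E)%E.
Proof.
move=> mA Ak k0 d0 dA Lu; have mu_ : measurable_fun setT u by case: Lu.
have i0 (x : 'rV[R]_n) : 0 <= \1_A x :> R by rewrite indicE.
have m1 : measurable_fun setT (\1_A : 'rV[R]_n -> R) by exact: measurable_indic.
have mfst : measurable_fun setT (fun z : 'rV[R]_n * 'rV[R]_n => \1_A z.1 : R).
  by apply: (measurableT_comp m1); exact: measurable_fst.
have msnd : measurable_fun setT (fun z : 'rV[R]_n * 'rV[R]_n => \1_A z.2 : R).
  by apply: (measurableT_comp m1); exact: measurable_snd.
have md2 : measurable_fun setT (fun z : 'rV[R]_n * 'rV[R]_n => (u z.1 - u z.2) ^+ 2).
  by apply: measurable_funX; exact: measurable_diff2.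
pose H z : R := \1_A z.1 * (\1_A z.2 * (u z.1 - u z.2) ^+ 2).
have H0 z : 0 <= H z by rewrite mulr_ge0// mulr_ge0// sqr_ge0.
have mH : measurable_fun setT H.
  by apply: measurable_funM => //; exact: measurable_funM.
have Hle : (\int[mu \x mu]_z (H z)%:E <= (delta `^ p)%:E *
    \int[mu \x mu]_z (\1_A z.1 * \1_A z.2 * ((u z.1 - u z.2) ^+ 2 * gkern (z.1 - z.2)))%:E)%E.
  have mI : measurable_fun setT (fun z : 'rV[R]_n * 'rV[R]_n =>
      (\1_A z.1 * \1_A z.2 * ((u z.1 - u z.2) ^+ 2 * gkern (z.1 - z.2)))%:E).
    apply/measurable_EFinP; apply: measurable_funM; first exact: measurable_funM.
    by apply: measurable_funM => //; apply: measurable_kernel_diff; exact: measurable_gkern.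
  have I0 (z : 'rV[R]_n * 'rV[R]_n) :
      0 <= \1_A z.1 * \1_A z.2 * ((u z.1 - u z.2) ^+ 2 * gkern (z.1 - z.2)).
    by apply: mulr_ge0; apply: mulr_ge0; rewrite ?i0 ?sqr_ge0 ?gkern_ge0.
  rewrite -ge0_integralZl_EFin ?powR_ge0//; last by move=> z _; rewrite lee_fin.
  apply: ge0_le_integral => //.
  - by move=> z _; rewrite lee_fin.
  - exact/measurable_EFinP.
  - exact: measurable_funeM.
  move=> [x y] _; rewrite -EFinM lee_fin /H /=.
  have [Ax|Ax] := pselect (A x); last by rewrite indicE memNset// !mul0r mulr0.
  have [Ay|Ay] := pselect (A y); last by rewrite [\1_A y]indicE memNset// !(mul0r, mulr0).
  rewrite !indicE !mem_set// !mul1r.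
  have [->|xy] := eqVneq x y; first by rewrite !subrr expr0n !(mul0r, mulr0).
  rewrite mulrCA ler_peMr ?sqr_ge0// /gkern -/p.
  have e0 : 0 < enorm (x - y) by rewrite enorm_gt0 subr_eq0.
  rewrite ler_pdivlMr ?powR_gt0// mul1r ge0_ler_powR ?nnegrE ?enorm_ge0//; last exact: dA.
  exact: ltW.
have c0 : 0 <= 2 / k by rewrite divr_ge0// ltW.
apply: (@le_trans _ _ (\int[mu]_x ((2 / k)%:E * (\int[mu]_y (H (x, y))%:E) +
   (2 / k ^+ 2 * ip mu \1_A u ^+ 2)%:E * (\1_A x)%:E)))%E.
  apply: ge0_le_integral => //.
  - by move=> x _; rewrite lee_fin mulr_ge0 ?sqr_ge0.
  - by apply/measurable_EFinP; apply: measurable_indicM => //; exact: measurable_funX.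
  - apply: emeasurable_funD; apply: measurable_funeM; last exact/measurable_EFinP.
    apply: (@measurable_fun_fubini_tonelli_F _ _ _ _ _ mu (fun z => (H z)%:E)).
      exact/measurable_EFinP.
    by move=> z; rewrite lee_fin.
  move=> x _; have [Ax|Ax] := pselect (A x); last first.
    rewrite indicE memNset// mul0r adde_ge0//.
      by rewrite mule_ge0 ?lee_fin//; apply: integral_ge0 => y _; rewrite lee_fin.
    by rewrite mule0.
  apply: le_trans (_ : _ <= (u x ^+ 2)%:E)%E _; first by rewrite indicE mem_set// mul1r.
  apply: le_trans (sqr_le_oscillation x mA Ak k0 Lu) _.
  rewrite /H /= indicE mem_set// mule1; apply: leeD => //.
  by under [in leRHS]eq_integral do rewrite mul1r.
rewrite ge0_integralD//; last 4 first.
- move=> x _; rewrite mule_ge0 ?lee_fin//.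
  by apply: integral_ge0 => y _; rewrite lee_fin.
- apply: measurable_funeM.
  apply: (@measurable_fun_fubini_tonelli_F _ _ _ _ _ mu (fun z => (H z)%:E)).
    exact/measurable_EFinP.
  by move=> z; rewrite lee_fin.
- by move=> x _; rewrite mule_ge0// lee_fin mulr_ge0 ?sqr_ge0// divr_ge0// sqr_ge0.
- by apply: measurable_funeM; exact/measurable_EFinP.
apply: leeD; last first.
  rewrite ge0_integralZl_EFin//; last 2 first.
  - exact/measurable_EFinP.
  - by rewrite mulr_ge0 ?sqr_ge0// divr_ge0// sqr_ge0.
  have -> : (\int[mu]_x (\1_A x)%:E)%E = k%:E by rewrite integral_indic// setIT.
  rewrite -EFinM lee_fin le_eqVlt; apply/orP; left; apply/eqP.
  by field; rewrite gt_eqF.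
rewrite ge0_integralZl_EFin//; last 2 first.
- by move=> x _; apply: integral_ge0 => y _; rewrite lee_fin.
- apply: (@measurable_fun_fubini_tonelli_F _ _ _ _ _ mu (fun z => (H z)%:E)).
    exact/measurable_EFinP.
  by move=> z; rewrite lee_fin.
rewrite -(fubini_tonelli1 (fun z => (H z)%:E))//; last exact/measurable_EFinP.
rewrite (_ : 2 * delta `^ p / k = 2 / k * delta `^ p); last by ring.
rewrite [(2 / k * _)%:E]EFinM -muleA; apply: lee_wpmul2l; first by rewrite lee_fin.
exact: Hle.
Qed.

Lemma bounded_enorm (A : set 'rV[R]_n) : bounded_set A ->
  exists2 N : R, 0 < N & forall x, A x -> enorm x <= N.
Proof.
move=> [M [_ hM]]; have := hM (`|M| + 1) _ => /(_ _) h.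
have {h} : forall x, A x -> `|x| <= `|M| + 1.
  by apply: h; apply: le_lt_trans (ler_norm M) _; rewrite ltrDl.
move=> h; have M1 : 0 <= `|M| + 1 by rewrite addr_ge0.
exists (n%:R * (`|M| + 1) + 1); first by rewrite ltr_wpDl// mulr_ge0.
move=> x Ax; apply: (@le_trans _ _ (n%:R * (`|M| + 1))); last by rewrite lerDl.
apply: enorm_le_coord => // i; apply: le_trans (h x Ax).
rewrite [leRHS]mx_normrE; exact: (le_bigmax _ (fun ij => `|x ij.1 ij.2|) (ord0, i)).
Qed.

Section cells.
Variables (N eps : R) (m : nat).
Context (eps0 : 0 < eps).

(** The cube of side [eps] with multi-index [f] in the grid anchored at the corner (-N, ..., -N). It
    is half-open, so that distinct cells are disjoint. *)
Definition cell (f : {ffun 'I_n -> 'I_m}) : set 'rV[R]_n :=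
  [set x | forall i, (f i)%:R * eps <= x ord0 i + N < (f i).+1%:R * eps].

Let cellE f : cell f = [set x | [set y : 'rV[R]_n | forall i, `[0, 1[%classic (y ord0 i)]
  (eps^-1 *: x + \row_i (N / eps - (f i)%:R))].
Proof.
have h (x : 'rV[R]_n) i (k : nat) : (k%:R * eps <= x ord0 i + N < k.+1%:R * eps) =
    (0 <= eps^-1 * x ord0 i + (N / eps - k%:R) < 1).
  have -> : eps^-1 * x ord0 i + (N / eps - k%:R) = (x ord0 i + N) / eps - k%:R by ring.
  by rewrite subr_ge0 ler_pdivlMr// ltrBlDr ltr_pdivrMr// -natr1 [1 + _]addrC.
apply/seteqP; split=> x /= hx i; have := hx i; rewrite /= in_itv /= ?mxE.
  by rewrite h.
by rewrite h.
Qed.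

Lemma measurable_cell f : measurable (cell f).
Proof.
rewrite cellE -[X in measurable X]setTI; apply: measurable_rV_affine => //.
exact: (measurable_rV_box (measurable_itv _)).
Qed.

Lemma lebesgue_cell f : mu (cell f) = (eps ^+ n)%:E.
Proof.
rewrite cellE lebesgue_rV_affine ?invr_gt0//; last first.
  exact: (measurable_rV_box (measurable_itv _)).
rewrite exprVn invrK (lebesgue_rV_box n (measurable_itv _)).
by rewrite lebesgue_measure_itv /= lte_fin ltr01 -EFinB subr0 -EFin_expe expr1n mule1.
Qed.

Lemma cell_diam f x y : cell f x -> cell f y -> enorm (x - y) <= n%:R * eps.
Proof.
move=> fx fy; apply: enorm_le_coord => [|i]; first exact: ltW.
have := fx i; have := fy i; rewrite -!natr1 !mxE ler_norml.
move: (x ord0 i) (y ord0 i) ((f i)%:R) => a b c /andP[? ?] /andP[? ?].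
by apply/andP; split; lra.
Qed.

Lemma cell_inj f g x : cell f x -> cell g x -> f = g.
Proof.
move=> fx gx; apply/ffunP => i; apply: val_inj => /=.
have := fx i; have := gx i => /andP[a1 a2] /andP[b1 b2].
have h1 := le_lt_trans a1 b2; have h2 := le_lt_trans b1 a2.
move: h1 h2; rewrite !ltr_pM2r// !ltr_nat !ltnS => h1 h2.
by apply/eqP; rewrite eqn_leq h1 h2.
Qed.

Lemma cell_cover (x : 'rV[R]_n) : (forall i, 0 <= x ord0 i + N < m%:R * eps) -> exists f, cell f x.
Proof.
move=> hx.
have ex i : exists k : 'I_m, (k%:R * eps <= x ord0 i + N < k.+1%:R * eps).
  have /andP[h0 h1] := hx i.
  have t0 : 0 <= (x ord0 i + N) / eps by rewrite divr_ge0// ltW.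
  have := truncn_itv t0; set k := Num.truncn _ => /andP[k1 k2].
  have km : (k < m)%N.
    rewrite -(ltr_nat R); apply: le_lt_trans k1 _.
    by rewrite ltr_pdivrMr.
  exists (Ordinal km) => /=.
  by rewrite -ler_pdivlMr// k1 -ltr_pdivrMr// k2.
have [f hf] := choice ex; exists [ffun i => f i] => i.
by rewrite ffunE.
Qed.

Lemma cell_partition (x : 'rV[R]_n) : \sum_(f : {ffun 'I_n -> 'I_m}) (\1_(cell f) x : R) <= 1.
Proof.
have [[f fx]|nex] := pselect (exists f, cell f x); last first.
  rewrite big1 ?ler01// => f _; rewrite indicE memNset// => fx.
  by apply: nex; exists f.
rewrite (bigD1 f)//= big1 ?addr0; first by rewrite indicE mem_set.
move=> g gf; rewrite indicE memNset// => gx.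
by move/eqP: gf; apply; exact: cell_inj gx fx.
Qed.

Lemma cell_partition2 (x y : 'rV[R]_n) :
  \sum_(f : {ffun 'I_n -> 'I_m}) (\1_(cell f) x * \1_(cell f) y : R) <= 1.
Proof.
apply: le_trans (cell_partition x); apply: ler_sum => f _.
by rewrite ler_piMr// indicE ?ler0n// lern1 leq_b1.
Qed.

End cells.

(** Sum the one-cell inequality over a grid of mesh eps covering [Omega]. The energy then carries
    the factor 2 (n eps)^p / eps^n = 2 n^p eps^(2s), with p = n + 2s, which tends to 0 with eps
    since s > 0. A finer grid only raises the number of averages and their weight M. *)
Lemma fractional_poincare (Omega : set 'rV[R]_n) (e : R) :
  bounded_set Omega -> 0 < e ->
  exists (I : finType) (Q : I -> set 'rV[R]_n) (M : R),
    [/\ 0 < M, forall i, measurable (Q i) /\ (mu (Q i) < +oo)%E &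
    forall u, sqint mu u -> {ae mu, forall x, ~ Omega x -> u x = 0} ->
      (sqn mu u <= e%:E * kenergy gkern u + (M * \sum_i (ip mu \1_(Q i) u) ^+ 2)%:E)%E].
Proof.
move=> /bounded_enorm[N N0 hN] e0.
have s0 : 0 < 2 * s by case/andP: hs => ? _; rewrite mulr_gt0.
pose c := 2 * n%:R `^ p : R.
have c0 : 0 <= c by rewrite mulr_ge0// powR_ge0.
have c1 : 0 < c + 1 by rewrite ltr_wpDl.
(* Chosen so that c eps^(2s) <= e; the denominator is c + 1 because c may be 0. *)
pose eps := (e / (c + 1)) `^ (2 * s)^-1.
have eps0 : 0 < eps by rewrite powR_gt0// divr_gt0.
have epsE : c * eps `^ (2 * s) <= e.
  rewrite /eps -powRrM mulVf ?gt_eqF// powRr1 ?divr_ge0 ?(ltW e0) ?(ltW c1)//.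
  by rewrite mulrCA ler_piMr ?(ltW e0)// ler_pdivrMr// mul1r lerDl.
(* With this number of cells along each axis the grid covers the cube [-N, N]^n, hence [Omega]. *)
pose m := (Num.truncn (2 * N / eps)).+1.
have mN : 2 * N < m%:R * eps.
  by rewrite -ltr_pdivrMr//; exact: truncnS_gt.
pose k := eps ^+ n; have k0 : 0 < k by rewrite exprn_gt0.
exists {ffun 'I_n -> 'I_m}, (@cell N eps m), (2 / k); split.
- by rewrite divr_gt0.
- by move=> f; split; [exact: measurable_cell|rewrite lebesgue_cell// ltry].
move=> u Lu u0; have mu_ : measurable_fun setT u by case: Lu.
have i0 (f : {ffun 'I_n -> 'I_m}) (x : 'rV[R]_n) : 0 <= \1_(cell N eps f) x :> R by rewrite indicE.
have mc (f : {ffun 'I_n -> 'I_m}) := measurable_cell N eps0 f.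
pose J (f : {ffun 'I_n -> 'I_m}) (z : 'rV[R]_n * 'rV[R]_n) : R :=
  \1_(cell N eps f) z.1 * \1_(cell N eps f) z.2 * ((u z.1 - u z.2) ^+ 2 * gkern (z.1 - z.2)).
have J0 f z : 0 <= J f z.
  by apply: mulr_ge0; apply: mulr_ge0; rewrite ?i0 ?sqr_ge0 ?gkern_ge0.
have mKd : measurable_fun setT (fun z : 'rV[R]_n * 'rV[R]_n => (u z.1 - u z.2) ^+ 2 * gkern (z.1
  - z.2)).
  apply: measurable_funM; first by apply: measurable_funX; exact: measurable_diff2.
  by apply: measurable_kernel_diff; exact: measurable_gkern.
have mJ f : measurable_fun setT (EFin \o J f).
  apply/measurable_EFinP; apply: measurable_funM => //.
  have m1 : measurable_fun setT (\1_(cell N eps f) : 'rV[R]_n -> R) by exact: measurable_indic.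
  apply: measurable_funM; apply: (measurableT_comp m1).
    exact: measurable_fst.
  exact: measurable_snd.
have mcu (f : {ffun 'I_n -> 'I_m}) : measurable_fun setT (fun x => (\1_(cell N eps f) x * u x ^+
  2)%:E).
  by apply/measurable_EFinP; apply: measurable_indicM => //; exact: measurable_funX.
have cu0 (f : {ffun 'I_n -> 'I_m}) (x : 'rV[R]_n) : (0 <= (\1_(cell N eps f) x * u x ^+ 2)%:E)%E.
  by rewrite lee_fin mulr_ge0 ?sqr_ge0.
apply: (@le_trans _ _ (\sum_f \int[mu]_x (\1_(cell N eps f) x * u x ^+ 2)%:E)%E).
  rewrite -ge0_integral_sum//.
  apply: ae_ge0_le_integral => //.
  - by move=> x _; rewrite lee_fin sqr_ge0.
  - exact: measurable_sqr.
  - by move=> x _; exact: sume_ge0.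
  - exact: emeasurable_sum.
  apply: filterS u0 => x u0 _; have [Ox|/u0 ->] := pselect (Omega x); last first.
    by rewrite expr0n; exact: sume_ge0.
  have [|f fx] := @cell_cover N eps m eps0 x.
    move=> i; have := le_trans (coord_le_enorm x i) (hN x Ox).
    by rewrite ler_norml => /andP[? ?]; apply/andP; split; lra.
  by rewrite (bigD1 f)//= indicE mem_set// mul1r leeDl//; exact: sume_ge0.
apply: (@le_trans _ _ (\sum_f ((c * eps `^ (2 * s))%:E * (\int[mu \x mu]_z (J f z)%:E)
    + (2 / k * ip mu \1_(cell N eps f) u ^+ 2)%:E))%E).
  apply: lee_sum => f _.
  have ne0 : 0 <= n%:R * eps by rewrite mulr_ge0// ltW.
  apply: le_trans (poincare_cell (mc f) (lebesgue_cell N eps0 f) k0 ne0 _ Lu) _.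
    by move=> x y; exact: cell_diam.
  rewrite le_eqVlt; apply/orP; left; apply/eqP; congr (_%:E * _ + _)%E.
  have epE : eps `^ p = k * eps `^ (2 * s).
    rewrite /p powRD ?powR_mulrn ?ltW//.
    by rewrite gt_eqF// implybT.
  rewrite powRM ?(ltW eps0)// epE -/k /c; field.
  by rewrite gt_eqF.
rewrite big_split/= sumEFin -mulr_sumr; apply: leeD => //.
rewrite -ge0_sume_distrr; last by move=> f _; apply: integral_ge0 => z _; rewrite lee_fin.
apply: lee_pmul => //.
- by rewrite lee_fin mulr_ge0// powR_ge0.
- by apply: sume_ge0 => f _; apply: integral_ge0 => z _; rewrite lee_fin.
rewrite -ge0_integral_sum//; last by move=> f z _; rewrite lee_fin.
apply: ge0_le_integral => //.
- by move=> z _; apply: sume_ge0 => f _; rewrite lee_fin.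
- exact: emeasurable_sum.
- exact/measurable_EFinP.
(* The products of a cell with itself are disjoint, so the energies of the cells add up to at most
   the full energy. *)
move=> z _; rewrite sumEFin lee_fin /J -mulr_suml ler_piMl ?cell_partition2//.
by rewrite mulr_ge0 ?sqr_ge0 ?gkern_ge0.
Qed.

End fractional_poincare.

(** * Smooth functions with compact support *)

Lemma is_deriveP {R : realType} {V : normedModType R} (f : V -> R) (x v : V) (l : R) :
  h^-1 *: (f (h *: v + x) - f x) @[h --> 0^'] --> l -> is_derive x v f l.
Proof. by move=> h; apply: DeriveDef; [apply/cvg_ex; exists l|exact: cvg_lim]. Qed.

Lemma is_derive_cvg {R : realType} {V : normedModType R} (f : V -> R) (x v : V) (l : R) :
  is_derive x v f l -> h^-1 *: (f (h *: v + x) - f x) @[h --> 0^'] --> l.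
Proof. by case=> df <-; exact: df. Qed.

Section directional_derivatives.
Context {R : realType} {V : normedModType R}.
Implicit Types (f g : V -> R) (x v : V).

Lemma is_derive_line f x v (t l : R) :
  is_derive t 1 (fun t : R => f (t *: v + x)) l <-> is_derive (t *: v + x) v f l.
Proof.
have E : (fun h : R => h^-1 *: (f ((h *: 1 + t) *: v + x) - f (t *: v + x))) =
         (fun h : R => h^-1 *: (f (h *: v + (t *: v + x)) - f (t *: v + x))).
  by apply/funext => h; rewrite scalerDl [h *: 1]mulr1 addrA.
split=> hd; apply: is_deriveP.
  by rewrite -E; have := is_derive_cvg hd.
by rewrite E; have := is_derive_cvg hd.
Qed.

Lemma is_derive_line0 f x v (l : R) :
  is_derive (0 : R) 1 (fun t : R => f (t *: v + x)) l <-> is_derive x v f l.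
Proof. by rewrite is_derive_line scale0r add0r. Qed.

End directional_derivatives.

(** * The flat function exp(-1/t) and its relatives *)

Section flat_function.
Context {R : realType}.
Implicit Types (m : nat) (t y : R).

(** The factors t^(-m) make the family stable under differentiation, up to linear combinations: one
    first derivative, computed for all m, yields all orders of smoothness. *)
Definition flat m t : R := if 0 < t then t^-1 ^+ m * expR (- t^-1) else 0.

Lemma flat_ge0 m t : 0 <= flat m t.
Proof.
rewrite /flat; case: ifPn => // t0.
by rewrite mulr_ge0 ?expR_ge0// exprn_ge0// invr_ge0 ltW.
Qed.

Lemma flat_gt0 m t : 0 < t -> 0 < flat m t.
Proof. by move=> t0; rewrite /flat t0 mulr_gt0 ?expR_gt0// exprn_gt0// invr_gt0. Qed.

Lemma flat_le0 m t : t <= 0 -> flat m t = 0.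
Proof. by rewrite /flat leNgt => /negbTE ->. Qed.

(** The exponential series gives y^m <= m! exp(y), used at y = 1/t. *)
Lemma flat_le m t : flat m t <= m`!%:R.
Proof.
rewrite /flat; case: ifPn => [t0|_]; last by rewrite ler0n.
have y0 : 0 < t^-1 by rewrite invr_gt0.
rewrite expRN ler_pdivrMr ?expR_gt0//; case: m => [|m].
  by rewrite expr0 fact0 mul1r; apply: le_trans (expR_ge1Dx _); rewrite lerDl ltW.
rewrite mulrC -ler_pdivrMr ?ltr0n ?fact_gt0//.
by apply: le_trans (expR_ge1Dxn m (ltW y0)); rewrite lerDr.
Qed.

Lemma flatS m t : t * flat m.+1 t = flat m t.
Proof.
rewrite /flat; case: ifPn => [t0|_]; last by rewrite mulr0.
by rewrite exprS !mulrA mulfV ?mul1r// gt_eqF.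
Qed.

Lemma is_derive_flat m t :
  is_derive t 1 (flat m) (flat m.+2 t - m%:R * flat m.+1 t).
Proof.
have [t0|t0|->] := ltgtP t 0.
- rewrite !flat_le0 ?(ltW t0)// mulr0 subrr.
  apply: (@near_eq_is_derive _ _ _ (cst 0 : R -> R)).
  by near=> y; rewrite flat_le0// ltW//; near: y; exact: lt_nbhsl.
- pose F y : R := y^-1 ^+ m * expR (- y^-1).
  apply: (@near_eq_is_derive _ _ _ F).
    by near=> y; rewrite /flat ifT//; near: y; exact: lt_nbhsr.
  have dV : is_derive t 1 (fun y : R => y^-1) (- t ^- 2 *: 1).
    by apply: (@is_deriveV _ id) => //; rewrite gt_eqF.
  have dN : is_derive t 1 (fun y : R => - y^-1) (t ^- 2).
    have := is_deriveN dV; by rewrite scaleNr opprK [_ *: 1]mulr1.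
  have dE : is_derive t 1 (fun y : R => expR (- y^-1)) (expR (- t^-1) * t ^- 2).
    exact: (@is_derive1_comp _ expR (fun y : R => - y^-1)).
  have V2 : t ^- 2 = t^-1 * t^-1 by rewrite -exprVn expr2.
  have dX : is_derive t 1 (fun y : R => y^-1 ^+ m) (- (m%:R * t^-1 ^+ m.+1)).
    elim: m {F} => [|m IH]; first by rewrite mul0r oppr0; exact: is_derive_cst.
    have -> : (fun y : R => y^-1 ^+ m.+1) =
              (fun y => y^-1) * (fun y : R => y^-1 ^+ m).
      by apply/funext => y; rewrite exprS.
    apply: is_derive_eq (is_deriveM dV IH) _.
    by rewrite V2 /GRing.scale /= !exprS -natr1; ring.
  have -> : F = (fun y : R => y^-1 ^+ m) * (fun y : R => expR (- y^-1)) by [].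
  apply: is_derive_eq (is_deriveM dX dE) _.
  by rewrite V2 /flat t0 /GRing.scale /= !exprS; ring.
- rewrite !flat_le0// mulr0 subrr; apply: is_deriveP.
  apply/cvgrPdist_lt => /= e e0.
  have c0 : 0 < (m.+2)`!%:R + 1 :> R by rewrite ltr_wpDl ?ler0n.
  near=> h; have h0 : h != 0 by near: h; exact: nbhs_dnbhs_neq.
  rewrite sub0r normrN addr0 (flat_le0 m (lexx 0)) subr0 [h *: 1]mulr1.
  (* This turns the difference quotient at 0 into h times a bounded function, for both signs of
     h. *)
  have -> : h^-1 *: flat m h = h * flat m.+2 h.
    have -> : h^-1 *: flat m h = h^-1 * flat m h by [].
    by rewrite -(flatS m) -(flatS m.+1) [h^-1 * _]mulrA mulVf// mul1r.
  rewrite normrM (ger0_norm (flat_ge0 _ _)).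
  apply: (@le_lt_trans _ _ (`|h| * ((m.+2)`!%:R + 1))).
    by rewrite ler_wpM2l//; apply: le_trans (flat_le _ _) _; rewrite lerDl.
  rewrite -ltr_pdivlMr//.
  near: h; apply: dnbhs0_lt; by rewrite divr_gt0.
Unshelve. all: by end_near. Qed.

Lemma continuous_flat m : continuous (flat m).
Proof.
move=> t; apply: differentiable_continuous; apply/derivable1_diffP.
by case: (is_derive_flat m t).
Qed.

End flat_function.

Section Ck_calculus.
Context {R : realType} {n : nat}.
Implicit Types (f g : 'rV[R]_n -> R) (k m : nat) (i : 'I_n) (x v : 'rV[R]_n).

Definition partial i f x : R := 'D_(delta_mx ord0 i) f x.

Lemma Ck_continuous k f : Ck k f -> continuous f.
Proof. by case: k => [|k] // []. Qed.

Lemma CkS k f (g : 'I_n -> 'rV[R]_n -> R) : continuous f ->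
  (forall i x, is_derive x (delta_mx ord0 i) f (g i x)) ->
  (forall i, Ck k (g i)) -> Ck k.+1 f.
Proof.
move=> cf df Cg; split=> // i; split=> [x|]; first by case: (df i x).
rewrite (_ : (fun x => _) = g i)//.
by apply/funext => x; case: (df i x).
Qed.

Lemma CkS_derive k f i x : Ck k.+1 f ->
  is_derive x (delta_mx ord0 i) f (partial i f x).
Proof. by move=> [_ /(_ i)[df _]]; apply: DeriveDef. Qed.

Lemma CkW k f : Ck k.+1 f -> Ck k f.
Proof.
elim: k f => [|k IH] f; first by case.
by move=> [cf Cf]; split=> // i; have [df /IH] := Cf i.
Qed.

Lemma Ck_cst k (c : R) : Ck k (cst c : 'rV[R]_n -> R).
Proof.
elim: k c => [|k IH] c; first by move=> x; exact: cst_continuous.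
apply: (@CkS _ _ (fun _ => cst 0)) => // x; exact: cst_continuous.
Qed.

Lemma CkD k f g : Ck k f -> Ck k g -> Ck k (f \+ g).
Proof.
elim: k f g => [|k IH] f g Cf Cg.
  by move=> x; apply: continuousD; [exact: Cf|exact: Cg].
apply: (@CkS _ _ (fun i => partial i f \+ partial i g)) => [x|i x|i].
- by apply: continuousD; [exact: (Ck_continuous Cf)|exact: (Ck_continuous Cg)].
- by apply: (is_deriveD (CkS_derive i x Cf) (CkS_derive i x Cg)).
- by apply: IH; [case: Cf|case: Cg] => _ /(_ i)[].
Qed.

Lemma CkM k f g : Ck k f -> Ck k g -> Ck k (f \* g).
Proof.
elim: k f g => [|k IH] f g Cf Cg.
  by move=> x; apply: continuousM; [exact: Cf|exact: Cg].
apply: (@CkS _ _ (fun i => f \* partial i g \+ g \* partial i f)) => [x|i x|i].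
- by apply: continuousM; [exact: (Ck_continuous Cf)|exact: (Ck_continuous Cg)].
- by apply: (is_deriveM (CkS_derive i x Cf) (CkS_derive i x Cg)).
- apply: CkD; apply: IH; by [exact: CkW|case: Cf => _ /(_ i)[]|case: Cg => _ /(_ i)[]].
Qed.

Lemma Ck_sum k (I : Type) (r : seq I) (F : I -> 'rV[R]_n -> R) :
  (forall j, Ck k (F j)) -> Ck k (fun x => \sum_(j <- r) F j x).
Proof.
move=> CF; elim: r => [|j r IH].
  rewrite (_ : (fun _ => _) = cst 0); first exact: Ck_cst.
  by apply/funext => x; rewrite big_nil.
rewrite (_ : (fun _ => _) = F j \+ (fun x => \sum_(j <- r) F j x)).
  exact: CkD.
by apply/funext => x; rewrite big_cons.
Qed.

Lemma is_derive_coord (i : 'I_n) x v :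
  is_derive x v (fun x : 'rV[R]_n => x ord0 i) (v ord0 i).
Proof.
apply/is_derive_line0.
rewrite (_ : (fun t : R => _) = (fun t => t * v ord0 i + x ord0 i)); last first.
  by apply/funext => t; rewrite !mxE.
rewrite -[X in is_derive _ _ _ X]addr0; apply: is_deriveD.
rewrite (_ : (fun t : R => _) = v ord0 i \*: (id : R -> R)).
  by rewrite -[X in is_derive _ _ _ X]mulr1; exact: is_deriveZ.
by apply/funext => t; rewrite mulrC.
Qed.

Lemma Ck_coord k (i : 'I_n) : Ck k (fun x : 'rV[R]_n => x ord0 i).
Proof.
have cc : continuous (fun x : 'rV[R]_n => x ord0 i) by move=> x; exact: coord_continuous.
case: k => [|k] //.
apply: (@CkS _ _ (fun j => cst ((delta_mx ord0 j : 'rV[R]_n) ord0 i))) => // [j x|j].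
  exact: is_derive_coord.
exact: Ck_cst.
Qed.

Lemma is_derive_comp_line (h : R -> R) (g : 'rV[R]_n -> R) x v (a b : R) :
  is_derive (g x) 1 h a -> is_derive x v g b ->
  is_derive x v (h \o g) (a * b).
Proof.
move=> dh /is_derive_line0 dg; apply/is_derive_line0.
apply: (@is_derive1_comp _ h (fun t : R => g (t *: v + x))).
by rewrite scale0r add0r.
Qed.

(** Differentiation raises the index of [flat], so the induction on k has to be uniform in m. *)
Lemma Ck_flat k m g : Ck k g -> Ck k (flat m \o g).
Proof.
elim: k m g => [|k IH] m g Cg.
  by move=> x; apply: continuous_comp; [exact: Cg|exact: continuous_flat].
apply: (@CkS _ _ (fun i => (fun x => flat m.+2 (g x) - m%:R * flat m.+1 (g x)) \* partial i g))
  => [x|i x|i].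
- by apply: continuous_comp; [exact: (Ck_continuous Cg)|exact: continuous_flat].
- apply: is_derive_comp_line; first exact: is_derive_flat.
  exact: (CkS_derive i x Cg).
- apply: (@CkM k (fun x => flat m.+2 (g x) - m%:R * flat m.+1 (g x))); last first.
    by case: Cg => _ /(_ i)[].
  have Cg' := CkW Cg.
  rewrite (_ : (fun x => _) = flat m.+2 \o g \+ (cst (- m%:R) \* (flat m.+1 \o g))).
    apply: CkD; first exact: IH.
    by apply: CkM; [exact: Ck_cst|exact: IH].
  by apply/funext => x /=; rewrite mulNr.
Qed.

End Ck_calculus.

Section Ccinf.
Context {R : realType} {n : nat}.
Implicit Types (f g : 'rV[R]_n -> R) (U : set 'rV[R]_n) (i : 'I_n) (x z : 'rV[R]_n).

Lemma supp_out f x : ~ supp f x -> f x = 0.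
Proof.
by apply: contra_notP => /eqP h; exact: subset_closure.
Qed.

Lemma supp_sub f (K : set 'rV[R]_n) : closed K ->
  (forall x, ~ K x -> f x = 0) -> supp f `<=` K.
Proof.
move=> cK h; rewrite [X in _ `<=` X](closure_id K).1//; apply: closureS => x /eqP.
by apply: contra_notP => /h.
Qed.

Lemma Ccinf_sub U f (K : set 'rV[R]_n) : (forall k, Ck k f) -> compact K ->
  (forall x, ~ K x -> f x = 0) -> K `<=` U -> Ccinf U f.
Proof.
move=> Cf cK fK KU; have cl : closed K by apply: compact_closed cK; exact: norm_hausdorff.
have sK := supp_sub cl fK; split=> //; last exact: subset_trans KU.
apply: subclosed_compact cK sK; exact: closed_closure.
Qed.

Lemma Ccinf_subspace U : lin_subspace (Ccinf U : set ('rV[R]_n -> R)).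
Proof.
split=> [|c f g [Cf cf fU] [Cg cg gU]].
  apply: (@Ccinf_sub _ _ set0) => //; last exact: compact0.
  by move=> k; exact: Ck_cst.
apply: (@Ccinf_sub _ _ (supp f `|` supp g)) => //.
- by move=> k; apply: CkD => //; apply: CkM => //; exact: Ck_cst.
- exact: compactU.
- move=> x /not_orP[/supp_out fx /supp_out gx].
  by transitivity (c * f x + g x) => //; rewrite fx gx mulr0 addr0.
- by move=> x [/fU|/gU].
Qed.

Lemma Ccinf_continuous U f : Ccinf U f -> continuous f.
Proof. by case=> /(_ 0%N). Qed.

Lemma Ccinf_partial U f i : Ccinf U f -> Ccinf U (partial i f).
Proof.
move=> [Cf cf fU]; apply: (@Ccinf_sub _ _ (supp f)) => //.
  by move=> k; case: (Cf k.+1) => _ /(_ i)[].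
move=> x nx; rewrite /partial (@near_eq_derive _ _ _ _ (cst 0)) ?derive_cst//.
have : nbhs x (~` supp f).
  by apply: open_nbhs_nbhs; split=> //; apply: closed_openC; exact: closed_closure.
by apply: filterS => y /supp_out.
Qed.

Lemma Ccinf_bounded U f : Ccinf U f -> exists2 M, 0 <= M & forall x, `|f x| <= M.
Proof.
move=> Cf; have [_ cf _] := Cf.
have : bounded_set (f @` supp f).
  apply: compact_bounded; apply: continuous_compact cf.
  by apply: continuous_subspaceT; exact: Ccinf_continuous Cf.
move=> [M [_ hM]]; exists (`|M| + 1) => [|x]; first by rewrite addr_ge0.
have [sx|/supp_out ->] := pselect (supp f x); last by rewrite normr0 addr_ge0.
by apply: (hM (`|M| + 1)); [rewrite ltr_pwDr// ler_norm|exists x].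
Qed.

Lemma Ccinf_mvt U f i x (h : R) : Ccinf U f -> exists2 c, `|c| <= `|h| &
  f (h *: delta_mx ord0 i + x) - f x =
  h * partial i f (c *: delta_mx ord0 i + x).
Proof.
move=> [Cf _ _]; pose F (t : R) := f (t *: delta_mx ord0 i + x).
have dF (t : R) : is_derive t 1 F (partial i f (t *: delta_mx ord0 i + x)).
  by apply/is_derive_line; exact: (@CkS_derive _ _ 0 f i _ (Cf 1%N)).
have cF : continuous F.
  move=> t; apply: differentiable_continuous; apply/derivable1_diffP.
  by case: (dF t).
have F0 : F 0 = f x by rewrite /F scale0r add0r.
rewrite -/(F h) -F0; have [h0|h0] := leP 0 h.
  have [c] := @MVT_segment _ F _ _ _ h0 (fun t _ => dF t) (continuous_subspaceT cF).
  rewrite in_itv/= subr0 => /andP[c0 ch] ->; exists c; last by rewrite mulrC.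
  by rewrite !ger0_norm.
have [c] := @MVT_segment _ F _ _ _ (ltW h0) (fun t _ => dF t) (continuous_subspaceT cF).
rewrite in_itv/= sub0r => /andP[hc c0] e; exists c; first by rewrite !ler0_norm ?lerN2// ltW.
by rewrite -opprB e mulrN opprK mulrC.
Qed.

(** The way from x to x + z is travelled one coordinate at a time, with the mean value theorem on
    each leg; L is the sum of bounds for the partial derivatives. *)
Lemma Ccinf_lipschitz U f : Ccinf U f ->
  exists2 L, 0 <= L & forall x z, `|f (x + z) - f x| <= L * enorm z.
Proof.
move=> Cf.
have /choice[M hM] i : exists M : R, 0 <= M /\ forall x, `|partial i f x| <= M.
  by have [M M0 hM] := Ccinf_bounded (Ccinf_partial i Cf); exists M.
exists (\sum_i M i) => [|x z]; first by apply: sumr_ge0 => i _; case: (hM i).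
have key (r : seq 'I_n) : `|f (x + \sum_(i <- r) z ord0 i *: delta_mx ord0 i) - f x|
    <= (\sum_(i <- r) M i) * enorm z.
  elim: r => [|i r IH]; first by rewrite !big_nil addr0 subrr normr0 mul0r.
  rewrite !big_cons mulrDl.
  set w : 'rV[R]_n := \sum_(j <- r) z ord0 j *: delta_mx ord0 j in IH *.
  set a : 'rV[R]_n := _ *: _.
  have -> : f (x + (a + w)) - f x = (f (a + (x + w)) - f (x + w)) + (f (x + w) - f x).
    by rewrite subrKA addrCA.
  apply: le_trans (ler_normD _ _) _; apply: lerD IH.
  have [c _ ->] := Ccinf_mvt i (x + w) (z ord0 i) Cf.
  rewrite normrM mulrC; apply: ler_pM => //; last exact: coord_le_enorm.
  by case: (hM i).
by rewrite {1}(row_sum_delta z); exact: key.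
Qed.

(** Mean value theorem, then the Lipschitz bound of the partial derivative. The constant is uniform
    in x, which is what differentiation of a convolution requires. *)
Lemma Ccinf_taylor U f i : Ccinf U f -> exists2 L, 0 <= L & forall x (h : R),
  `|f (h *: delta_mx ord0 i + x) - f x - h * partial i f x| <= L * h ^+ 2.
Proof.
move=> Cf; have [L L0 hL] := Ccinf_lipschitz (Ccinf_partial i Cf).
exists (L * enorm (delta_mx ord0 i : 'rV[R]_n)) => [|x h]; first by rewrite mulr_ge0 ?enorm_ge0.
have [c ch ->] := Ccinf_mvt i x h Cf.
set e : 'rV[R]_n := delta_mx ord0 i in hL *.
have := hL x (c *: e); rewrite [x + _]addrC enormZ => hc.
rewrite -mulrBr normrM (_ : L * enorm e * h ^+ 2 = `|h| * (L * (`|h| * enorm e))).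
  rewrite ler_wpM2l//; apply: le_trans hc _.
  by rewrite ler_wpM2l// ler_wpM2r ?enorm_ge0.
by rewrite -(real_normK (num_real h)); ring.
Qed.

End Ccinf.

(** * Integrability of homogeneous jump kernels *)

Section levy_kernel.
Context {R : realType} {n : nat}.
Local Notation mu := (lebesgue_rV n).
Local Open Scope ereal_scope.

Lemma measurable_dilate (c : R) (U : set 'rV[R]_n) : measurable U ->
  measurable [set z : 'rV[R]_n | U (c *: z)%R].
Proof.
move=> mU; rewrite (_ : [set z | _] = setT `&` (fun z : 'rV[R]_n => c *: z + 0)%R @^-1` U).
  exact: measurable_rV_affine.
by rewrite setTI; apply/seteqP; split => z /=; rewrite addr0.
Qed.

(* Self-similarity: the integral over U is dominated by a geometric series in
   the integrals over the dilates of the fundamental domain U \ lambda U. *)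
Lemma integral_self_similar (lambda rho : R) (U : set 'rV[R]_n) (G : 'rV[R]_n -> \bar R) :
  (0 < lambda)%R -> (0 <= rho < 1)%R -> measurable U ->
  measurable_fun setT G -> (forall z, 0 <= G z) ->
  (forall z, (lambda ^+ n)%:E * G (lambda *: z)%R = rho%:E * G z) ->
  (forall z, U z -> U (lambda *: z)%R) ->
  (forall z, U z -> exists N : nat, ~ U (lambda ^- N *: z)%R) ->
  \int[mu]_(z in U `&` [set z | ~ U (lambda^-1 *: z)%R]) G z < +oo ->
  \int[mu]_(z in U) G z < +oo.
Proof.
move=> l0 /andP[r0 r1] mU mG G0 Gl Ul Uex base.
have l0' : (lambda != 0)%R by rewrite gt_eqF.
pose V N := U `&` [set z | ~ U (lambda ^- N *: z)%R].
have mV N : measurable (V N).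
  by apply: measurableI => //; apply: measurableC; exact: measurable_dilate.
have ndV : nondecreasing_seq V.
  apply/nondecreasing_seqP => N; apply/subsetPset => z [Uz nU]; split=> //.
  apply: contra_not nU => /Ul; rewrite scalerA.
  by rewrite [X in (X *: _)%R](_ : _ = lambda ^- N)%R// exprS invfM mulVKf.
have VU : \bigcup_N V N = U.
  apply/seteqP; split=> [z [N _ []]//|z Uz].
  by have [N nU] := Uex _ Uz; exists N.
have base_fin : \int[mu]_(z in V 1%N) G z \is a fin_num.
  rewrite ge0_fin_numE; last by apply: integral_ge0.
  by rewrite /V expr1.
have [t t0 ht] : exists2 t : R, (0 <= t)%R & \int[mu]_(z in V 1%N) G z = t%:E.
  exists (fine (\int[mu]_(z in V 1%N) G z)); last by rewrite fineK.
  by rewrite fine_ge0// integral_ge0.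
(* A point of [V N.+1] lies in [V 1] or is the dilate by lambda of a point of [V N], so the
   integrals satisfy I(N+1) <= t + rho I(N); t / (1 - rho) is the fixed point of this recursion. *)
have bound N : \int[mu]_(z in V N) G z <= (t / (1 - rho))%:E.
  have r1' : (0 < 1 - rho)%R by rewrite subr_gt0.
  elim: N => [|N IH].
    rewrite (_ : V 0%N = set0) ?integral_set0 ?lee_fin ?divr_ge0 ?(ltW r1')//.
    by apply/seteqP; split => z // [Uz]; rewrite /= expr0 invr1 scale1r.
  pose H (z : 'rV[R]_n) := (G \_ (V N)) (lambda^-1 *: z + 0)%R * (rho / lambda ^+ n)%:E.
  have mGV : measurable_fun setT (G \_ (V N)).
    by apply/(measurable_restrictT _ _).1 => //; exact: measurable_funTS.
  have GV0 z : 0 <= (G \_ (V N)) z by rewrite patchE; case: ifP.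
  have rl0 : (0 <= rho / lambda ^+ n)%R by rewrite divr_ge0// exprn_ge0// ltW.
  have mH : measurable_fun setT (fun z : 'rV[R]_n => (G \_ (V N)) (lambda^-1 *: z + 0)%R).
    by apply: measurableT_comp => //; exact: measurable_rV_affine.
  apply: (@le_trans _ _ (t%:E + rho%:E * \int[mu]_(z in V N) G z)); last first.
    apply: (@le_trans _ _ (t%:E + rho%:E * (t / (1 - rho))%:E)).
      by rewrite leeD2l// lee_wpmul2l// lee_fin.
    rewrite -EFinM -EFinD lee_fin le_eqVlt; apply/orP; left; apply/eqP.
    by field; rewrite gt_eqF.
  have -> : rho%:E * \int[mu]_(z in V N) G z = \int[mu]_z H z.
    rewrite /H ge0_integralZr// (integral_rV_affine 0%R)//; last first.
      by rewrite invr_eq0.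
    rewrite gtr0_norm ?invr_gt0// exprVn invrK [in RHS]muleC muleA -EFinM.
    by rewrite mulfVK ?expf_neq0// integral_mkcond.
  rewrite -ht (integral_mkcond (V N.+1)) (integral_mkcond (V 1%N)).
  rewrite -ge0_integralD//; first last.
  - exact: emeasurable_funM.
  - by move=> z _; rewrite mule_ge0.
  - by apply/(measurable_restrictT _ _).1 => //; exact: measurable_funTS.
  - by move=> z _; rewrite patchE; case: ifP.
  apply: ge0_le_integral => //.
  - by move=> z _; rewrite patchE; case: ifP.
  - by apply/(measurable_restrictT _ _).1 => //; exact: measurable_funTS.
  - apply: emeasurable_funD; last exact: emeasurable_funM.
    by apply/(measurable_restrictT _ _).1 => //; exact: measurable_funTS.
  move=> z _; rewrite [leLHS]patchE; case: ifPn => [/set_mem[Uz nU]|_]; last first.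
    by rewrite adde_ge0 ?mule_ge0// patchE; case: ifP.
  have [Ul1|nUl1] := pselect (U (lambda^-1 *: z)%R); last first.
    rewrite patchE ifT; first by rewrite leeDl// mule_ge0.
    by rewrite inE; split => //; rewrite /= expr1.
  rewrite [X in _ <= X + _]patchE ifF ?add0e; last first.
    by apply/negbTE; rewrite notin_setE => -[_]; rewrite /= expr1.
  rewrite /H patchE addr0 ifT; last first.
    rewrite inE; split => //; apply: contra_not nU.
    by rewrite /= scalerA -invfM -exprSr.
  rewrite EFinM muleA [G _ * _]muleC -Gl scalerA mulfV// scale1r muleAC -EFinM.
  by rewrite mulfV ?expf_neq0// mul1e.
have := ge0_nondecreasing_set_cvg_integral (mu := mu) ndV mV
  (fun N => measurable_funTS mG) (fun N z _ => G0 z).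
rewrite VU => cv; apply: (@le_lt_trans _ _ (t / (1 - rho))%:E); last exact: ltry.
by apply: cvge_le cv; exact: nearW.
Qed.

Variable s : R.
Hypothesis hs : (0 < s < 1)%R.

(** Self-similarity is used twice. In the unit ball, halving z multiplies the integral of |z|^2 b
    |z|^(-p) by 2^(2s-2); outside it, doubling z multiplies that of b |z|^(-p) by 2^(-2s). Both
    ratios are below 1 exactly because 0 < s < 1. The fundamental domains are shells between radii
    1/2 and 1 and between 1 and 2, where the power is bounded and [b] integrable. *)
Lemma integral_levy (b : 'rV[R]_n -> R) :
  measurable_fun setT b -> (forall z, (0 <= b z)%R) ->
  (forall (t : R) z, (0 < t)%R -> b (t *: z)%R = b z) ->
  \int[mu]_(z in eball 0%R 1%R) (b z)%:E < +oo ->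
  \int[mu]_z (Num.min 1 (enorm z ^+ 2) * (b z * gkern s z))%:E < +oo.
Proof.
move=> mb b0 bZ bfin; have [s0 s1] := andP hs.
pose p := (n%:R + 2 * s)%R.
have p0 : (0 <= p)%R by rewrite addr_ge0// mulr_ge0// ltW.
have mK := @measurable_gkern R n s; have K0 := @gkern_ge0 R n s.
have bfin2 : \int[mu]_(z in eball 0%R 2%R) (b z)%:E < +oo.
  rewrite integral_homogeneous//.
  - by rewrite lte_mul_pinfty// lee_fin exprn_ge0.
  - exact/measurable_EFinP.
  - by move=> t x t0; rewrite bZ.
have KZ (l : R) (z : 'rV[R]_n) : (0 < l)%R -> gkern s (l *: z)%R = ((l `^ p)^-1 * gkern s z)%R.
  by move=> l0; rewrite /gkern enormZ gtr0_norm// powRM ?enorm_ge0 ?(ltW l0)// invfM.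
pose G1 (z : 'rV[R]_n) := (enorm z ^+ 2 * (b z * gkern s z))%:E.
pose G2 (z : 'rV[R]_n) := (b z * gkern s z)%:E.
have mbK : measurable_fun setT (fun z => b z * gkern s z)%R by exact: measurable_funM.
have mG2 : measurable_fun setT G2 by exact/measurable_EFinP.
have mG1 : measurable_fun setT G1.
  apply/measurable_EFinP; apply: measurable_funM => //; apply: measurable_funX.
  exact: measurable_enorm.
have G20 z : 0 <= G2 z by rewrite lee_fin mulr_ge0.
have G10 z : 0 <= G1 z by rewrite lee_fin mulr_ge0 ?sqr_ge0// mulr_ge0.
pose U1 : set 'rV[R]_n := [set z | (0 < enorm z)%R /\ (enorm z <= 1)%R].
pose U2 : set 'rV[R]_n := [set z | (1 <= enorm z)%R].
have mU2 : measurable U2.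
  rewrite -[U2]setTI; apply: measurable_fun_le => //; exact: measurable_enorm.
have mU1 : measurable U1.
  rewrite (_ : U1 = punctured_ball); first exact: measurable_punctured_ball.
  by apply/seteqP; split => z /=; [move=> [? ?]; apply/andP|move=> /andP].
have mT A (mA : measurable A) f : measurable_fun setT f -> measurable_fun setT ((f : 'rV[R]_n ->
  \bar R) \_ A).
  by move=> mf; apply/(measurable_restrictT _ _).1 => //; exact: measurable_funTS.
have n20 : (0 < 2 `^ p)%R by rewrite powR_gt0.
have fin_of A (c : R) (G : 'rV[R]_n -> \bar R) : measurable A -> (0 <= c)%R ->
    measurable_fun setT G -> (forall z, 0 <= G z) ->
    A `<=` eball 0%R 2%R -> (forall z, A z -> G z <= c%:E * (b z)%:E) ->
    \int[mu]_(z in A) G z < +oo.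
  move=> mA c0 mG G0 A2 hG.
  apply: (@le_lt_trans _ _ (c%:E * \int[mu]_(z in eball 0%R 2%R) (b z)%:E)); last first.
    by rewrite lte_mul_pinfty// lee_fin.
  rewrite -ge0_integralZl//; last 3 first.
  - exact: measurable_eball.
  - by apply/measurable_EFinP; exact: measurable_funTS.
  - by move=> z _; rewrite lee_fin.
  have mcb : measurable_fun setT (fun z => c%:E * (b z)%:E).
    by apply: measurable_funeM; exact/measurable_EFinP.
  apply: (@le_trans _ _ (\int[mu]_(z in A) (c%:E * (b z)%:E))).
    by apply: ge0_le_integral => //; exact: measurable_funTS.
  apply: ge0_subset_integral => //; [exact: measurable_eball|exact: measurable_funTS|].
  by move=> z _; rewrite mule_ge0// lee_fin.
pose A := (2 `^ (2 * s))%R; pose B := (2 `^ (2 - 2 * s))%R.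
have gt1 (x : R) : (0 < x)%R -> (1 < 2 `^ x)%R.
  by move=> x0; have := @gt0_ltr_powR R x x0 1%R 2%R; rewrite powR1 !nnegrE; apply; rewrite ?ltr1n.
have A1 : (1 < A)%R by apply: gt1; lra.
have B1 : (1 < B)%R by apply: gt1; lra.
have A0 : (A != 0)%R by rewrite gt_eqF// (lt_trans ltr01).
have B0 : (B != 0)%R by rewrite gt_eqF// (lt_trans ltr01).
have AB : (A * B = 4)%R.
  rewrite /A /B -powRD; last by rewrite pnatr_eq0/= implybT.
  rewrite addrC subrK powR_mulrn//; lra.
have pA : (2 `^ p = 2 ^+ n * A)%R.
  by rewrite /p powRD ?pnatr_eq0 ?implybT// powR_mulrn.
have pV : (2^-1 `^ p = (2 `^ p)^-1)%R.
  have n2 : (2 `^ p != 0)%R by rewrite gt_eqF.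
  apply: (mulIf n2).
  by rewrite -powRM ?invr_ge0// !mulVf ?powR1// ?pnatr_eq0 ?gt_eqF.
have pow2 (x : R) : exists N : nat, (x < 2 ^+ N)%R.
  exists (Num.bound `|x|); apply: le_lt_trans (ler_norm x) _.
  apply: lt_le_trans (archi_boundP (normr_ge0 x)) _.
  by rewrite -natrX ler_nat ltnW// ltn_expl.
have I1 : \int[mu]_(z in U1) G1 z < +oo.
  have h0 : (0 < 2^-1 :> R)%R by rewrite invr_gt0.
  apply: (@integral_self_similar 2^-1 B^-1) => //.
  - by rewrite invr_ge0 (ltW (lt_trans ltr01 B1))/= invf_lt1// (lt_trans ltr01).
  - move=> z; rewrite /G1 -!EFinM; congr EFin; rewrite enormZ KZ// bZ// gtr0_norm//.
    rewrite pV pA invrK.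
    have -> : (B^-1 = A / 4)%R by rewrite -AB; field; rewrite A0 B0.
    have : ((2^-1 : R) ^+ n * 2 ^+ n = 1)%R by rewrite -exprMn mulVf ?expr1n.
    move: (2^-1 ^+ n)%R (2 ^+ n)%R => x y xy.
    transitivity (x * y * A / 4 * (enorm z ^+ 2 * (b z * gkern s z)))%R; first by field.
    by rewrite xy mul1r.
  - move=> z [z0 z1]; split; rewrite enormZ gtr0_norm// ?mulr_gt0//.
    by rewrite ler_pdivrMl// (le_trans z1)// mulr1 ler1n.
  - move=> z [z0 z1]; have [N hN] := pow2 (enorm z)^-1%R.
    exists N => -[_]; rewrite exprVn invrK enormZ gtr0_norm ?exprn_gt0//.
    by apply/negP; rewrite -ltNge -ltr_pdivrMr// mul1r.
  - apply: (fin_of _ (2 `^ p)%R) => //; first by apply: measurableI => //; apply: measurableC;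
      exact: measurable_dilate.
    + by move=> z [[z0 z1] _]; rewrite eball0E (le_trans z1)// ler1n.
    + move=> z [[z0 z1] nz]; rewrite /G1 -EFinM lee_fin [leRHS]mulrC mulrCA ler_wpM2l//.
      have z2 : (2^-1 <= enorm z)%R.
        move/not_andP: nz => [|/negP]; rewrite enormZ gtr0_norm ?invr_gt0// ?invrK.
          by rewrite mulr_gt0.
        by rewrite -ltNge => /ltW; rewrite -ler_pdivrMl// mulr1.
      rewrite -[leRHS]mul1r; apply: ler_pM; rewrite ?sqr_ge0// ?expr_le1 ?enorm_ge0//.
      rewrite -[leRHS]invrK -pV lef_pV2 ?posrE ?powR_gt0//.
      by apply: ge0_ler_powR; rewrite ?nnegrE ?enorm_ge0// invr_ge0.
have I2 : \int[mu]_(z in U2) G2 z < +oo.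
  apply: (@integral_self_similar 2 A^-1) => //.
  - by rewrite invr_ge0 (ltW (lt_trans ltr01 A1))/= invf_lt1// (lt_trans ltr01).
  - move=> z; rewrite /G2 -!EFinM; congr EFin; rewrite KZ// bZ// pA.
    by field; rewrite A0 expf_neq0.
  - move=> z; rewrite /U2/= enormZ gtr0_norm// => z1.
    by rewrite (le_trans z1)// ler_peMl ?enorm_ge0// ler1n.
  - move=> z _; have [N hN] := pow2 (enorm z).
    exists N; rewrite /U2/= enormZ gtr0_norm ?invr_gt0 ?exprn_gt0//.
    by apply/negP; rewrite -ltNge ltr_pdivrMl ?exprn_gt0// mulr1.
  - apply: (fin_of _ 1%R) => //; first by apply: measurableI => //; apply: measurableC;
      exact: measurable_dilate.
    + move=> z [_ /=]; rewrite /U2/= enormZ gtr0_norm ?invr_gt0// => /negP.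
      by rewrite -ltNge ltr_pdivrMl// mulr1 eball0E => /ltW.
    + move=> z [z1 _]; rewrite /G2 mul1e lee_fin ler_piMr//.
      rewrite invf_le1 ?powR_gt0 ?(lt_le_trans ltr01)//.
      have := @ge0_ler_powR R p p0 1%R (enorm z); rewrite powR1 !nnegrE; apply;
        rewrite ?enorm_ge0//.
apply: (@le_lt_trans _ _ (\int[mu]_z ((G1 \_ U1) z + (G2 \_ U2) z))); last first.
  rewrite ge0_integralD//; [|by move=> z _; rewrite patchE; case: ifP|exact: mT|by move=> z _;
    rewrite patchE; case: ifP|exact: mT].
  by rewrite -!integral_mkcond lte_add_pinfty.
apply: ge0_le_integral => //.
- by move=> z _; rewrite lee_fin mulr_ge0 ?mulr_ge0// le_min ler01 sqr_ge0.
- apply/measurable_EFinP; apply: measurable_funM => //.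
  apply: measurable_minr => //; apply: measurable_funX; exact: measurable_enorm.
- by apply: emeasurable_funD; exact: mT.
move=> z _; have [->|z0] := eqVneq z 0%R.
  rewrite enorm0 expr0n /= minEge ler01 mul0r.
  by rewrite adde_ge0// patchE; case: ifP.
have [z1|z1] := leP (enorm z) 1%R.
  rewrite [X in _ <= X + _]patchE ifT; last by rewrite inE; split=> //; rewrite enorm_gt0.
  rewrite -[leLHS]adde0 leeD//; last by rewrite patchE; case: ifP.
  by rewrite lee_fin ler_wpM2r ?mulr_ge0// ge_min lexx orbT.
rewrite [X in _ <= _ + X]patchE ifT; last by rewrite inE; exact: ltW.
rewrite -[leLHS]add0e leeD//; first by rewrite patchE; case: ifP.
by rewrite lee_fin -[leRHS]mul1r ler_wpM2r ?mulr_ge0// ge_min lexx.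
Qed.

End levy_kernel.

Section smooth_functions.
Context {R : realType} {n : nat}.
Local Notation mu := (lebesgue_rV n).
Implicit Types (f g : 'rV[R]_n -> R) (U : set 'rV[R]_n) (x y z : 'rV[R]_n).

Lemma continuous_measurable_rV f : continuous f -> measurable_fun setT f.
Proof.
move=> cf; apply: (measurability _ (RGenOInfty.measurableE R)) => //.
move=> /= _ [_ [x ->] <-]; rewrite setTI; apply: open_measurable_rV.
by move/continuousP : cf; apply; exact: interval_open.
Qed.

Lemma compact_eball x (r : R) : compact (eball x r).
Proof.
have cE : closed (eball x r).
  rewrite (_ : eball x r = (fun y => enorm (y - x)) @^-1` [set t | t <= r])//.
  apply: preimage_closed; last exact: (@closed_le R r).
  move=> y _; apply: continuous_comp; last exact: continuous_enorm.
  by apply: continuousB; [exact: cvg_id|exact: cst_continuous].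
have cB := @rV_compact R n (fun i => `[x ord0 i - r, x ord0 i + r]%classic)
  (fun i => @segment_compact R _ _).
apply: subclosed_compact cE cB _ => y xy i /=.
rewrite in_itv/= -ler_distl.
by have := coord_le_enorm (y - x) i; rewrite !mxE => /le_trans; apply.
Qed.

Lemma Ccinf_eball U f : Ccinf U f ->
  exists2 N, 0 < N & forall x, ~ eball 0 N x -> f x = 0.
Proof.
move=> [_ cf _]; have [N N0 hN] := bounded_enorm (compact_bounded cf).
exists N => // x; rewrite eball0E => nx; apply: supp_out.
by apply: contra_not nx => /hN.
Qed.

Variable s : R.
Hypothesis hs : 0 < s < 1.

Lemma integral_one_eball : (\int[mu]_(z in eball 0%R 1%R) (1%:E : \bar R) < +oo)%E.
Proof.
rewrite integral_cst ?mul1e; last exact: measurable_eball.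
exact: lebesgue_rV_eball_lty.
Qed.

Lemma Ccinf_sqint U f : Ccinf U f -> sqint mu f.
Proof.
move=> Cf; have mf := continuous_measurable_rV (Ccinf_continuous Cf).
have [N N0 hN] := Ccinf_eball Cf; have [M M0 hM] := Ccinf_bounded Cf.
split=> //; apply: (@le_lt_trans _ _ (\int[mu]_x (cst (M ^+ 2)%:E \_ (eball 0 N)) x)%E).
  apply: ge0_le_integral => //.
  - by move=> x _; rewrite lee_fin sqr_ge0.
  - exact: measurable_sqr.
  - by apply/(measurable_restrictT _ _).1; [exact: measurable_eball|].
  move=> x _; rewrite patchE; case: ifPn => [_|/negP nx].
    by rewrite lee_fin -real_normK ?num_real// ler_sqr ?nnegrE.
  by rewrite hN ?expr0n// => h; apply: nx; rewrite inE.
rewrite -integral_mkcond integral_cst; last exact: measurable_eball.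
by rewrite lte_mul_pinfty// ?lee_fin ?sqr_ge0//; exact: lebesgue_rV_eball_lty.
Qed.

(** The increment is bounded by twice the supremum of |f| and by the Lipschitz constant times |z|,
    and it vanishes unless x or x + z lies in a ball containing the support; the volume of that ball
    is therefore counted twice. *)
Lemma Ccinf_incr2 U f : Ccinf U f -> exists2 c, 0 <= c &
  forall z, (incr2 f z <= (c * Num.min 1 (enorm z ^+ 2))%:E)%E.
Proof.
move=> Cf; have mf := continuous_measurable_rV (Ccinf_continuous Cf).
have [N N0 hN] := Ccinf_eball Cf; have [M M0 hM] := Ccinf_bounded Cf.
have [L L0 hL] := Ccinf_lipschitz Cf.
pose B : set 'rV[R]_n := eball 0 N; have mB : measurable B by exact: measurable_eball.
pose K := (2 * M) ^+ 2 + L ^+ 2.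
have K0 : 0 <= K by rewrite addr_ge0 ?sqr_ge0.
have Bfin : mu B \is a fin_num by rewrite ge0_fin_numE//; exact: lebesgue_rV_eball_lty.
exists (2 * K * fine (mu B)) => [|z].
  by rewrite !mulr_ge0// fine_ge0// measure_ge0.
pose m := K * Num.min 1 (enorm z ^+ 2).
have m0 : 0 <= m by rewrite mulr_ge0// le_min ler01 sqr_ge0.
have hm x : (f (x + z) - f x) ^+ 2 <= m.
  have h0 (t c : R) : `|t| <= c -> t ^+ 2 <= c ^+ 2.
    move=> tc; have c0 := le_trans (normr_ge0 t) tc.
    by rewrite -real_normK ?num_real// ler_sqr ?nnegrE.
  rewrite /m minEle; case: ifPn => _.
    rewrite mulr1; apply: (@le_trans _ _ ((2 * M) ^+ 2)); last by rewrite lerDl sqr_ge0.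
    apply: h0; apply: le_trans (ler_normB _ _) _.
    by rewrite mulr_natl mulr2n lerD.
  apply: (@le_trans _ _ ((L * enorm z) ^+ 2)); first exact: h0.
  by rewrite exprMn ler_wpM2r ?sqr_ge0// lerDr sqr_ge0.
pose k x : R := \1_B (x + z) + \1_B x.
have mI : measurable_fun setT (\1_B : 'rV[R]_n -> R) by [].
have mIz : measurable_fun setT (fun x : 'rV[R]_n => \1_B (x + z) : R).
  by apply: measurableT_comp => //; exact: measurable_shift.
have ind0 x : 0 <= \1_B x :> R by rewrite indicE ler0n.
apply: (@le_trans _ _ (\int[mu]_x (m%:E * (k x)%:E))%E).
  apply: ge0_le_integral => //.
  - by move=> x _; rewrite lee_fin sqr_ge0.
  - exact: measurable_sqr_incr.
  - by apply: measurable_funeM; apply/measurable_EFinP; exact: measurable_funD.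
  move=> x _; rewrite -EFinM lee_fin.
  have [Bx|nBx] := pselect (B x).
    apply: le_trans (hm x) _; rewrite ler_peMr// /k (indicE R B x) mem_set//.
    by rewrite lerDr.
  have [Bxz|nBxz] := pselect (B (x + z)).
    apply: le_trans (hm x) _; rewrite ler_peMr// /k (indicE R B (x + z)) mem_set//.
    by rewrite lerDl.
  rewrite !hN// subrr expr0n /= mulr_ge0// /k addr_ge0//.
rewrite ge0_integralZl//; last 2 first.
- by apply/measurable_EFinP; exact: measurable_funD.
- by move=> x _; rewrite lee_fin addr_ge0.
under eq_integral do rewrite EFinD.
rewrite ge0_integralD//; try exact/measurable_EFinP; try by move=> x _; rewrite lee_fin.
rewrite (integral_rV_shift z (f := fun x => (\1_B x)%:E)); last 2 first.
- exact/measurable_EFinP.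
- by move=> x; rewrite lee_fin.
have -> : (\int[mu]_x (\1_B x : R)%:E = (fine (mu B))%:E)%E.
  by rewrite integral_indic// setIT fineK.
rewrite -EFinD -EFinM lee_fin /m.
by rewrite le_eqVlt; apply/orP; left; apply/eqP; ring.
Qed.

Lemma Ccinf_Hs U f : Ccinf U f -> Hs s f.
Proof.
move=> Cf; have sf := Ccinf_sqint Cf; have [mf _] := sf.
split; first exact/sqint_Lfun.
have [c c0 hc] := Ccinf_incr2 Cf.
have mK := @measurable_gkern R n s; have K0 := @gkern_ge0 R n s.
have -> : gagliardo s f = kenergy (gkern s) f by [].
rewrite kenergyE//.
have h : (\int[mu]_z (Num.min 1 (enorm z ^+ 2) * (1 * gkern s z))%:E < +oo)%E.
  exact: (integral_levy hs (measurable_cst _) (fun=> ler01) (fun _ _ _ => erefl)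
    integral_one_eball).
have mm : measurable_fun setT (fun z : 'rV[R]_n => Num.min 1 (enorm z ^+ 2)).
  by apply: measurable_minr => //; apply: measurable_funX; exact: measurable_enorm.
have mm0 z : 0 <= Num.min 1 (enorm z ^+ 2) by rewrite le_min ler01 sqr_ge0.
have mmK : measurable_fun setT (fun z : 'rV[R]_n => (Num.min 1 (enorm z ^+ 2) * (1 * gkern s
  z))%:E).
  by apply/measurable_EFinP; do 2 apply: measurable_funM => //.
apply: (@le_lt_trans _ _
  (c%:E * \int[mu]_z (Num.min 1 (enorm z ^+ 2) * (1 * gkern s z))%:E)%E); last first.
  by rewrite lte_mul_pinfty// lee_fin.
rewrite -ge0_integralZl//; last first.
  by move=> z _; rewrite lee_fin mulr_ge0// mul1r.
apply: ge0_le_integral => //.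
- by move=> z _; rewrite mule_ge0 ?lee_fin// incr2_ge0.
- by apply: emeasurable_funM; [exact/measurable_EFinP|exact: measurable_incr2].
- exact: measurable_funeM.
move=> z _; rewrite mul1r -EFinM mulrA EFinM [leRHS]muleC lee_wpmul2l ?lee_fin//.
Qed.

End smooth_functions.

(** * Mollification *)

Section mollifier.
Context {R : realType} {n : nat}.
Implicit Types (e : R) (x y : 'rV[R]_n).

(** The standard bump, without normalisation: only the vanishing of convolutions matters, and the
    mass, proportional to e^n, is tracked separately. *)
Definition mollifier e x : R := flat 0 (1 - (e^-1 * enorm x) ^+ 2).

Lemma mollifier_ge0 e x : 0 <= mollifier e x. Proof. exact: flat_ge0. Qed.

Lemma mollifierN e x : mollifier e (- x) = mollifier e x.
Proof. by rewrite /mollifier enormN. Qed.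

Lemma mollifier_out e x : 0 < e -> ~ eball 0 e x -> mollifier e x = 0.
Proof.
move=> e0; rewrite eball0E => /negP; rewrite -ltNge => xe; apply: flat_le0.
rewrite subr_le0 expr_ge1// ?mulr_ge0 ?enorm_ge0 ?invr_ge0 ?(ltW e0)//.
by rewrite ler_pdivlMl// mulr1 ltW.
Qed.

Lemma Ccinf_mollifier e (x0 : 'rV[R]_n) (U : set 'rV[R]_n) : 0 < e -> eball x0 e `<=` U ->
  Ccinf U (fun y => mollifier e (x0 - y)).
Proof.
move=> e0 eU; apply: (@Ccinf_sub _ _ _ _ (eball x0 e)) => //.
- move=> k; rewrite (_ : (fun y => _) = flat 0 \o (fun y : 'rV[R]_n => 1 +
      - e^-1 ^+ 2 * \sum_(i < n) ((x0 ord0 i + -1 * y ord0 i) * (x0 ord0 i + -1 * y ord0 i)))).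
    apply: Ck_flat; apply: CkD; first exact: Ck_cst.
    apply: CkM; first exact: Ck_cst.
    apply: Ck_sum => i.
    have C : Ck k (fun y : 'rV[R]_n => x0 ord0 i + -1 * y ord0 i).
      apply: CkD; first exact: Ck_cst.
      by apply: CkM; [exact: Ck_cst|exact: Ck_coord].
    exact: CkM.
  apply/funext => y; rewrite /mollifier/= exprMn sqr_enorm mulNr; congr (flat _ (_ - _ * _)).
  by apply: eq_bigr => i _; rewrite !mxE mulN1r.
- exact: compact_eball.
- move=> y ny; apply: mollifier_out => //; apply: contra_not ny.
  by rewrite eball0E /eball /= enormB.
Qed.

End mollifier.

(** * Convolution with a test function *)

Section convolution.
Context {R : realType} {n : nat}.
Local Notation mu := (lebesgue_rV n).
Implicit Types (f g phi : 'rV[R]_n -> R) (U : set 'rV[R]_n) (x y z : 'rV[R]_n).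

Lemma lipschitz_continuous f (L : R) :
  (forall x z, `|f (x + z) - f x| <= L * enorm z) -> continuous f.
Proof.
move=> hL x A /nbhs_ballP[e /= e0 eA].
have L0 : 0 < `|L| + 1 by rewrite ltr_wpDl.
have [d d0 dr] := @enorm_ball _ _ x _ (divr_gt0 e0 L0).
apply/nbhs_ballP; exists d => // y /dr xy; apply: eA; rewrite /ball /= distrC.
have -> : y = x + (y - x) by rewrite addrC subrK.
apply: le_lt_trans (hL _ _) _; rewrite enormB.
apply: (@le_lt_trans _ _ ((`|L| + 1) * enorm (x - y))); last by rewrite -ltr_pdivlMl// mulrC.
rewrite ler_wpM2r ?enorm_ge0//; apply: le_trans (ler_norm L) _; by rewrite lerDl.
Qed.

Lemma quadratic_is_derive f x (v : 'rV[R]_n) (d L : R) :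
  (forall h : R, `|f (h *: v + x) - f x - h * d| <= L * h ^+ 2) -> is_derive x v f d.
Proof.
move=> hL; apply: is_deriveP; apply/cvgrPdist_lt => /= e e0.
have L0 : 0 < `|L| + 1 by rewrite ltr_wpDl.
near=> h; have h0 : h != 0 by near: h; exact: nbhs_dnbhs_neq.
have hp : 0 < `|h| by rewrite normr_gt0.
have -> : d - h^-1 *: (f (h *: v + x) - f x) = - (h^-1 * (f (h *: v + x) - f x - h * d)).
  have -> : h^-1 *: (f (h *: v + x) - f x) = h^-1 * (f (h *: v + x) - f x) by [].
  by field.
rewrite normrN normrM normfV ltr_pdivrMl//.
apply: le_lt_trans (hL h) _; rewrite -(real_normK (num_real h)) expr2 mulrCA ltr_pM2l//.
apply: (@le_lt_trans _ _ (`|h| * (`|L| + 1))).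
  by rewrite mulrC ler_wpM2l//; apply: le_trans (ler_norm L) _; rewrite lerDl.
rewrite -ltr_pdivlMr//; near: h; apply: dnbhs0_lt; exact: divr_gt0.
Unshelve. all: by end_near. Qed.

Definition convol g phi x : R := \int[mu]_y (g (x - y) * phi y).

Variable phi : 'rV[R]_n -> R.
Hypothesis iphi : mu.-integrable setT (EFin \o phi).

Let mphi : measurable_fun setT phi.
Proof. by apply/measurable_EFinP; case/integrableP: iphi. Qed.

Lemma convol_integrable g x (c : R) : measurable_fun setT g -> (forall y, `|g y| <= c) ->
  mu.-integrable setT (EFin \o (fun y => g (x - y) * phi y)).
Proof.
move=> mg gc; apply: (@le_integrable _ _ _ mu setT measurableT _ (fun y => (c * phi y)%:E)) => //.
- apply/measurable_EFinP; apply: measurable_funM => //; apply: measurableT_comp => //.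
  by apply: measurable_rVB => //; exact: measurable_id.
- move=> y _; rewrite /= lee_fin !normrM ler_wpM2r//.
  exact: le_trans (gc _) (ler_norm _).
- exact: (integrableZl measurableT c iphi).
Qed.

Lemma Rintegral_bound f (c : R) : mu.-integrable setT (EFin \o f) ->
  (forall y, `|f y| <= c * `|phi y|) ->
  `|\int[mu]_y f y| <= c * \int[mu]_y `|phi y|.
Proof.
move=> fi fc; apply: le_trans (le_normr_Rintegral _ fi) _ => //.
have iN := integrable_norm iphi.
rewrite -RintegralZl//; apply: le_Rintegral => //; first exact: integrable_norm.
exact: (integrableZl measurableT c iN).
Qed.

(** The second-order remainder of g is uniform, so its integral against |phi| is a quadratic
    remainder for the convolution. This shows at once that the derivative falls on g, without a
    limit under the integral sign. *)
Lemma Ck_convol U g k : Ccinf U g -> Ck k (convol g phi).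
Proof.
have Cint U' g' x : Ccinf U' g' -> mu.-integrable setT (EFin \o (fun y => g' (x - y) * phi y)).
  move=> Cg; have [c _ hc] := Ccinf_bounded Cg; apply: (convol_integrable _ _ hc).
  exact: continuous_measurable_rV (Ccinf_continuous Cg).
have iB f1 f2 : mu.-integrable setT (EFin \o f1) -> mu.-integrable setT (EFin \o f2) ->
    mu.-integrable setT (EFin \o (fun y => f1 y - f2 y)).
  by move=> i1 i2; exact: (integrableB measurableT i1 i2).
have cC g' : Ccinf U g' -> continuous (convol g' phi).
  move=> Cg; have [L L0 hL] := Ccinf_lipschitz Cg.
  apply: (@lipschitz_continuous _ (L * \int[mu]_y `|phi y|)) => x z.
  rewrite mulrAC /convol -RintegralB//; [|exact: Cint Cg|exact: Cint Cg].
  apply: Rintegral_bound => [|y]; first by apply: iB; exact: Cint Cg.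
  by rewrite -mulrBl normrM ler_wpM2r// addrAC.
elim: k g => [|k IH] g Cg; first exact: cC.
apply: (@CkS _ _ _ _ (fun i => convol (partial i g) phi)) => [|i x|i].
- exact: cC.
- have [L L0 hL] := Ccinf_taylor i Cg; have Cg' := Ccinf_partial i Cg.
  apply: (@quadratic_is_derive _ _ _ _ (L * \int[mu]_y `|phi y|)) => h.
  rewrite mulrAC /convol -RintegralZl//; last exact: Cint Cg'.
  have hi : mu.-integrable setT (EFin \o (fun y => h * (partial i g (x - y) * phi y))).
    exact: (integrableZl measurableT h (Cint _ _ x Cg')).
  rewrite -!RintegralB//; first last.
  + exact: Cint Cg.
  + exact: Cint Cg.
  + by apply: iB; exact: Cint Cg.
  apply: Rintegral_bound => [|y]; first by apply: (iB _ _ _ hi); apply: iB; exact: Cint Cg.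
  have := hL (x - y) h; rewrite addrA => hy.
  rewrite mulrA -!mulrBl normrM ler_wpM2r//.
- exact: IH (Ccinf_partial i Cg).
Qed.

End convolution.

Section mollification.
Context {R : realType} {n : nat}.
Local Notation mu := (lebesgue_rV n).
Implicit Types (g phi : 'rV[R]_n -> R) (U : set 'rV[R]_n) (x y z : 'rV[R]_n) (e : R).

Lemma mollifier_le1 e x : mollifier e x <= 1.
Proof. by apply: le_trans (flat_le _ _) _; rewrite fact0. Qed.

Lemma Ccinf_mollifierT e : 0 < e -> Ccinf setT (@mollifier R n e).
Proof.
move=> e0; rewrite (_ : mollifier e = fun y => mollifier e (0 - y)); first exact: Ccinf_mollifier.
by apply/funext => y; rewrite sub0r mollifierN.
Qed.

Lemma measurable_mollifier e : 0 < e -> measurable_fun setT (@mollifier R n e).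
Proof.
by move=> e0; exact: continuous_measurable_rV (Ccinf_continuous (Ccinf_mollifierT e0)).
Qed.

Lemma convol_eq0 g phi x : (forall y, phi y <> 0 -> g (x - y) = 0) ->
  convol g phi x = 0.
Proof.
move=> h; rewrite /convol /Rintegral integral0_eq// => y _; congr EFin.
have [->|/eqP/h ->] := eqVneq (phi y) 0; by rewrite ?mulr0 ?mul0r.
Qed.

Lemma convol_mollifier_Ccinf e phi (N : R) : 0 < e -> mu.-integrable setT (EFin \o phi) ->
  (forall x, ~ eball 0 N x -> phi x = 0) -> Ccinf setT (convol (mollifier e) phi).
Proof.
move=> e0 iphi hN; apply: (@Ccinf_sub _ _ _ _ (eball 0 (e + N))) => //.
- by move=> k; apply: Ck_convol => //; exact: Ccinf_mollifierT.
- exact: compact_eball.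
- move=> x; rewrite eball0E => /negP; rewrite -ltNge => xN.
  apply: convol_eq0 => y phiy.
  have yN : eball 0 N y by apply: contrapT => /hN.
  rewrite mollifier_out//; apply/negP; rewrite subr0 -ltNge.
  rewrite eball0E in yN; have := enorm_sub_le x y; lra.
Qed.

Lemma integral_mollifier e x : 0 < e ->
  (\int[mu]_y (mollifier e (x - y))%:E = (e ^+ n)%:E * \int[mu]_y (mollifier 1 y)%:E)%E.
Proof.
move=> e0; have en0 : - e^-1 != 0 by rewrite oppr_eq0 invr_eq0 gt_eqF.
have m1 := measurable_mollifier (@ltr01 R).
have := integral_rV_affine (e^-1 *: x) en0 (f := fun y => (mollifier 1 y)%:E).
rewrite normrN gtr0_norm ?invr_gt0// exprVn invrK => <-.
- apply: eq_integral => y _; rewrite /mollifier invr1 mul1r.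
  rewrite (_ : - e^-1 *: y + e^-1 *: x = e^-1 *: (x - y)).
    by rewrite enormZ gtr0_norm ?invr_gt0.
  by rewrite scalerBr scaleNr addrC.
- exact/measurable_EFinP.
- by move=> y; rewrite lee_fin mollifier_ge0.
Qed.

Lemma integral_mollifier1_gt0 : exists2 b : R, 0 < b & (\int[mu]_y (mollifier 1 (y :
  'rV[R]_n))%:E = b%:E)%E.
Proof.
have m1 := measurable_mollifier (@ltr01 R).
have fin : (\int[mu]_y (mollifier 1 (y : 'rV[R]_n))%:E < +oo)%E.
  apply: (@le_lt_trans _ _ (mu (eball 0 1))); last exact: lebesgue_rV_eball_lty.
  have -> : mu (eball 0 1) = (\int[mu]_x (\1_(eball 0 1) x : R)%:E)%E.
    by rewrite integral_indic ?setIT//; exact: measurable_eball.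
  apply: ge0_le_integral => //.
  - by move=> x _; rewrite lee_fin mollifier_ge0.
  - exact/measurable_EFinP.
  - by apply/measurable_EFinP; apply: measurable_indic; exact: measurable_eball.
  move=> x _; rewrite lee_fin indicE; case: (pselect (eball 0 1 x)) => hx.
    by rewrite mem_set// mollifier_le1.
  by rewrite mollifier_out.
have ge : (0 <= \int[mu]_y (mollifier 1 (y : 'rV[R]_n))%:E)%E.
  by apply: integral_ge0 => y _; rewrite lee_fin mollifier_ge0.
exists (fine (\int[mu]_y (mollifier 1 (y : 'rV[R]_n))%:E)%E); last by rewrite fineK// ge0_fin_numE.
rewrite fine_gt0// fin andbT.
have h2 : 0 < 2^-1 :> R by rewrite invr_gt0.
pose c : R := flat 0 (3 / 4); have c0 : 0 < c by apply: flat_gt0; lra.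
apply: (@lt_le_trans _ _ (c%:E * mu (eball 0 2^-1))%E).
  by apply: mule_gt0; [rewrite lte_fin|exact: lebesgue_rV_eball_gt0].
rewrite -integral_cst; last exact: measurable_eball.
apply: (@le_trans _ _ (\int[mu]_(y in eball 0 2^-1) (mollifier 1 (y : 'rV[R]_n))%:E)%E).
  apply: ge0_le_integral => //.
  - exact: measurable_eball.
  - by move=> y _; rewrite lee_fin ltW.
  - by apply/measurable_EFinP; exact: measurable_funTS.
  move=> y; rewrite eball0E => y2; rewrite lee_fin /mollifier invr1 mul1r.
  have t1 : 3 / 4 <= 1 - enorm y ^+ 2.
    suff : enorm y ^+ 2 <= 2^-1 ^+ 2 by lra.
    by rewrite ler_sqr ?nnegrE ?enorm_ge0// ltW.
  have t0 : 0 < 1 - enorm y ^+ 2 by apply: lt_le_trans t1; lra.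
  rewrite /c /flat t0 ifT; last lra.
  by rewrite !expr0 !mul1r ler_expR lerN2 lef_pV2// posrE; lra.
apply: ge0_subset_integral => //; first exact: measurable_eball.
- by apply/measurable_EFinP.
- by move=> y _; rewrite lee_fin mollifier_ge0.
Qed.

(* If the mollification of phi vanishes at x, then expanding the square shows
   that phi(x)^2 is at most the weighted mean of (phi(x) - phi(y))^2. *)
Lemma sqr_le_mollified (s : R) : 0 < s -> exists2 c, 0 < c &
  forall phi x e, mu.-integrable setT (EFin \o phi) -> 0 < e ->
  convol (mollifier e) phi x = 0 ->
  ((phi x ^+ 2)%:E <= (c * e `^ (2 * s))%:E *
     \int[mu]_y ((phi x - phi y) ^+ 2 * gkern s (x - y))%:E)%E.
Proof.
move=> s0; have [b b0 hb] := integral_mollifier1_gt0; exists b^-1; first by rewrite invr_gt0.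
move=> phi x e iphi e0 h0.
have mphi : measurable_fun setT phi by apply/measurable_EFinP; case/integrableP: iphi.
pose q y := (phi x - phi y) ^+ 2 * gkern s (x - y).
have q0 y : 0 <= q y by rewrite mulr_ge0 ?sqr_ge0 ?gkern_ge0.
have mxB : measurable_fun setT (fun y : 'rV[R]_n => x - y).
  by apply: measurable_rVB => //; exact: measurable_id.
have mq : measurable_fun setT q.
  apply: measurable_funM; first by apply: measurable_funX; exact: measurable_funB.
  by apply: measurableT_comp => //; exact: measurable_gkern.
have ce0 : 0 < b^-1 * e `^ (2 * s) by rewrite mulr_gt0 ?invr_gt0 ?powR_gt0.
have H0 : (0 <= \int[mu]_y (q y)%:E)%E by apply: integral_ge0 => y _; rewrite lee_fin.
have [Hfin|] := boolP ((\int[mu]_y (q y)%:E) < +oo)%E; last first.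
  by rewrite -leNgt leye_eq => /eqP ->; rewrite gt0_muley ?lte_fin// leey.
have iq : mu.-integrable setT (EFin \o q).
  apply/integrableP; split; first exact/measurable_EFinP.
  by under eq_integral do rewrite gee0_abs ?lee_fin//.
pose t (y : 'rV[R]_n) := mollifier e (x - y).
have t0 y : 0 <= t y by exact: mollifier_ge0.
have mt : measurable_fun setT t by apply: measurableT_comp => //; exact: measurable_mollifier.
have It : (\int[mu]_y (t y)%:E = (e ^+ n * b)%:E)%E by rewrite integral_mollifier// hb.
have it : mu.-integrable setT (EFin \o t).
  apply/integrableP; split; first exact/measurable_EFinP.
  under eq_integral do rewrite gee0_abs ?lee_fin//.
  by rewrite It ltry.
have itphi : mu.-integrable setT (EFin \o (fun y => t y * phi y)).
  apply: (@convol_integrable _ _ _ iphi _ _ 1); first exact: measurable_mollifier.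
  by move=> y; rewrite ger0_norm ?mollifier_ge0// mollifier_le1.
(* f equals t ((phi x - phi y)^2 - phi(y)^2), and the cross term integrates to 0 by the assumption
   on the convolution. *)
pose f y := phi x ^+ 2 * t y - 2 * phi x * (t y * phi y).
have if1 := integrableZl measurableT (phi x ^+ 2) it.
have if2 := integrableZl measurableT (2 * phi x) itphi.
have If : \int[mu]_y f y = phi x ^+ 2 * (e ^+ n * b).
  rewrite /f RintegralB// !RintegralZl//.
  rewrite (_ : \int[mu]_y (t y * phi y) = 0)// mulr0 subr0; congr (_ * _).
  by rewrite /Rintegral It.
pose p := n%:R + 2 * s.
(* Where the mollifier is nonzero |x - y| <= e, so 1 <= e^p [gkern]. Dividing by its mass, of order
   e^n, leaves e^(2s). *)
have fq y : f y <= e `^ p * q y.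
  apply: (@le_trans _ _ (t y * (phi x - phi y) ^+ 2)).
    rewrite /f -subr_ge0 (_ : _ - _ = t y * phi y ^+ 2); last ring.
    by rewrite mulr_ge0 ?sqr_ge0.
  rewrite [leLHS]mulrC [leRHS]mulrCA; have [<-|xy] := eqVneq x y;
    first by rewrite subrr expr0n !mul0r.
  rewrite ler_wpM2l ?sqr_ge0//.
  have [xye|nxy] := pselect (eball 0 e (x - y)); last first.
    by rewrite /t mollifier_out// mulr_ge0 ?powR_ge0 ?gkern_ge0.
  have d0 : 0 < enorm (x - y) by rewrite enorm_gt0 subr_eq0.
  rewrite eball0E in xye; apply: le_trans (mollifier_le1 _ _) _.
  rewrite /gkern ler_pdivlMr ?powR_gt0// mul1r.
  apply: ge0_ler_powR; [|exact: enorm_ge0|exact: ltW|exact: xye].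
  by rewrite addr_ge0// mulr_ge0// ltW.
have iepq := integrableZl measurableT (e `^ p) iq.
have : \int[mu]_y f y <= \int[mu]_y (e `^ p * q y).
  apply: le_Rintegral => //; exact: (integrableB measurableT if1 if2).
rewrite If RintegralZl//.
have -> : (\int[mu]_y (q y)%:E = (\int[mu]_y q y)%:E)%E.
  by rewrite /Rintegral fineK// ge0_fin_numE.
rewrite -EFinM lee_fin /p powRD; last by rewrite (gt_eqF e0) implybT.
rewrite powR_mulrn ?(ltW e0)// => h; rewrite -mulrA ler_pdivlMl//.
rewrite -(ler_pM2l (exprn_gt0 n e0)) [leRHS]mulrA; apply: le_trans h.
by rewrite le_eqVlt; apply/orP; left; apply/eqP; ring.
Qed.

Variable s : R.
Hypothesis s0 : 0 < s.

Lemma ae_slice_energy phi : Hs s phi ->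
  {ae mu, forall x, (\int[mu]_y ((phi x - phi y) ^+ 2 * gkern s (x - y))%:E < +oo)%E}.
Proof.
move=> Hphi; have mphi := Hs_measurable Hphi; have [_ gfin] := Hphi.
pose F (z : 'rV[R]_n * 'rV[R]_n) := (((phi z.1 - phi z.2) ^+ 2 * gkern s (z.1 - z.2))%:E).
have mF : measurable_fun setT F.
  apply/measurable_EFinP; apply: measurable_funM; last by apply: measurable_kernel_diff;
    exact: measurable_gkern.
  by apply: measurable_funX; exact: measurable_diff2.
have F0 (z : 'rV[R]_n * 'rV[R]_n) : (0 <= F z)%E by rewrite lee_fin mulr_ge0 ?sqr_ge0 ?gkern_ge0.
have iF : (mu \x mu)%E.-integrable setT F.
  apply/integrableP; split => //; apply: le_lt_trans gfin.
  by apply: ge0_le_integral => //; [exact: measurableT_comp|move=> z _; rewrite gee0_abs].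
have := ae_integrable1 iF; apply: filterS => x /(integrable_lty measurableT).
by apply.
Qed.

(* The bound of [sqr_le_mollified] is O(e^{2s}) at each point where the slice of
   the energy is finite, hence at almost every point. *)
Lemma ae_mollified_eq0 (A : set 'rV[R]_n) phi : Hs s phi ->
  mu.-integrable setT (EFin \o phi) ->
  (forall x, A x -> exists2 r, 0 < r & forall e, 0 < e -> e < r ->
     convol (mollifier e) phi x = 0) ->
  {ae mu, forall x, A x -> phi x = 0}.
Proof.
move=> Hphi iphi hA; have := ae_slice_energy Hphi; apply: filterS => x.
set H := (\int[mu]_y _)%E => Hfin /hA[r r0 hr].
have [c c0 hc] := sqr_le_mollified s0.
have H0 : (0 <= H)%E.
  by apply: integral_ge0 => y _; rewrite lee_fin mulr_ge0 ?sqr_ge0 ?gkern_ge0.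
pose h := fine H; have h0 : 0 <= h by exact: fine_ge0.
have HE : H = h%:E by rewrite /h fineK// ge0_fin_numE.
have bd e : 0 < e -> e < r -> phi x ^+ 2 <= c * h * e `^ (2 * s).
  move=> e0 er; have := hc _ _ _ iphi e0 (hr _ e0 er).
  by rewrite -/H HE -EFinM lee_fin mulrAC.
apply/eqP; rewrite -sqrf_eq0 eq_le sqr_ge0 andbT; apply/ler_addgt0Pr => d d0.
rewrite add0r; have k0 : 0 < c * h + 1 by rewrite ltr_wpDl// mulr_ge0// ltW.
have s20 : 0 < 2 * s by rewrite mulr_gt0.
pose e := Num.min (r / 2) ((d / (c * h + 1)) `^ (2 * s)^-1).
have e0 : 0 < e by rewrite lt_min divr_gt0// powR_gt0// divr_gt0.
have er : e < r by rewrite gt_min ltr_pdivrMr// mulr_natr mulr2n ltrDl r0.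
apply: le_trans (bd e e0 er) _.
apply: (@le_trans _ _ ((c * h + 1) * (d / (c * h + 1)))).
  apply: ler_pM; rewrite ?powR_ge0 ?mulr_ge0 ?(ltW c0) ?lerDl//.
  have -> : d / (c * h + 1) = ((d / (c * h + 1)) `^ (2 * s)^-1) `^ (2 * s).
    by rewrite -powRrM mulVf ?gt_eqF// powRr1// ltW// divr_gt0.
  by apply: ge0_ler_powR; rewrite ?nnegrE ?powR_ge0 ?(ltW e0) ?(ltW s20)// ge_min lexx orbT.
by rewrite mulrC divfK// gt_eqF.
Qed.



End mollification.

(** * The Dirichlet form *)

Section tilde_space.
Context {R : realType} {n : nat}.
Variables (s : R) (Omega : set 'rV[R]_n).
Hypothesis hs : 0 < s < 1.
Hypothesis Omega_open : open Omega.
Local Notation mu := (lebesgue_rV n).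
Local Notation HS := (@Hs R n s : set ('rV[R]_n -> R)).
Local Notation V := (@tHs R n s Omega : set ('rV[R]_n -> R)).
Implicit Types (u v w phi : 'rV[R]_n -> R).

Lemma Hs_norm_lt u (e : R) : Hs s u -> 0 < e -> (Hs_norm s u < e) = (Hs_ip s u u < e ^+ 2).
Proof.
move=> Hu e0; rewrite Hs_normE//.
have eE : e = Num.sqrt (e ^+ 2) by rewrite sqrtr_sqr gtr0_norm.
by rewrite {1}eE ltr_sqrt// exprn_gt0.
Qed.

Lemma tHsP u : tHs s Omega u <-> Hs s u /\ forall e, 0 < e ->
  exists2 phi, Ccinf Omega phi & Hs_ip s (u - phi) (u - phi) < e.
Proof.
split=> -[Hu hu]; split=> // e e0.
  have se0 : 0 < Num.sqrt e by rewrite sqrtr_gt0.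
  have [phi Cphi] := hu _ se0.
  rewrite Hs_norm_lt//; last exact: subspaceB (Hs_subspace s) Hu (Ccinf_Hs hs Cphi).
  by rewrite sqr_sqrtr ?ltW// => h; exists phi.
have [phi Cphi h] := hu _ (exprn_gt0 2 e0); exists phi => //.
by rewrite Hs_norm_lt//; exact: subspaceB (Hs_subspace s) Hu (Ccinf_Hs hs Cphi).
Qed.

Lemma tHs_Hs u : tHs s Omega u -> Hs s u. Proof. by case. Qed.

Lemma Ccinf_tHs u : Ccinf Omega u -> tHs s Omega u.
Proof.
move=> Cu; apply/tHsP; split; first exact: Ccinf_Hs Cu.
move=> e e0; exists u => //; have Hu := Ccinf_Hs hs Cu.
by rewrite (sipBB (Hs_subspace s) (@Hs_semi_inner_product R n s))//; lra.
Qed.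

Let ipV := @Hs_semi_inner_product R n s.
Let sH := @Hs_subspace R n s.

Lemma tHs_of_close w : Hs s w ->
  (forall e, 0 < e -> exists2 u, tHs s Omega u & Hs_ip s (w - u) (w - u) < e) ->
  tHs s Omega w.
Proof.
move=> Hw hw; apply/tHsP; split => // e e0; have e4 : 0 < e / 4 by lra.
have [u Vu wu] := hw _ e4; have [Hu /(_ _ e4)[phi Cphi uphi]] := (tHsP u).1 Vu.
exists phi => //; have Hphi := Ccinf_Hs hs Cphi.
have := sip_quasi_triangle sH ipV Hw Hu Hphi; lra.
Qed.

Lemma tHs_subspace : lin_subspace V.
Proof.
split.
  exact: Ccinf_tHs (Ccinf_subspace _).1.
move=> c u v /tHsP[Hu hu] /tHsP[Hv hv]; apply: tHs_of_close.
  exact: sH.2.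
move=> e e0; have c0 : 0 < c ^+ 2 + 1 by rewrite ltr_wpDl ?sqr_ge0.
have e1 : 0 < e / 4 / (c ^+ 2 + 1) by rewrite !divr_gt0.
have e4 : 0 < e / 4 by rewrite divr_gt0.
have [phi Cphi uphi] := hu _ e1; have [psi Cpsi vpsi] := hv _ e4.
exists (c *: phi + psi); first by apply: Ccinf_tHs; exact: (Ccinf_subspace _).2.
have Hphi := Ccinf_Hs hs Cphi; have Hpsi := Ccinf_Hs hs Cpsi.
have Hu' := subspaceB sH Hu Hphi; have Hv' := subspaceB sH Hv Hpsi.
have := sip_quasi_triangle sH ipV (sH.2 c _ _ Hu Hv) (sH.2 c _ _ Hphi Hv) (sH.2 c _ _ Hphi Hpsi).
have -> : c *: u + v - (c *: phi + v) = c *: (u - phi) by rewrite scalerBr opprD addrACA subrr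
  addr0.
have -> : c *: phi + v - (c *: phi + psi) = v - psi by rewrite opprD addrACA subrr add0r.
have [sym lin ip0] := ipV.
have -> : Hs_ip s (c *: (u - phi)) (c *: (u - phi)) = c ^+ 2 * Hs_ip s (u - phi) (u - phi).
  have Zl (x y : 'rV[R]_n -> R) : Hs s x -> Hs s y -> Hs_ip s (c *: x) y = c * Hs_ip s x y.
    move=> Hx Hy; have H0 := sH.1.
    rewrite -[c *: x]addr0 (lin _ Hy c x 0)//.
    by have := lin _ Hy (-1) 0 0 H0 H0; rewrite scaler0 addr0 => ?; lra.
  have Hcu := subspaceZ c sH Hu'.
  by rewrite (Zl _ _ Hu' Hcu) (sym _ _ Hu' Hcu) (Zl _ _ Hu' Hu') expr2 mulrA.
have := ip0 _ Hu'; move: uphi vpsi; rewrite ltr_pdivlMr//.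
move: (Hs_ip s (u - phi) _) (Hs_ip s (v - psi) _) (c ^+ 2) c0 => x y d d0.
nra.
Qed.

Lemma tHs_ae u v : tHs s Omega u -> measurable_fun setT v -> u = v %[ae mu] ->
  tHs s Omega v.
Proof.
move=> Vu mv uv; have Hu := tHs_Hs Vu; have Hv := Hs_ae Hu mv uv.
apply: tHs_of_close => // e e0; exists u => //.
have mB : measurable_fun setT (v - u : 'rV[R]_n -> R).
  by apply: measurable_funB => //; exact: Hs_measurable Hu.
have vu0 : v - u = cst 0 %[ae mu].
  by apply: filterS uv => x /(_ I) /= xE _; rewrite !fctE xE subrr.
by have [_ ->] := @Hs_ip_ae0 R n s _ mB vu0.
Qed.

Lemma tHs_complete : sip_complete V (Hs_ip s).
Proof.
move=> U VU cU; have [g Hg hg] := Hs_complete (fun k => tHs_Hs (VU k)) cU.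
exists g => //; apply: tHs_of_close => // e e0; have [M hM] := hg _ e0.
exists (U M) => //; have := hM M (leqnn M); have HU := tHs_Hs (VU M).
rewrite !(sipBB sH ipV)// [Hs_ip s g (U M)](let: And3 sym _ _ := ipV in sym)//; lra.
Qed.

Lemma Ccinf_out (phi : 'rV[R]_n -> R) x : Ccinf Omega phi -> ~ Omega x -> phi x = 0.
Proof. by move=> [_ _ sO] nx; apply: supp_out; apply: contra_not nx => /sO. Qed.

(** Test functions vanish outside [Omega], so the L^2 norm of u there is at most the distance from u
    to any of them, which is arbitrarily small. *)
Lemma tHs_supp u : tHs s Omega u -> {ae mu, forall x, ~ Omega x -> u x = 0}.
Proof.
move=> Vu; have Hu := tHs_Hs Vu; have mu_ := Hs_measurable Hu.
pose uc : 'rV[R]_n -> R := u \_ (~` Omega).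
have mO : measurable (~` Omega) by apply: measurableC; exact: open_measurable_rV.
have muc : measurable_fun setT uc.
  by apply/(measurable_restrictT _ _).1 => //; exact: measurable_funTS.
have s0 : sqn mu uc = 0%E.
  apply/eqP; rewrite eq_le sqn_ge0 andbT; apply/lee_addgt0Pr => e e0; rewrite add0e.
  have [_ /(_ _ e0)[phi Cphi hphi]] := (tHsP u).1 Vu.
  have Hphi := Ccinf_Hs hs Cphi; have Hd := subspaceB sH Hu Hphi.
  have [d1 d2] := (HsP s _).1 Hd.
  apply: (@le_trans _ _ (sqn mu (u - phi))); last first.
    rewrite -ip_sqn// lee_fin; apply: le_trans (ltW hphi).
    by rewrite lerDl ip_ge0.
  apply: ge0_le_integral => //.
  - by move=> x _; rewrite lee_fin sqr_ge0.
  - exact: measurable_sqr.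
  - by apply: measurable_sqr; case: d1.
  move=> x _; rewrite lee_fin /uc patchE; case: ifPn => [/set_mem nx|_].
    by rewrite !fctE (Ccinf_out Cphi nx) subr0.
  by rewrite expr0n sqr_ge0.
have : (\int[mu]_x `|(uc x ^+ 2)%:E| = 0)%E.
  by rewrite -[RHS]s0; apply: eq_integral => x _; rewrite gee0_abs// lee_fin sqr_ge0.
move/(ae_eq_integral_abs mu measurableT (measurable_sqr muc)).
apply: filterS => x /(_ I) /= [/eqP]; rewrite sqrf_eq0 => /eqP + nx.
by rewrite /uc patchE mem_set.
Qed.

End tilde_space.

(** * The form on the whole space: boundedness, coercivity up to finite rank, density criterion *)

Section bilinear_form.
Context {R : realType} {n : nat}.
Local Notation mu := (lebesgue_rV n).
Local Notation mu2 := (mu \x mu)%E.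
Variables (s : R) (a : 'rV[R]_n -> R) (C Omega : set 'rV[R]_n) (q : 'rV[R]_n -> R).
Hypothesis hs : 0 < s < 1.
Hypothesis Omega_open : open Omega.
Hypothesis Omega_bounded : bounded_set Omega.
Hypothesis hq : (q \_ Omega) \in Lfun mu +oo%E.
Hypothesis hA1 : condA1 s a.
Hypothesis hA2 : condA2 a.
Hypothesis hA3 : condA3 a C.
Implicit Types (u v w phi f g : 'rV[R]_n -> R).
Local Notation K := (kern s a).
Local Notation qO := (q \_ Omega).

Let mK := measurable_kern hs hA1.
Let K0 := kern_ge0 hs hA2.
Let sH := @Hs_subspace R n s.
Let ipV := @Hs_semi_inner_product R n s.
Local Notation V := (@tHs R n s Omega : set ('rV[R]_n -> R)).

Let mqO : measurable_fun setT qO.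
Proof. by move/sub_Lfun_mfun : hq; rewrite inE. Qed.

Lemma potential_bounded : exists2 Q : R, 0 <= Q & {ae mu, forall x, `|qO x| <= Q}.
Proof.
have := hq; rewrite inE => /andP[_]; rewrite inE /= /finite_norm unlock /Lnorm.
(* The norm of exponent +oo is an essential supremum only when the space has positive measure. *)
have -> : (0 < mu [set: 'rV[R]_n])%E.
  apply: lt_le_trans (lebesgue_rV_eball_gt0 (0 : 'rV[R]_n) ltr01) _.
  by apply: le_measure; rewrite ?inE//; exact: measurable_eball.
rewrite ess_supEae => /ereal_inf_lt[y /= hy yoo].
exists (`|fine y|) => //; apply: filterS hy => x /=.
by case: y yoo => //= r _; rewrite lee_fin => /le_trans; apply; exact: ler_norm.
Qed.

Lemma sqint_potential u : sqint mu u -> sqint mu (fun x => qO x * u x).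
Proof.
move=> [mu_ uf]; have [Q Q0 hQ] := potential_bounded.
have mqu : measurable_fun setT (fun x => qO x * u x) by exact: measurable_funM.
split => //; apply: (@le_lt_trans _ _ ((Q ^+ 2)%:E * sqn mu u)%E).
  rewrite -ge0_integralZl//; first last.
  - by rewrite lee_fin sqr_ge0.
  - by move=> x _; rewrite lee_fin sqr_ge0.
  - exact: measurable_sqr.
  apply: ae_ge0_le_integral => //.
  - by move=> x _; rewrite lee_fin sqr_ge0.
  - exact: measurable_sqr.
  - by move=> x _; rewrite mule_ge0// lee_fin sqr_ge0.
  - by apply: measurable_funeM; exact: measurable_sqr.
  apply: filterS hQ => x hx _; rewrite -EFinM lee_fin exprMn ler_wpM2r ?sqr_ge0//.
  by rewrite -(real_normK (num_real (qO x))) ler_sqr ?nnegrE.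
by rewrite lte_mul_pinfty// lee_fin sqr_ge0.
Qed.

Lemma Hs_sqint u : Hs s u -> sqint mu u. Proof. by move=> /HsP[]. Qed.

(** The upper half of the energy comparison: it makes the form finite on all of H^s although [a] may
    be unbounded. *)
Lemma Hs_kern u : Hs s u -> sqint mu2 (nlgrad K u).
Proof.
move=> Hu; have mu_ := Hs_measurable Hu; apply: sqint_nlgrad => //.
have [k k0 /(_ _ mu_)[_ hk]] := kenergy_gagliardo hs hA1 hA2 hA3.
apply: le_lt_trans hk _; case: Hu => _ gu.
by rewrite lte_mul_pinfty// lee_fin ltW.
Qed.

(* The form B_q of the whole space; it coincides with [Bq] when one argument
   vanishes outside Omega. *)
Definition energy_form u v : R :=
  2^-1 * ip mu2 (nlgrad K u) (nlgrad K v) + ip mu (fun x => qO x * u x) v.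

Lemma energy_formC u v : energy_form u v = energy_form v u.
Proof.
rewrite /energy_form ipC; congr (_ + _).
by apply: eq_Rintegral => x _; rewrite -!mulrA [u x * _]mulrC.
Qed.

Lemma energy_form_linear w : Hs s w -> linear_on (@Hs R n s : set ('rV[R]_n -> R)) (energy_form^~
  w).
Proof.
move=> Hw c u v Hu Hv; rewrite /energy_form nlgradD ip_linear//; try exact: Hs_kern.
have -> : (fun x => qO x * (c *: u + v) x) = (fun x => c * (qO x * u x) + qO x * v x).
  by apply/funext => x; rewrite !fctE /GRing.scale/=; ring.
rewrite ip_linear; [ring|exact/sqint_potential/Hs_sqint..|exact: Hs_sqint].
Qed.

(* Garding's inequality: the fractional Poincare inequality absorbs the
   potential up to finitely many averages. *)
Lemma energy_form_garding : exists m (p : 'I_m -> ('rV[R]_n -> R) -> R) (k0 k1 k2 : R),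
  [/\ 0 < k0,
    forall i, linear_on (@Hs R n s : set ('rV[R]_n -> R)) (p i),
    forall i v, Hs s v -> p i v ^+ 2 <= k1 * Hs_ip s v v,
    forall v, tHs s Omega v -> k0 * Hs_ip s v v <= energy_form v v + \sum_i p i v ^+ 2 &
    forall v, Hs s v -> energy_form v v <= k2 * Hs_ip s v v].
Proof.
have [Q Q0 hQ] := potential_bounded.
have [k kp hk] := kenergy_gagliardo hs hA1 hA2 hA3.
have Q1 : 0 < Q + 1 by rewrite ltr_wpDl.
(* The form controls g / (2k), where g is the Gagliardo energy, minus Q times the squared L^2 norm.
   Applying the Poincare inequality with weight Q + 1 costs g / (4k) for this e, so that g / (4k)
   and one full squared L^2 norm are left. *)
pose e := (4 * k * (Q + 1))^-1; have e0 : 0 < e by rewrite invr_gt0 !mulr_gt0.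
have [I [S [M [M0 mS hp]]]] := fractional_poincare hs Omega_bounded e0.
(* The squares of the [p i] then add up to (Q + 1) M times the sum in the Poincare inequality. *)
pose c := Num.sqrt ((Q + 1) * M).
have c2 : c ^+ 2 = (Q + 1) * M by rewrite sqr_sqrtr// mulr_ge0// ltW.
pose p (i : 'I_#|I|) v := c * ip mu \1_(S (enum_val i)) v.
have sS i : sqint mu (\1_(S i) : 'rV[R]_n -> R) by case: (mS i) => *; exact: sqint_indic.
have qb v : Hs s v -> `|ip mu (fun x => qO x * v x) v| <= Q * ip mu v v.
  move=> Hv; have sv := Hs_sqint Hv; have sqv := sqint_potential sv.
  have h1 := sqint_mul sqv sv; have [mv _] := sv; have [mqv _] := sqv.
  rewrite -lee_fin EFinM ip_sqn//.
  have -> : (`|ip mu (fun x => qO x * v x) v|%:E = `|\int[mu]_x (qO x * v x * v x)%:E|)%E.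
    by rewrite -abse_EFin fineK//; exact: integrable_fin_num h1.
  apply: le_trans (le_abse_integral mu measurableT _) _.
    by apply/measurable_EFinP; exact: measurable_funM.
  rewrite /sqn -ge0_integralZl//; first last.
  - by move=> x _; rewrite lee_fin sqr_ge0.
  - exact: measurable_sqr.
  apply: ae_ge0_le_integral => //.
  - by apply: measurableT_comp => //; apply/measurable_EFinP; exact: measurable_funM.
  - by move=> x _; rewrite mule_ge0// lee_fin sqr_ge0.
  - by apply: measurable_funeM; exact: measurable_sqr.
  apply: filterS hQ => x hx _; rewrite -EFinM lee_fin -mulrA normrM -expr2.
  by rewrite [`|_ ^+ 2|]ger0_norm ?sqr_ge0// ler_wpM2r ?sqr_ge0.
exists #|I|, p, (Num.min 1 (4 * k)^-1), (c ^+ 2 * \sum_i fine (mu (S i))), (k / 2 + Q).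
pose G v := ip mu2 (nlgrad K v) (nlgrad K v).
have iE v : Hs s v -> exists g : R,
    [/\ 0 <= g, Hs_ip s v v = ip mu v v + g, kenergy (gkern s) v = g%:E,
       g <= k * G v & G v <= k * g].
  move=> Hv; have [sv sg] := (HsP s v).1 Hv; have [mv _] := sv; have sk := Hs_kern Hv.
  exists (ip mu2 (nlgrad (gkern s) v) (nlgrad (gkern s) v)).
  have [] := hk _ mv; rewrite [gagliardo s v](_ : _ = kenergy (gkern s) v)//.
  rewrite !kenergy_sqn//; last exact: gkern_ge0.
  by rewrite -!ip_sqn// -!EFinM !lee_fin => h1 h2; split => //; rewrite ?ip_ge0.
have pS v : \sum_i p i v ^+ 2 = c ^+ 2 * \sum_i ip mu \1_(S i) v ^+ 2.
  rewrite mulr_sumr [RHS]big_enum_val; apply: eq_bigr => i _.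
  by rewrite /p exprMn.
split=> [||i v Hv|v Vv|v Hv].
- by rewrite lt_min ltr01 invr_gt0 mulr_gt0.
- move=> i u v w Hv Hw; rewrite /p ![ip mu \1_(S _) _]ipC.
  have Ew : (u *: v + w) = (fun x => u * v x + w x) by [].
  by rewrite Ew ip_linear; [ring|exact: Hs_sqint|exact: Hs_sqint|exact: sS].
- rewrite [p i v]/p exprMn -[leRHS]mulrA; apply: ler_wpM2l; first exact: sqr_ge0.
  have sv := Hs_sqint Hv.
  apply: le_trans (ip_CauchySchwarz (sS _) sv) _.
  have h0 x : 0 <= fine (mu (S x)) by apply: fine_ge0; exact: measure_ge0.
  apply: ler_pM; rewrite ?ip_ge0//.
    case: (mS (enum_val i)) => m1 m2.
    have -> : ip mu \1_(S (enum_val i)) \1_(S (enum_val i)) = fine (mu (S (enum_val i))).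
      by rewrite -(ip_indic m1 m2).
    by rewrite (bigD1 (enum_val i))//= lerDl sumr_ge0.
  by have [g [g0 -> _ _ _]] := iE _ Hv; rewrite lerDl.
- have Hv := tHs_Hs Vv; have [g [g0 -> eg gG Gg]] := iE _ Hv.
  have := hp v (Hs_sqint Hv) (tHs_supp hs Omega_open Vv).
  rewrite eg -(ip_sqn (Hs_sqint Hv)) -EFinM -EFinD lee_fin => hpv.
  have := qb v Hv; rewrite ler_norml => /andP[hq1 _].
  rewrite /energy_form -/(G v) pS c2; set S2 := \sum_i _ in hpv *.
  have v0 := ip_ge0 (Hs_sqint Hv).
  move: (ip mu (fun x => qO x * v x) v) (ip mu v v) v0 hpv hq1 => qv vv v0 hpv hq1.
  have h1 : (Q + 1) * vv <= (4 * k)^-1 * g + (Q + 1) * M * S2.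
    apply: (@le_trans _ _ ((Q + 1) * (e * g + M * S2))); first by rewrite ler_pM2l.
    rewrite le_eqVlt; apply/orP; left; apply/eqP; rewrite /e; field.
    by rewrite !gt_eqF.
  have h2 : k^-1 * g <= G v by rewrite ler_pdivrMl.
  have k4 : (4 * k)^-1 = 4^-1 * k^-1 by rewrite invfM.
  have kg0 : 0 <= k^-1 * g by rewrite mulr_ge0// invr_ge0 ltW.
  apply: (@le_trans _ _ (vv + (4 * k)^-1 * g)).
    rewrite mulrDr lerD//.
      by rewrite -[leRHS]mul1r ler_wpM2r// ge_min lexx.
    by rewrite ler_wpM2r// ge_min lexx orbT.
  rewrite mulrDl mul1r in h1; rewrite k4 -mulrA in h1 *; lra.
- have [g [g0 -> eg gG Gg]] := iE _ Hv.
  have := qb v Hv; rewrite ler_norml => /andP[_ hq2].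
  rewrite /energy_form -/(G v); have v0 := ip_ge0 (Hs_sqint Hv).
  move: (ip mu (fun x => qO x * v x) v) (ip mu v v) v0 hq2 => qv vv v0 hq2.
  have := mulr_ge0 Q0 g0; have := mulr_ge0 (ltW kp) v0; nra.
Qed.


(** With D = A + \sum_i p_i (x) p_i, the two-sided bound against the inner product of H^s transports
    completeness, null vectors and approximation between the two. The hypotheses D(phi, -) = \sum_i
    p_i(phi) p_i of the abstract lemma say that A(phi, -) = 0, which is where [injV] and [testN]
    come in. *)
Lemma energy_form_density (N : set ('rV[R]_n -> R)) :
  lin_subspace (N : set ('rV[R]_n -> R)) -> N `<=` tHs s Omega ->
  (forall phi, tHs s Omega phi -> (forall v, tHs s Omega v -> energy_form phi v = 0) ->
     Hs_ip s phi phi = 0) ->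
  (forall phi, tHs s Omega phi -> (forall r, N r -> energy_form phi r = 0) ->
     Hs_ip s phi phi = 0) ->
  forall w, tHs s Omega w -> forall e, 0 < e ->
    exists2 r, N r & Hs_ip s (w - r) (w - r) < e.
Proof.
move=> sN NV injV testN.
have [m [p [k0 [k1 [k2 [k00 lp bp lo hi]]]]]] := energy_form_garding.
pose D u v := energy_form u v + \sum_i p i u * p i v.
have [sym lin ip0] := ipV; have sV := tHs_subspace Omega hs.
pose k3 := `|k2| + m%:R * `|k1| + 1.
have k30 : 0 < k3 by rewrite ltr_wpDl// addr_ge0// mulr_ge0.
have DE v : D v v = energy_form v v + \sum_i p i v ^+ 2 by [].
have Dlo v : V v -> k0 * Hs_ip s v v <= D v v by exact: lo.
have Dhi v : V v -> D v v <= k3 * Hs_ip s v v.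
  move=> Vv; have Hv := tHs_Hs Vv; have v0 := ip0 _ Hv.
  rewrite DE /k3 -[X in X * _]addrA mulrDl; apply: lerD.
    by apply: le_trans (hi _ Hv) _; rewrite ler_wpM2r// ler_norm.
  apply: (@le_trans _ _ (\sum_(i < m) (`|k1| * Hs_ip s v v))).
    apply: ler_sum => i _; apply: le_trans (bp i _ Hv) _.
    by rewrite ler_wpM2r// ler_norm.
  by rewrite sumr_const card_ord -[leLHS]mulr_natl mulrA mulrDl mul1r lerDl.
have D0 v : V v -> 0 <= D v v.
  by move=> Vv; apply: le_trans (Dlo _ Vv); exact: mulr_ge0 (ltW k00) (ip0 _ (tHs_Hs Vv)).
have Dip0 v : V v -> Hs_ip s v v = 0 -> D v v = 0.
  move=> Vv v0; apply/eqP; rewrite eq_le D0// andbT.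
  by apply: le_trans (Dhi _ Vv) _; rewrite v0 mulr0.
have DV : semi_inner_product V D.
  split=> // [u v _ _|w Vw c u v Vu Vv].
    by rewrite /D energy_formC; congr (_ + _); apply: eq_bigr => i _; rewrite mulrC.
  have Hu := tHs_Hs Vu; have Hv := tHs_Hs Vv.
  have L : energy_form (c *: u + v) w = c * energy_form u w + energy_form v w :=
    energy_form_linear (tHs_Hs Vw) c Hu Hv.
  have S : \sum_i p i (c *: u + v) * p i w = c * \sum_i p i u * p i w + \sum_i p i v * p i w.
    by rewrite mulr_sumr -big_split/=; apply: eq_bigr => i _; rewrite lp//; ring.
  by rewrite /D L S; ring.
have cV : sip_complete V D.
  move=> U VU cU; have [e e0|g Vg hg] := tHs_complete hs VU.
    have [M hM] := cU _ (mulr_gt0 k00 e0); exists M => i j Mi Mj.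
    have := hM i j Mi Mj; have Vij := subspaceB sV (VU i) (VU j).
    by move=> /(le_lt_trans (Dlo _ Vij)); rewrite ltr_pM2l.
  exists g => // e e0; have [M hM] := hg _ (divr_gt0 e0 k30).
  exists M => i Mi; apply: le_lt_trans (Dhi _ (subspaceB sV (VU i) Vg)) _.
  by rewrite mulrC -ltr_pdivlMr//; exact: hM.
have key (S : set ('rV[R]_n -> R)) phi : S `<=` V ->
    (forall v, S v -> D phi v = \sum_i p i phi * p i v) -> forall v, S v -> energy_form phi v = 0.
  by move=> SV h v Sv; have := h v Sv; rewrite /D; lra.
have lpV i : linear_on V (p i).
  by move=> c u v Vu Vv; apply: lp; [exact: tHs_Hs Vu|exact: tHs_Hs Vv].
have K0' : 0 <= `|k1| / k0 by rewrite divr_ge0// ltW.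
have bpV i v : V v -> p i v ^+ 2 <= `|k1| / k0 * D v v.
  move=> Vv; apply: le_trans (bp i _ (tHs_Hs Vv)) _.
  apply: (@le_trans _ _ (`|k1| * Hs_ip s v v)).
    exact: ler_wpM2r (ip0 _ (tHs_Hs Vv)) _ _ (ler_norm _).
  by rewrite -mulrA ler_wpM2l// ler_pdivlMl//; exact: Dlo.
move=> w Vw e e0.
have [phi Vphi h|phi Vphi h|r Nr hr] := dense_of_finite_rank_perturbation
  sV DV cV sN NV K0' lpV bpV _ _ Vw (mulr_gt0 k00 e0).
- by apply: Dip0 => //; apply: injV => //; exact: (key V).
- by apply: Dip0 => //; apply: testN => //; exact: (key N).
exists r => //; have := le_lt_trans (Dlo _ (subspaceB sV Vw (NV _ Nr))) hr.
by rewrite ltr_pM2l.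
Qed.

End bilinear_form.

(** * Reduction of B_q on the cone neighbourhood to the whole space *)

Section whole_space_form.
Context {R : realType} {n : nat}.
Local Notation mu := (lebesgue_rV n).
Local Notation mu2 := (mu \x mu)%E.
Variables (s : R) (a : 'rV[R]_n -> R) (C Omega : set 'rV[R]_n) (q : 'rV[R]_n -> R).
Hypothesis hs : 0 < s < 1.
Hypothesis Omega_open : open Omega.
Hypothesis hq : (q \_ Omega) \in Lfun mu +oo%E.
Hypothesis hA1 : condA1 s a.
Hypothesis hA2 : condA2 a.
Hypothesis hA3 : condA3 a C.
Implicit Types (u v w phi f g : 'rV[R]_n -> R) (U : set 'rV[R]_n).
Local Notation K := (kern s a).
Local Notation COmega := (cone_nbhd C Omega).

Lemma cone_nbhd_open U : open U -> open (cone_nbhd C U).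
Proof.
move=> /open_enormP oU; apply/open_enormP => _ [x Ux [y Cy <-]].
have [r r0 hr] := oU _ Ux; exists r => // z xyz.
exists (z - y); last by exists y => //; rewrite subrK.
by apply: hr; rewrite opprB addrA.
Qed.

(** As 0 is outside the cone, openness does the work: x = (x - t c) + t c with c in the cone and t c
    short enough for x - t c to stay in U. *)
Lemma sub_cone_nbhd U : open U -> U `<=` cone_nbhd C U.
Proof.
move=> /open_enormP oU x Ux; have [[_ _ [c Cc] cC _] _] := hA3.
have [r r0 hr] := oU _ Ux; have c0 : 0 < enorm c by rewrite enorm_gt0; exact: (cone_neq0 hA3).
pose t := r / 2 / enorm c; have t0 : 0 < t by rewrite !divr_gt0.
exists (x - t *: c); last by exists (t *: c); [right; exact: cC|rewrite subrK].
apply: hr; rewrite opprB addrC subrK enormZ gtr0_norm// /t divfK ?gt_eqF//.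
by rewrite ltr_pdivrMr// mulr_natr mulr2n ltrDl.
Qed.

Lemma ae_eq_Rintegral d (T : measurableType d) (m : {measure set T -> \bar R}) (f g : T -> R) :
  measurable_fun setT f -> measurable_fun setT g -> {ae m, forall x, f x = g x} ->
  \int[m]_x f x = \int[m]_x g x.
Proof.
move=> mf mg fg; rewrite /Rintegral; congr fine; apply: ae_eq_integral => //.
- exact/measurable_EFinP.
- exact/measurable_EFinP.
- by apply: filterS fg => x -> _.
Qed.

(** Outside the square of the cone neighbourhood the integrand vanishes almost everywhere. If the
    kernel at x - z is nonzero, then x - z and z - x are in the symmetric cone; if moreover x or z
    is in [Omega], both lie in the neighbourhood, and otherwise v vanishes at both. The values of u'
    off the neighbourhood are left free because weak solutions are only given there. *)
Lemma BqE u u' v : Hs s u -> measurable_fun COmega u' ->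
  {ae mu, forall x, COmega x -> u' x = u x} -> tHs s Omega v ->
  Bq s a C q Omega u' v = energy_form s a Omega q u v.
Proof.
move=> Hu mu' u'u Vv; have mu_ := Hs_measurable Hu; have mv := Hs_measurable (tHs_Hs Vv).
have mCO : measurable COmega by apply: open_measurable_rV; exact: cone_nbhd_open.
have mO : measurable Omega by exact: open_measurable_rV.
(* Extension by 0 gives a function measurable on the whole space; u' is assumed measurable on the
   neighbourhood only. *)
pose w : 'rV[R]_n -> R := u' \_ COmega.
have mw : measurable_fun setT w by apply/(measurable_restrictT _ _).1.
have mK := measurable_kern hs hA1; have K0 := kern_ge0 hs hA2.
have mqO : measurable_fun setT (q \_ Omega) by move/sub_Lfun_mfun : hq; rewrite inE.
have OC := sub_cone_nbhd Omega_open.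
have wE x : COmega x -> w x = u' x by move=> Cx; rewrite /w patchE mem_set.
have vO := tHs_supp hs Omega_open Vv.
have wu : {ae mu, forall x, COmega x -> w x = u x}.
  by apply: filterS u'u => x + Cx => <-//; exact: wE.
rewrite /Bq /energy_form; congr (2^-1 * _ + _).
  rewrite Rintegral_mkcond /ip.
  rewrite (_ : _ \_ _ = (fun z => (w z.1 - w z.2) * (v z.1 - v z.2) * K (z.1 - z.2))
      \_ (COmega `*` COmega)); last first.
    apply/funext => z; rewrite !patchE; case: ifPn => // /set_mem[z1 z2].
    by rewrite !wE.
  have mF : measurable_fun setT (fun z : 'rV[R]_n * 'rV[R]_n =>
      (w z.1 - w z.2) * (v z.1 - v z.2) * K (z.1 - z.2)).
    apply: measurable_funM; last exact: measurable_kernel_diff.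
    by apply: measurable_funM; exact: measurable_diff2.
  apply: ae_eq_Rintegral.
  - apply/(measurable_restrictT _ _).1; first exact: measurableX.
    exact: measurable_funTS.
  - by apply: measurable_funM; exact: measurable_nlgrad.
  have vw : {ae mu, forall x, (~ Omega x -> v x = 0) /\ (COmega x -> w x = u x)}.
    by apply: filterS2 vO wu.
  apply: filterS2 (ae_product1 mu vw) (ae_product2 mu vw) => -[x z] /= [vx wx] [vz wz].
  rewrite /nlgrad /= -[RHS]/(_ * _ * (_ * _)) mulrACA -expr2 sqr_sqrtr//.
  rewrite patchE /=; case: ifPn => [/set_mem[/= Cx Cz]|/negP nCC].
    by rewrite wx// wz.
  have [->|/eqP kxz] := eqVneq (K (x - z)) 0; first by rewrite mulr0.
  have xz : sym_cone C (x - z) by apply: (kern_neq0 hs hA3); exact/eqP.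
  have zx : sym_cone C (z - x).
    apply: (kern_neq0 hs hA3); rewrite -(kernN hs hA2) opprB; exact/eqP.
  have [Ox|nOx] := pselect (Omega x).
    by case: nCC; rewrite inE; split => /=; [exact: OC|exists x => //; exists (z - x) => //;
      rewrite addrC subrK].
  have [Oz|nOz] := pselect (Omega z).
    by case: nCC; rewrite inE; split => /=; [exists z => //; exists (x - z) => //;
      rewrite addrC subrK|exact: OC].
  by rewrite vx// vz// subrr mulr0 mul0r.
rewrite Rintegral_mkcond /ip.
rewrite (_ : (fun x => q x * u' x * v x) \_ Omega = fun x => (q \_ Omega) x * w x * v x);
  last first.
  apply/funext => x; rewrite !patchE; case: ifPn => [/set_mem Ox|_]; last by rewrite !mul0r.
  by rewrite wE//; exact: OC.
apply: ae_eq_Rintegral.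
- by do 2 apply: measurable_funM => //.
- by do 2 apply: measurable_funM => //.
apply: filterS wu => x wx; rewrite patchE; case: ifPn => [/set_mem Ox|_]; last by rewrite !mul0r.
by rewrite wx//; exact: OC.
Qed.

End whole_space_form.

(** * Antilocality and density *)

Section operator_of_mollification.
Context {R : realType} {n : nat}.
Local Notation mu := (lebesgue_rV n).
Local Notation mu2 := (mu \x mu)%E.
Variables (s : R) (a : 'rV[R]_n -> R) (C Omega : set 'rV[R]_n) (q : 'rV[R]_n -> R).
Hypothesis hs : 0 < s < 1.
Hypothesis hA1 : condA1 s a.
Hypothesis hA2 : condA2 a.
Hypothesis hA3 : condA3 a C.
Local Notation K := (kern s a).
Implicit Types (x y z w : 'rV[R]_n).

Let mK := measurable_kern hs hA1.
Let K0 := kern_ge0 hs hA2.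

(** For |y| >= d the weight min(1, |y|^2) is at least min(1, d^2) > 0, so the bound of
    [integral_levy] applies. *)
Lemma kern_far_integrable (d : R) : 0 < d ->
  mu.-integrable setT (EFin \o (K \_ [set y | d <= enorm y])).
Proof.
move=> d0; have mS : measurable [set y : 'rV[R]_n | d <= enorm y].
  by rewrite -[X in measurable X]setTI; apply: measurable_fun_le => //; exact: measurable_enorm.
have mKd : measurable_fun setT (K \_ [set y | d <= enorm y]).
  by apply/(measurable_restrictT _ _).1 => //; exact: measurable_funTS.
have hfin0 := integral_levy hs (measurable_adir hA1) (adir_ge0 hA2) (@adirZ R n a)
  (integral_adir_lty hA1 hA2 hA3).
pose h z : \bar R := (Num.min 1 (enorm z ^+ 2) * (adir a z * gkern s z))%:E.
have hfin : (\int[mu]_z h z < +oo)%E := hfin0.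
have hE z : h z = (Num.min 1 (enorm z ^+ 2) * K z)%:E by rewrite /h kernE.
pose m := Num.min 1 (d ^+ 2); have m0 : 0 < m by rewrite lt_min ltr01 exprn_gt0.
have h0 z : (0 <= h z)%E by rewrite hE lee_fin mulr_ge0// le_min ler01 sqr_ge0.
have mh : measurable_fun setT h.
  rewrite (_ : h = fun z => (Num.min 1 (enorm z ^+ 2) * K z)%:E); last exact/funext.
  apply/measurable_EFinP; apply: measurable_funM => //.
  by apply: measurable_minr => //; apply: measurable_funX; exact: measurable_enorm.
apply/integrableP; split; first exact/measurable_EFinP.
apply: (@le_lt_trans _ _ ((m^-1)%:E * \int[mu]_z h z)%E); last first.
  by rewrite lte_mul_pinfty// lee_fin invr_ge0 ltW.
rewrite -ge0_integralZl//; last by rewrite lee_fin invr_ge0 ltW.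
apply: ge0_le_integral => //.
- by apply: measurableT_comp => //; exact/measurable_EFinP.
- exact: measurable_funeM.
move=> y _; rewrite /= patchE; case: ifPn => [/set_mem /= dy|_]; last first.
  by rewrite normr0 mule_ge0// lee_fin invr_ge0 ltW.
rewrite ger0_norm// hE -EFinM lee_fin mulrA ler_peMl//.
rewrite ler_pdivlMl// mulr1 le_min ge_min lexx/= ge_min; apply/orP; right.
by rewrite ler_sqr ?nnegrE ?enorm_ge0// ltW.
Qed.

Variables (phi : 'rV[R]_n -> R) (x0 : 'rV[R]_n) (e d : R).
Hypothesis iphi : mu.-integrable setT (EFin \o phi).
Hypothesis e0 : 0 < e.
Hypothesis d0 : 0 < d.
Hypothesis phi_far : forall z, phi z <> 0 -> e + d <= enorm (z - x0).

(** The truncated kernel is integrable, so Fubini can be applied directly, with no cancellation near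
    the singularity. *)
Let Kd := K \_ [set y | d <= enorm y].
Let g x := mollifier e (x0 - x).
Let f := convol (mollifier e) phi.

Let mphi : measurable_fun setT phi.
Proof. by apply/measurable_EFinP; case/integrableP: iphi. Qed.

Let mKd : measurable_fun setT Kd.
Proof. by apply/measurable_EFinP; case/integrableP: (kern_far_integrable d0). Qed.

Let Kd0 y : 0 <= Kd y. Proof. by rewrite /Kd patchE; case: ifP. Qed.

Let KdN y : Kd (- y) = Kd y.
Proof.
rewrite /Kd !patchE (kernN hs hA2); congr (if _ then _ else _).
by apply: asbool_equiv_eq => /=; rewrite enormN.
Qed.

Let KdE y : d <= enorm y -> Kd y = K y.
Proof. by move=> dy; rewrite /Kd patchE mem_set. Qed.

Let mmol : measurable_fun setT (@mollifier R n e). Proof. exact: measurable_mollifier. Qed.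

Let mol_eq0 x : e < enorm x -> mollifier e x = 0.
Proof. by move=> ex; apply: mollifier_out => //; apply/negP; rewrite subr0 -ltNge. Qed.

(* The pairing of g and phi through the jump kernel; only jumps of length at
   least d contribute. *)
Let F (p : 'rV[R]_n * 'rV[R]_n) := g p.1 * phi p.2 * Kd (p.1 - p.2).

(* tau is y |-> x0 + y or y |-> x0 - y. *)
Let H (tau : 'rV[R]_n -> 'rV[R]_n) (p : 'rV[R]_n * 'rV[R]_n) :=
  mollifier e (tau p.1 - p.2) * phi p.2 * Kd p.1.

Let mg : measurable_fun setT g.
Proof. by apply: measurableT_comp => //; apply: measurable_rVB => //; exact: measurable_id. Qed.

Let mF : measurable_fun setT F.
Proof.
apply: measurable_funM; last exact: measurable_kernel_diff.
by apply: measurable_funM; apply: measurableT_comp => //.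
Qed.

Let mH tau : measurable_fun setT tau -> measurable_fun setT (H tau).
Proof.
move=> mtau; apply: measurable_funM; last exact: measurableT_comp.
apply: measurable_funM; apply: measurableT_comp => //.
apply: measurable_rVB; last exact: measurable_snd.
by apply: (measurableT_comp mtau); exact: measurable_fst.
Qed.

Let slice_bound (h k : 'rV[R]_n -> R) z : measurable_fun setT h -> measurable_fun setT k ->
  (forall x, 0 <= h x <= 1) -> (forall x, 0 <= k x) ->
  (\int[mu]_x (k x)%:E = \int[mu]_x (Kd x)%:E)%E ->
  (\int[mu]_x `|(h x * phi z * k x)%:E| <= `|phi z|%:E * \int[mu]_x (Kd x)%:E)%E.
Proof.
move=> mh mk h01 k0 <-; rewrite -ge0_integralZl//; last first.
- by move=> x _; rewrite lee_fin.
- exact/measurable_EFinP.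
apply: ge0_le_integral => //.
- by apply: measurableT_comp => //; apply/measurable_EFinP; do 2 apply: measurable_funM => //.
- by apply: measurable_funeM; exact/measurable_EFinP.
move=> x _; rewrite /= lee_fin !normrM (ger0_norm (k0 x)) ler_wpM2r//.
by have /andP[hx0 hx1] := h01 x; rewrite ger0_norm// ler_piMl.
Qed.

Let tail_lty : (\int[mu]_z (`|phi z|%:E * \int[mu]_x (Kd x)%:E) < +oo)%E.
Proof.
have /integrableP[_] := kern_far_integrable d0.
under eq_integral do rewrite /= ger0_norm//.
rewrite -/Kd => kfin; rewrite ge0_integralZr//.
- by case/integrableP: iphi => _ pfin; apply: lte_mul_pinfty => //;
    [exact: integral_ge0|rewrite ge0_fin_numE//; exact: integral_ge0].
- by apply/measurable_EFinP; exact: measurableT_comp.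
- by apply: integral_ge0 => z _; rewrite lee_fin.
Qed.

Let mol01 x : 0 <= mollifier e x <= 1. Proof. by rewrite mollifier_ge0 mollifier_le1. Qed.

Let integrable_by_slices (G : 'rV[R]_n * 'rV[R]_n -> R) : measurable_fun setT G ->
  (forall z, (\int[mu]_x `|(G (x, z))%:E| <= `|phi z|%:E * \int[mu]_x (Kd x)%:E)%E) ->
  mu2.-integrable setT (EFin \o G).
Proof.
move=> mG hG; apply/(integrable21ltyP mu mu); first exact/measurable_EFinP.
apply: le_lt_trans tail_lty; apply: ge0_le_integral => //.
- by move=> z _; exact: integral_ge0.
- apply: (@measurable_fun_fubini_tonelli_G _ _ _ _ _ mu (fun p => `|(G p)%:E|%E)) => //.
  by apply: measurableT_comp => //; exact/measurable_EFinP.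
- apply: emeasurable_funM => //; apply/measurable_EFinP; exact: measurableT_comp.
- by move=> z _; exact: hG.
Qed.

Let int_shift z : (\int[mu]_x (Kd (x - z))%:E = \int[mu]_x (Kd x)%:E)%E.
Proof.
apply: (integral_rV_shift (- z) (f := fun x => (Kd x)%:E)); first exact/measurable_EFinP.
by move=> x; rewrite lee_fin.
Qed.

Let iF : mu2.-integrable setT (EFin \o F).
Proof.
apply: integrable_by_slices mF _ => z.
exact: (slice_bound z mg (measurableT_comp mKd (measurable_shift (- z)))
  (fun x => mol01 _) (fun x => Kd0 _) (int_shift z)).
Qed.

Let iH tau : measurable_fun setT tau -> mu2.-integrable setT (EFin \o H tau).
Proof.
move=> mtau; apply: integrable_by_slices (mH mtau) _ => z.
have mt : measurable_fun setT (fun x : 'rV[R]_n => mollifier e (tau x - z)).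
  by apply: measurableT_comp => //; exact: measurable_rVB.
exact: (slice_bound z mt mKd (fun x => mol01 _) Kd0 erefl).
Qed.

Let pairing : R := \int[mu2]_p F p.

(** Both halves of L(D), f(x0 + y) and f(x0 - y), are treated at once: expand f as a convolution,
    exchange the integrals, and change variables for fixed z, the last hypothesis recording that
    change. Each half equals the same [pairing]. *)
Let convol_term (tau : 'rV[R]_n -> 'rV[R]_n) : measurable_fun setT tau ->
  (forall y, enorm (tau y - x0) = enorm y) ->
  (forall z, (\int[mu]_y (mollifier e (tau y - z) * Kd y)%:E =
              \int[mu]_x (g x * Kd (x - z))%:E)%E) ->
  mu.-integrable setT (EFin \o (fun y => f (tau y) * K y)) /\
  (\int[mu]_y (f (tau y) * K y)%:E = pairing%:E)%E.
Proof.
move=> mtau tauE tauI.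
have imol y : mu.-integrable setT (EFin \o (fun z => mollifier e (tau y - z) * phi z)).
  by apply: (convol_integrable iphi _ mmol (c := 1)) => z;
    rewrite ger0_norm ?mollifier_ge0 ?mollifier_le1.
have fE y : (f (tau y) * K y)%:E = (\int[mu]_z (H tau (y, z))%:E)%E.
  (* For |y| < d the point tau y is farther than e from every z with phi z nonzero, so f vanishes
     there and the truncation changes nothing. *)
  have -> : f (tau y) * K y = f (tau y) * Kd y.
    have [dy|dy] := leP d (enorm y); first by rewrite KdE.
    rewrite /f convol_eq0 ?mul0r// => z /phi_far zx; apply: mol_eq0.
    have := enorm_sub_le (z - x0) (tau y - x0);
      rewrite tauE opprB addrA subrK [enorm (z - tau y)]enormB; lra.
  rewrite /f /convol -RintegralZr//.
  have h1 := integrableZr measurableT (Kd y) (imol y).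
  rewrite /Rintegral fineK; first by [].
  have h2 : mu.-integrable setT (EFin \o (fun z => mollifier e (tau y - z) * phi z * Kd y)).
    by apply: eq_integrable h1 => // z _; rewrite /= EFinM.
  exact: (integrable_fin_num measurableT h2).
have eqF : (fun y => (f (tau y) * K y)%:E) = fubini_F mu (EFin \o H tau).
  by apply/funext => y; rewrite fE.
split.
  rewrite (_ : _ \o _ = fubini_F mu (EFin \o H tau))//.
  exact: integrable_fubini_F (iH mtau).
have fin_F : (\int[mu2]_p (EFin \o F) p)%E \is a fin_num := integrable_fin_num measurableT iF.
have pairingE : pairing%:E = (\int[mu2]_p (EFin \o F) p)%E by exact: (fineK fin_F).
rewrite pairingE eqF (integral12_prod_meas1 (iH mtau)).
rewrite -[LHS](integral21_prod_meas1 (iH mtau)) -[RHS](integral21_prod_meas1 iF).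
apply: eq_integral => z _; rewrite /fubini_G /=.
have mt : measurable_fun setT (fun y : 'rV[R]_n => mollifier e (tau y - z) * Kd y).
  exact: (measurable_funM (measurableT_comp mmol (measurable_rVB mtau (measurable_cst z))) mKd).
have mgK : measurable_fun setT (fun x : 'rV[R]_n => g x * Kd (x - z)).
  exact: (measurable_funM mg (measurableT_comp mKd (measurable_shift (- z)))).
have ik (k : 'rV[R]_n -> R) : measurable_fun setT k -> (forall x, 0 <= k x) ->
    (\int[mu]_x (k x)%:E = \int[mu]_x (g x * Kd (x - z))%:E)%E ->
    mu.-integrable setT (EFin \o k).
  move=> mk k0 kE; apply/integrableP; split; first exact/measurable_EFinP.
  under eq_integral do rewrite /= ger0_norm//.
  rewrite kE; apply: (@le_lt_trans _ _ (\int[mu]_x (Kd (x - z))%:E)%E).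
    apply: ge0_le_integral => //.
    - by move=> x _; rewrite lee_fin mulr_ge0// mollifier_ge0.
    - exact/measurable_EFinP.
    - by apply/measurable_EFinP; apply: measurableT_comp => //; exact: measurable_shift.
    by move=> x _; rewrite lee_fin ler_piMl// mollifier_le1.
  rewrite int_shift; have /integrableP[_] := kern_far_integrable d0.
  by under eq_integral do rewrite /= ger0_norm//.
have it := ik _ mt (fun y => mulr_ge0 (mollifier_ge0 _ _) (Kd0 y)) (tauI z).
have igK := ik _ mgK (fun y => mulr_ge0 (mollifier_ge0 _ _) (Kd0 _)) erefl.
transitivity ((phi z)%:E * \int[mu]_y (mollifier e (tau y - z) * Kd y)%:E)%E.
  rewrite -(integralZl measurableT it).
  by apply: eq_integral => y _; rewrite /H -EFinM /=; congr EFin; ring.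
rewrite tauI; apply: etrans (esym (integralZl measurableT igK _)) _.
by apply: eq_integral => x _; rewrite /F -EFinM /=; congr EFin; ring.
Qed.

Let Fs (p : 'rV[R]_n * 'rV[R]_n) := F (p.2, p.1).

Let mFs : measurable_fun setT Fs.
Proof.
apply: (measurableT_comp mF).
by apply: measurable_fun_pair; [exact: measurable_snd|exact: measurable_fst].
Qed.

Let iFs : mu2.-integrable setT (EFin \o Fs).
Proof.
have mF' : measurable_fun setT (EFin \o F) by apply/measurable_EFinP; exact: mF.
have mFs' : measurable_fun setT (EFin \o Fs) by apply/measurable_EFinP; exact: mFs.
exact: ((integrable12ltyP mu mu mFs').2 ((integrable21ltyP mu mu mF').1 iF)).
Qed.

Let Fs_pairing : \int[mu2]_p Fs p = pairing.
Proof.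
have e1 := integral12_prod_meas1 iFs; have e2 := integral21_prod_meas1 iF.
exact: (f_equal fine (etrans (esym e1) e2)).
Qed.

Let phi_out z : phi z <> 0 -> e < enorm (x0 - z).
Proof. by move=> /phi_far; rewrite enormB; apply: lt_le_trans; rewrite ltrDl. Qed.

Lemma mollification_eq0 : f x0 = 0.
Proof. by apply: convol_eq0 => z /phi_out zx; exact: mol_eq0. Qed.

(** As f vanishes at x0, the left side is minus the two terms of [convol_term], that is -2
    [pairing]. On the other side g and phi have disjoint supports: the potential term drops out and
    the product of nonlocal gradients is -F minus its transpose, so the factor 1/2 of the form
    leaves -[pairing]. *)
Lemma LD_mollification : LD s a f x0 = 2 * energy_form s a Omega q g phi.
Proof.
have gphi x : g x * phi x = 0.
  have [->|/eqP/phi_out zx] := eqVneq (phi x) 0; first by rewrite mulr0.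
  by rewrite /g mol_eq0 ?mul0r.
have gphiK x z : g x * phi z * K (x - z) = g x * phi z * Kd (x - z).
  have [->|/eqP/phi_far zx] := eqVneq (phi z) 0; first by rewrite mulr0 !mul0r.
  have [xe|xe] := leP (enorm (x0 - x)) e; last first.
    by have -> : g x = 0 by [exact: mol_eq0]; rewrite !mul0r.
  suff dxz : d <= enorm (x - z) by rewrite (KdE dxz).
  have := enorm_sub_le (z - x0) (x - x0).
  rewrite opprB addrA subrK [enorm (z - x)]enormB [enorm (x - x0)]enormB.
  by move: (enorm _) (enorm _) (enorm _) xe zx => p1 p2 p3; lra.
have sqK y : Num.sqrt (K y) * Num.sqrt (K y) = K y by rewrite -expr2 sqr_sqrtr.
have pt x z : nlgrad K g (x, z) * nlgrad K phi (x, z) = -1 * F (x, z) - Fs (x, z).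
  have e2 : g z * phi x * Kd (z - x) = g z * phi x * K (x - z).
    by rewrite -gphiK -(kernN hs hA2) opprB.
  rewrite [F _](esym (gphiK x z)) [Fs _]e2 -(sqK (x - z)).
  have nE u : nlgrad K u (x, z) = (u x - u z) * Num.sqrt (K (x - z)) by [].
  rewrite !nE.
  have := gphi x; have := gphi z.
  move: (g x) (g z) (phi x) (phi z) (Num.sqrt (K (x - z))) => gx gz px pz k gz0 gx0.
  transitivity ((gx * px) * k * k + (gz * pz) * k * k - gx * pz * (k * k) - gz * px * (k * k));
    first by ring.
  by rewrite gx0 gz0; ring.
have formE : energy_form s a Omega q g phi = - pairing.
  rewrite /energy_form.
  have -> : ip mu (fun x => (q \_ Omega) x * g x) phi = 0.
    have z0 : (fun x => (q \_ Omega) x * g x * phi x) = (fun=> 0).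
      by apply/funext => x; rewrite -mulrA gphi mulr0.
    by rewrite /ip z0 /Rintegral integral0_eq.
  have -> : ip mu2 (nlgrad K g) (nlgrad K phi) = \int[mu2]_p (-1 * F p - Fs p).
    apply: eq_Rintegral => -[x z] _; exact: pt.
  have iF1 : mu2.-integrable setT (EFin \o (fun p => -1 * F p)) := integrableZl measurableT (-1) iF.
  have r1 : \int[mu2]_p (-1 * F p - Fs p) = \int[mu2]_p (-1 * F p) - \int[mu2]_p Fs p.
    exact: (RintegralB measurableT iF1 iFs).
  have r2 : \int[mu2]_p (-1 * F p) = -1 * pairing.
    exact: (RintegralZl (-1) measurableT iF).
  rewrite r1 r2 Fs_pairing.
  by rewrite addr0 mulN1r -opprD mulrN -mulr2n -[pairing *+ 2]mulr_natl mulrA mulVf ?mul1r.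
pose h z x := (g x * Kd (x - z))%:E.
have hm z : measurable_fun setT (h z).
  apply/measurable_EFinP.
  exact: (measurable_funM mg (measurableT_comp mKd (measurable_shift (- z)))).
have hp z x : (0 <= h z x)%E.
  by rewrite lee_fin; exact: mulr_ge0 (mollifier_ge0 _ _) (Kd0 _).
have [||z|i1 e1] := @convol_term (fun y => x0 + y).
- exact: (measurable_rVD (measurable_cst x0) (@measurable_id _ _ setT)).
- by move=> y; rewrite addrC addKr.
- apply: etrans (integral_rV_reflect z (hm z) (hp z)); apply: eq_integral => y _.
  have E1 : x0 - (z - y) = x0 + y - z by rewrite opprB addrA.
  have E2 : z - y - z = - y by rewrite addrC addKr.
  exact: (f_equal EFin (f_equal2 *%R (f_equal (mollifier e) (esym E1))
    (etrans (esym (KdN y)) (f_equal Kd (esym E2))))).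
have [||z|i2 e2] := @convol_term (fun y => x0 - y).
- exact: (measurable_rVB (measurable_cst x0) (@measurable_id _ _ setT)).
- by move=> y; rewrite addrC addKr enormN.
- apply: etrans (integral_rV_shift z (hm z) (hp z)); apply: eq_integral => y _.
  have E1 : x0 - (y + z) = x0 - y - z by rewrite opprD addrA.
  have E2 : y + z - z = y by rewrite addrK.
  exact: (f_equal EFin (f_equal2 *%R (f_equal (mollifier e) (esym E1))
    (f_equal Kd (esym E2)))).
have fin1 : \int[mu]_y (f (x0 + y) * K y) = pairing := f_equal fine e1.
have fin2 : \int[mu]_y (f (x0 - y) * K y) = pairing := f_equal fine e2.
have i1N : mu.-integrable setT (EFin \o (fun y => -1 * (f (x0 + y) * K y))) :=
  integrableZl measurableT (-1) i1.
have -> : LD s a f x0 = \int[mu]_y (-1 * (f (x0 + y) * K y) - f (x0 - y) * K y).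
  have ar (A B k : R) : (2 * 0 - A - B) * k = -1 * (A * k) - B * k by ring.
  by apply: eq_Rintegral => y _; rewrite mollification_eq0; exact: ar.
have r1 : \int[mu]_y (-1 * (f (x0 + y) * K y) - f (x0 - y) * K y) =
    \int[mu]_y (-1 * (f (x0 + y) * K y)) - \int[mu]_y (f (x0 - y) * K y).
  exact: (RintegralB measurableT i1N i2).
have r2 : \int[mu]_y (-1 * (f (x0 + y) * K y)) = -1 * \int[mu]_y (f (x0 + y) * K y).
  exact: (RintegralZl (-1) measurableT i1).
have ar (t : R) : -1 * t - t = 2 * - t by ring.
have r3 := f_equal2 (fun A B : R => A - B) (etrans r2 (f_equal (fun A : R => -1 * A) fin1)) fin2.
exact: (etrans r1 (etrans r3 (etrans (ar pairing) (f_equal (fun A : R => 2 * A) (esym formE))))).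
Qed.

End operator_of_mollification.

(** * Density of the restricted solutions *)

Section runge_approximation.
Context {R : realType} {n : nat}.
Local Notation mu := (lebesgue_rV n).
Variables (s : R) (a : 'rV[R]_n -> R) (C Omega W : set 'rV[R]_n) (q : 'rV[R]_n -> R).
Variable P : ('rV[R]_n -> R) -> 'rV[R]_n -> R.
Hypothesis hs : 0 < s < 1.
Hypothesis Omega_open : open Omega.
Hypothesis Omega_bounded : bounded_set Omega.
Hypothesis hq : (q \_ Omega) \in Lfun mu +oo%E.
Hypothesis hA1 : condA1 s a.
Hypothesis hA2 : condA2 a.
Hypothesis hA3 : condA3 a C.
Hypothesis hwp : well_posed s a C q Omega.
Hypothesis hP : poisson_operator s a C q Omega P.
Hypothesis hanti : antilocal s a C.
Hypothesis W_open : open W.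
Hypothesis W_ext : W `<=` exterior C Omega.
Hypothesis Omega_W : Omega `<=` cone_nbhd C W.
Local Notation CO := (cone_nbhd C Omega).
Local Notation V := (@tHs R n s Omega : set ('rV[R]_n -> R)).
Local Notation A := (energy_form s a Omega q).
Implicit Types (u v w phi f g : 'rV[R]_n -> R).

Let sH := @Hs_subspace R n s.
Let ipV := @Hs_semi_inner_product R n s.
Let sV := tHs_subspace Omega hs.
Let OC : Omega `<=` CO := sub_cone_nbhd hA3 Omega_open.
Let mCO : measurable CO.
Proof. by apply: open_measurable_rV; exact: cone_nbhd_open. Qed.
Let mO : measurable Omega.
Proof. exact: open_measurable_rV. Qed.

Let energyB w u v : Hs s u -> Hs s v -> Hs s w -> A (u - v) w = A u w - A v w.
Proof.
move=> Hu Hv Hw; have L := energy_form_linear hs hq hA1 hA2 hA3 Hw (-1) Hv Hu.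
by rewrite addrC -scaleN1r; apply: etrans L _; rewrite mulN1r addrC.
Qed.

Lemma HsOn_of_Hs (U : set 'rV[R]_n) f : Hs s f -> HsOn s U f.
Proof.
move=> Hf; split; first exact: measurable_funTS (Hs_measurable Hf).
by exists f; split => //; apply: filterE.
Qed.

Lemma W_Omega x : W x -> ~ Omega x.
Proof. by move=> /W_ext[_ nO] /subset_closure. Qed.

Lemma Ccinf_W_Omega f x : Ccinf W f -> Omega x -> f x = 0.
Proof.
move=> [_ _ fW] Ox; apply: supp_out => /fW /W_Omega; exact.
Qed.

Lemma restrict_tHs u : tHs s Omega u -> tHs s Omega (u \_ Omega).
Proof.
move=> Vu; apply: (tHs_ae hs Vu).
  by apply/(measurable_restrictT _ _).1 => //; exact: measurable_funTS (Hs_measurable (tHs_Hs Vu)).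
apply: filterS (tHs_supp hs Omega_open Vu) => x ux _; rewrite patchE.
by case: ifPn => // /negP nx; apply: ux => Ox; apply: nx; rewrite inE.
Qed.

Lemma restrict_CO_tHs u : tHs s Omega u -> tHs s Omega (u \_ CO).
Proof.
move=> Vu; apply: (tHs_ae hs Vu).
  by apply/(measurable_restrictT _ _).1 => //; exact: measurable_funTS (Hs_measurable (tHs_Hs Vu)).
apply: filterS (tHs_supp hs Omega_open Vu) => x ux _; rewrite patchE.
by case: ifPn => // /negP nx; apply: ux => /OC Cx; apply: nx; rewrite inE.
Qed.

Lemma BqE_self u v : tHs s Omega u -> tHs s Omega v -> Bq s a C q Omega u v = A u v.
Proof.
move=> Vu Vv; apply: (BqE hs Omega_open hq hA1 hA2 hA3) => //.
- exact: tHs_Hs Vu.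
- exact: measurable_funTS (Hs_measurable (tHs_Hs Vu)).
- exact: filterE.
Qed.

Lemma energy_restrict u v : tHs s Omega u -> tHs s Omega v -> A (u \_ Omega) v = A u v.
Proof.
move=> Vu Vv; have Vr := restrict_tHs Vu; rewrite -BqE_self//.
apply: (BqE hs Omega_open hq hA1 hA2 hA3) => //.
- exact: tHs_Hs Vu.
- exact: measurable_funTS (Hs_measurable (tHs_Hs Vr)).
apply: filterS (tHs_supp hs Omega_open Vu) => x ux _; rewrite patchE.
by case: ifPn => // /negP nx; apply/esym/ux => Ox; apply: nx; rewrite inE.
Qed.

(** The last clause of the definition quantifies over every extension ft of the zero datum, and ft
    need not visibly be in the closure of the test functions when [Omega] is merely open. Existence
    of a solution u0 settles it: u0 and u0 - ft, cut off to the neighbourhood, are both in that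
    closure, and phi - ft = (phi - u0) + (u0 - ft). *)
Lemma weak_solution0 phi : tHs s Omega phi -> (forall v, tHs s Omega v -> A phi v = 0) ->
  weak_solution s a C q Omega (cst 0) phi.
Proof.
move=> Vphi phi0; have H0 : Hs s (cst 0 : 'rV[R]_n -> R) := sH.1.
split=> [|v Vv|ft hft ft0].
- exact: HsOn_of_Hs (tHs_Hs Vphi).
- by rewrite BqE_self// phi0.
have [u0 [[_ _ hu0] _]] := hwp.1 _ (HsOn_of_Hs _ H0).
have V1 := hu0 _ hft ft0.
have h00 : (cst 0 : 'rV[R]_n -> R) = cst 0 %[ae mu in exterior C Omega] by exact: filterE.
have V2 := hu0 _ (HsOn_of_Hs _ H0) h00.
have -> : (phi \- ft) \_ CO = (phi \_ CO - (u0 \- cst 0) \_ CO) + (u0 \- ft) \_ CO.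
  apply/funext => x; rewrite !fctE !patchE; case: ifPn => _; last by rewrite subr0 addr0.
  by rewrite /= subr0; ring.
exact: (subspaceD sV (subspaceB sV (restrict_CO_tHs Vphi) V2) V1).
Qed.

(* Injectivity of the Dirichlet form is the uniqueness half of well-posedness. *)
Lemma energy_injective phi : tHs s Omega phi -> (forall v, tHs s Omega v -> A phi v = 0) ->
  Hs_ip s phi phi = 0.
Proof.
move=> Vphi phi0; have H0 : Hs s (cst 0 : 'rV[R]_n -> R) := sH.1.
have V0 : tHs s Omega (cst 0) := sV.1.
have A0 v : tHs s Omega v -> A (cst 0) v = 0.
  by move=> Vv; have := energyB (tHs_Hs V0) (tHs_Hs V0) (tHs_Hs Vv); rewrite !subrr.
have [u0 [_ uniq]] := hwp.1 _ (HsOn_of_Hs _ H0).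
have e1 := uniq _ (weak_solution0 Vphi phi0); have e2 := uniq _ (weak_solution0 V0 A0).
have p0 : phi = cst 0 %[ae mu].
  apply: filterS3 e1 e2 (tHs_supp hs Omega_open Vphi) => x h1 h2 h3 _.
  have [Ox|/h3//] := pselect (Omega x).
  by have := h2 (OC Ox); have := h1 (OC Ox) => -> <-.
by have [] := @Hs_ip_ae0 R n s phi (Hs_measurable (tHs_Hs Vphi)) p0.
Qed.

(** Subtracting f puts the solution into the tilde space, and since f vanishes on [Omega] the values
    of [P f] there are kept. *)
Definition correction f : 'rV[R]_n -> R := (P f \- f) \_ CO.

Lemma correctionP f : Ccinf W f -> tHs s Omega (correction f) /\
  forall v, tHs s Omega v -> A (correction f) v = - A f v.
Proof.
move=> Cf; have Hf := Ccinf_Hs hs Cf.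
have [[mPf _] Bf sf] := hP (HsOn_of_Hs _ Hf).
have Vc : tHs s Omega (correction f).
  by apply: sf; [exact: HsOn_of_Hs|exact: filterE].
split=> // v Vv; have Hc := tHs_Hs Vc; have Hv := tHs_Hs Vv.
have Hcf : Hs s (correction f + f) := subspaceD sH Hc Hf.
have := BqE hs Omega_open hq hA1 hA2 hA3 Hcf mPf _ Vv; rewrite Bf// => /(_ _) E.
have : A (correction f + f) v = 0.
  apply/esym/E; apply: filterE => x Cx.
  by rewrite fctE /correction patchE mem_set//= subrK.
have L := energy_form_linear hs hq hA1 hA2 hA3 Hv 1 Hc Hf.
rewrite scale1r in L; move=> h; have : A (correction f) v + A f v = 0.
  by rewrite -h L mul1r.
by move/eqP; rewrite addr_eq0 => /eqP.
Qed.

(** Described by the variational identity instead of as the image of [correction]: P picks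
    representatives of solutions unique only almost everywhere, so it is not literally linear,
    whereas this set is visibly a subspace. *)
Definition corrections : set ('rV[R]_n -> R) :=
  [set w | tHs s Omega w /\ exists2 f, Ccinf W f & forall v, tHs s Omega v -> A w v = - A f v].

Lemma corrections_subspace : lin_subspace (corrections : set ('rV[R]_n -> R)).
Proof.
have L v : tHs s Omega v -> linear_on (@Hs R n s : set ('rV[R]_n -> R)) (A^~ v).
  by move=> Vv; exact: (energy_form_linear hs hq hA1 hA2 hA3 (tHs_Hs Vv)).
have CW := Ccinf_subspace W.
split.
  split; first exact: sV.1.
  exists (0 : 'rV[R]_n -> R); first exact: CW.1.
  move=> v Vv; have H0 := sH.1; have := energyB H0 H0 (tHs_Hs Vv).
  by rewrite !subrr => ->; rewrite oppr0.
move=> c u w [Vu [f Cf uf]] [Vw [g Cg wg]]; split; first exact: sV.2.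
exists (c *: f + g); first exact: CW.2.
move=> v Vv.
have e1 := L v Vv c _ _ (tHs_Hs Vu) (tHs_Hs Vw).
have e2 := L v Vv c _ _ (Ccinf_Hs hs Cf) (Ccinf_Hs hs Cg).
by apply: etrans e1 _; rewrite uf// wg// e2; ring.
Qed.

(* If A(f, phi) = 0 for every f supported in W, then at the points of W the
   mollifications of phi vanish together with their images under L(D), so
   antilocality propagates their vanishing to Omega. *)
Lemma energy_test phi : tHs s Omega phi -> (forall r, corrections r -> A phi r = 0) ->
  Hs_ip s phi phi = 0.
Proof.
(* phi vanishes off [Omega] only almost everywhere; psi does so everywhere, as the pointwise support
   conditions on mollified functions demand. *)
move=> Vphi phi0; pose psi := phi \_ Omega.
have Vpsi : tHs s Omega psi by exact: restrict_tHs.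
(* A(f, psi) = -A(correction f, psi), and [correction f] is one of the functions on which A(phi, -)
   is assumed to vanish. *)
have psi0 f : Ccinf W f -> A f psi = 0.
  move=> Cf; have [Vc hc] := correctionP Cf.
  apply/eqP; rewrite -oppr_eq0 -hc// energy_formC energy_restrict//.
  by apply/eqP/phi0; split => //; exists f.
have [N N0 hN] := bounded_enorm Omega_bounded.
have out z : ~ Omega z -> psi z = 0 by move=> nO; rewrite /psi patchE memNset.
have psiO z : psi z <> 0 -> Omega z by move=> h; apply: contrapT => /out.
have psiN z : ~ eball 0 N z -> psi z = 0.
  by move=> nz; apply: out; apply: contra_not nz => /hN; rewrite eball0E.
have ipsi : mu.-integrable setT (EFin \o psi).
  have sO : sqint mu (\1_(eball 0 N) : 'rV[R]_n -> R).
    by apply: sqint_indic; [exact: measurable_eball|exact: lebesgue_rV_eball_lty].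
  have := sqint_mul (Hs_sqint (tHs_Hs Vpsi)) sO.
  apply: eq_integrable => // z _ /=; congr EFin; rewrite indicE.
  have [zN|/psiN->] := pselect (eball 0 N z); last by rewrite mul0r.
  by rewrite mem_set// mulr1.
have s0 : 0 < s by case/andP: hs.
have key : {ae mu, forall x, Omega x -> psi x = 0}.
  apply: (ae_mollified_eq0 s0 (tHs_Hs Vpsi) ipsi) => x /Omega_W[x1 Wx1 [y Cy xE]].
  have [r r0 hr] := (open_enormP W).1 W_open _ Wx1.
  have r4 : 0 < r / 4 by rewrite divr_gt0.
  (* For x0 within r/4 of x1 and e < r/4, the ball of radius e about x0 stays in W, while points of
     [Omega], at distance at least r from x1, are at distance at least 3r/4 >= e + r/2 from x0. So
     r/2 serves as the truncation length d. *)
  exists (r / 4) => // e e0 er.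
  pose U : set 'rV[R]_n := [set z | enorm (x1 - z) < r / 4].
  apply: (hanti (convol_mollifier_Ccinf e0 ipsi psiN) (U := U)).
  - apply/open_enormP => z Uz; exists (r / 4 - enorm (x1 - z)); first by rewrite subr_gt0.
    move=> z' zz'; rewrite /U /=; have := enormD (x1 - z) (z - z').
    by rewrite addrA subrK; lra.
  - by exists x1; rewrite /U /= subrr enorm0.
  - move=> x0 Ux0.
    have r2 : 0 < r / 2 by rewrite divr_gt0.
    have far z : psi z <> 0 -> e + r / 2 <= enorm (z - x0).
      move=> /psiO Oz; have nW : ~ W z by move=> /W_Omega.
      have : r <= enorm (x1 - z) by rewrite leNgt; apply/negP => /hr.
      have := enormD (x1 - x0) (x0 - z); rewrite addrA subrK (enormB x0 z).
      move: Ux0; rewrite /U /=; lra.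
    split; first exact: (mollification_eq0 e0 r2 far).
    rewrite (LD_mollification Omega q hs hA1 hA2 hA3 ipsi e0 r2 far) psi0 ?mulr0//.
    apply: Ccinf_mollifier => // z; rewrite /eball /= => zx0; apply: hr.
    have := enormD (x1 - x0) (x0 - z); rewrite addrA subrK (enormB x0 z).
    move: Ux0; rewrite /U /=; lra.
  - by exists x1; [rewrite /U /= subrr enorm0|exists y].
have p0 : phi = cst 0 %[ae mu].
  apply: filterS2 key (tHs_supp hs Omega_open Vphi) => x h1 h2 _.
  have [Ox|/h2//] := pselect (Omega x).
  by have := h1 Ox; rewrite /psi patchE mem_set.
by have [] := @Hs_ip_ae0 R n s phi (Hs_measurable (tHs_Hs Vphi)) p0.
Qed.

Lemma poisson_restrict f : Ccinf W f -> tHs s Omega ((P f) \_ Omega) /\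
  Hs_ip s (correction f - (P f) \_ Omega) (correction f - (P f) \_ Omega) = 0.
Proof.
move=> Cf; have [Vc _] := correctionP Cf.
have E : (P f) \_ Omega = correction f \_ Omega.
  apply/funext => x; rewrite !patchE; case: ifPn => // /set_mem Ox.
  by rewrite /correction patchE (mem_set (OC Ox)) /= (Ccinf_W_Omega Cf Ox) subr0.
rewrite E; split; first exact: restrict_tHs.
have p0 : correction f - correction f \_ Omega = cst 0 %[ae mu].
  apply: filterS (tHs_supp hs Omega_open Vc) => x h _; rewrite !fctE patchE.
  by case: ifPn => [_|/negP nx]; rewrite ?subrr// h ?subr0// => Ox; apply: nx; rewrite inE.
have mB := Hs_measurable (tHs_Hs (subspaceB sV Vc (restrict_tHs Vc))).
by have [] := @Hs_ip_ae0 R n s _ mB p0.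
Qed.

Lemma runge_dense : Hs_dense s (tHs s Omega) (runge_set Omega W P).
Proof.
split=> [_ [f Cf <-]|w Vw e e0]; first by case: (poisson_restrict Cf).
have e4 : 0 < e ^+ 2 / 4 by rewrite divr_gt0 ?exprn_gt0.
have [r [Vr [f Cf rf]] hr] := energy_form_density hs Omega_open Omega_bounded hq hA1 hA2 hA3
  corrections_subspace (fun u => @proj1 _ _) energy_injective energy_test Vw e4.
have [Vc hc] := correctionP Cf; have [VP cP] := poisson_restrict Cf.
exists ((P f) \_ Omega); first by exists f.
have Hw := tHs_Hs Vw; have Hr := tHs_Hs Vr; have Hc := tHs_Hs Vc; have HP := tHs_Hs VP.
(* r and [correction f] satisfy the same variational identity, so injectivity of the form makes
   their difference null; [P f] on [Omega] in turn differs from [correction f] by a null function,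
   and the approximation of w by r carries over. *)
have rc : Hs_ip s (r - correction f) (r - correction f) = 0.
  apply: energy_injective; first exact: subspaceB sV Vr Vc.
  by move=> v Vv; rewrite energyB ?rf ?hc ?subrr//; exact: tHs_Hs Vv.
have t1 := sip_quasi_triangle sH ipV Hr Hc HP.
have t2 := sip_quasi_triangle sH ipV Hw Hr HP.
rewrite rc cP mulr0 addr0 in t1.
rewrite Hs_norm_lt//; last exact: (subspaceB sH Hw HP).
apply: le_lt_trans t2 _; lra.
Qed.

End runge_approximation.

Theorem theorem2 (R : realType) (n : nat) (s : R) (a : 'rV[R]_n -> R)
    (C Omega W : set 'rV[R]_n) (q : 'rV[R]_n -> R)
    (P : ('rV[R]_n -> R) -> 'rV[R]_n -> R)
    (hs : 0 < s < 1)
    (Omega_open : open Omega) (Omega0 : Omega !=set0)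
    (Omega_bounded : bounded_set Omega)
    (hq : (q \_ Omega) \in Lfun (lebesgue_rV n) +oo%E)
    (hA1 : condA1 s a) (hA2 : condA2 a) (hA3 : condA3 a C)
    (hwp : well_posed s a C q Omega)
    (hP : poisson_operator s a C q Omega P)
    (hanti : antilocal s a C)
    (W_open : open W) (W_ext : W `<=` exterior C Omega)
    (Omega_W : Omega `<=` cone_nbhd C W) :
  Hs_dense s (tHs s Omega) (runge_set Omega W P).
Proof.
exact: (runge_dense hs Omega_open Omega_bounded hq hA1 hA2 hA3 hwp hP hanti
  W_open W_ext Omega_W).
Qed.
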